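(* For every complete ccdg-Hopf algebra $\Omega$ there is a natural isomorphism $(\mathbf{exp},\mathbf{ln})$ of set-valued presheaves $$\mathbf{exp}:\grave{T\mathfrak{P}}_\Omega\Rightarrow\grave{\mathfrak{P}}_\Omega,\qquad \mathbf{ln}:\grave{\mathfrak{P}}_\Omega\Rightarrow\grave{T\mathfrak{P}}_\Omega\ :\ (ho\,\mathbf{ccdgC}(\Bbbk))^{op}\to\mathbf{Set}$$ (inverse to each other), whose components $(\mathbf{exp}^C,\mathbf{ln}^C)$ at each ccdg-coalgebra $C$ are defined, for all $[g]\in\mathrm{Hom}_{ho\,\mathbf{ccdgC}(\Bbbk)}(C,\Omega)$ and $[\upsilon]\in\mathrm{THom}_{ho\,\mathbf{ccdgC}(\Bbbk)}(C,\Omega)$, by $$\mathbf{exp}^C([\upsilon]):=\Big[u_\Omega\circ\epsilon_C+\sum_{n=1}^\infty\frac{1}{n!}\,m_\Omega^{(n)}\circ(\upsilon\hat\otimes\cdots\hat\otimes\upsilon)\circ\Delta_C^{(n)}\Big],$$ $$\mathbf{ln}^C([g]):=\Big[-\sum_{n=1}^\infty\frac{(-1)^n}{n}\,m_\Omega^{(n)}\circ(\bar g\hat\otimes\cdots\hat\otimes\bar g)\circ\Delta_C^{(n)}\Big],$$ where $g\in\mathrm{Hom}_{\mathbf{ccdgC}(\Bbbk)}(C,\Omega)$ and $\upsilon\in\mathrm{THom}_{\mathbf{ccdgC}(\Bbbk)}(C,\Omega)$ are arbitrary representatives of the homotopy types $[g]$ and $[\upsilon]$, and $\bar g:=g-u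_\Omega\circ\epsilon_C$.
   Context: $\Bbbk$ is a field of characteristic zero. All graded objects are $\mathbb{Z}$-graded with homological grading (differentials have degree $-1$), $\otimes=\otimes_\Bbbk$, and the Koszul sign rule is used. For chain complexes $V,W$, $\mathrm{Hom}(V,W)_n$ is the space of $\Bbbk$-linear maps raising degree by $n$, $\mathrm{Hom}(V,W)=\bigoplus_n\mathrm{Hom}(V,W)_n$, with differential $\partial_{V,W}f=\partial_W\circ f-(-1)^{|f|}f\circ\partial_V$. A ccdg-coalgebra $C=(C,\epsilon_C,\Delta_C,\partial_C)$ is a counital coassociative graded-cocommutative dg-coalgebra over $\Bbbk$. Morphisms are degree $0$ chain maps compatible with counits and coproducts; the category is $\mathbf{ccdgC}(\Bbbk)$. A ccdg-Hopf algebra $\Omega=(\Omega,u_\Omega,m_\Omega,\epsilon_\Omega,\Delta_\Omega,\varsigma_\Omega,\partial_\Omega)$ is simultaneously a unital associative dg-algebra and a ccdg-coalgebra such that $\epsilon_\Omega,\Delta_\Omega$ are dg-algebra morphisms, with an antipode $\varsigma_\Omega$ (degree $0$ linear, $m_\Omega(\varsigma_\Omega\otimes\mathbb{I})\Delta_\Omega=m_\Omega(\mathbb{I}\otimes\varsigma_\Omega)\Delta_\Omega=u_\Omega\epsilon_\Omega$). Completion: for a ccdg-Hopf algebra $\Omega$ let $\mathfrak{I}=\ker\epsilon_\Omega$ with powers $\mathfrak{I}^n=m_\Omega^{(n)}(\mathfrak{I}\otimes\cdots\otimes\mathfrak{I})$, $\mathfrak I^0=\Omega$. All structure maps are compatible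 with this filtration; $\hat\Omega=\varprojlim\Omega/\mathfrak{I}^{n+1}$ is complete with filtration $F^n\hat\Omega=\ker(\hat\Omega\to\Omega/\mathfrak{I}^{n})$ (so that elements lying in arbitrarily high powers can be summed), and the structure maps extend, with coproduct $\hat\Omega\to\hat\Omega\hat\otimes\hat\Omega$ valued in the tensor product completed with respect to the filtration $F^n(\hat\Omega\otimes\hat\Omega)=\sum_{i+j=n}F^i\hat\Omega\otimes F^j\hat\Omega$. A complete ccdg-Hopf algebra is one with $\Omega=\hat\Omega$ with these extended structure maps; all the conditions below involving $\Delta_\Omega$ are then understood with $\hat\otimes$ in the target. $m_\Omega^{(n)}$ is the $n$-fold iterated product ($m^{(1)}_\Omega=\mathbb{I}_\Omega$) and $\Delta_C^{(n)}:C\to C^{\otimes n}$ the $n$-fold iterated coproduct ($\Delta^{(1)}_C=\mathbb{I}_C$). A homotopy pair on $\mathrm{Hom}_{\mathbf{ccdgC}(\Bbbk)}(C,C')$ is a pair $(f(t),\xi(t))\in\mathrm{Hom}(C,C')_0[t]\oplus\mathrm{Hom}(C,C')_1[t]$ (polynomial in $t$) with $\frac{d}{dt}f(t)=\partial_{C,C'}\xi(t)$, $f(0)$ a morphism of ccdg-coalgebras, $\epsilon_{C'}\circ\xi(t)=0$ and $\Delta_{C'}\circ\xi(t)=(f(t)\otimes\xi(t)+\xi(t)\otimes f(t))\circ\Delta_C$; $f\sim\tilde f$ if there is such a pair with $f(0)=f,f(1)=\tilde f$. Homotopy types $[f]$ are classes for the equivalence relation (generated by) $\sim$; $ho\,\mathbf{ccdgC}(\Bbbk)$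 has ccdg-coalgebras as objects and homotopy types as morphisms. Put $e:=u_\Omega\circ\epsilon_C$. $\mathrm{THom}_{\mathbf{ccdgC}(\Bbbk)}(C,\Omega)$ is the set of $\upsilon\in\mathrm{Hom}(C,\Omega)_0$ with $\partial_{C,\Omega}\upsilon=0$, $\epsilon_\Omega\circ\upsilon=0$, $\Delta_\Omega\circ\upsilon=(e\otimes\upsilon+\upsilon\otimes e)\circ\Delta_C$. A homotopy pair on it is $(\upsilon(t),\sigma(t))\in\mathrm{Hom}(C,\Omega)_0[t]\oplus\mathrm{Hom}(C,\Omega)_1[t]$ with $\frac{d}{dt}\upsilon(t)=\partial_{C,\Omega}\sigma(t)$, $\upsilon(0)\in\mathrm{THom}_{\mathbf{ccdgC}(\Bbbk)}(C,\Omega)$, $\epsilon_\Omega\circ\sigma(t)=0$, $\Delta_\Omega\circ\sigma(t)=(e\otimes\sigma(t)+\sigma(t)\otimes e)\circ\Delta_C$; $\upsilon\sim\tilde\upsilon$ if connected by such a pair, and $\mathrm{THom}_{ho\,\mathbf{ccdgC}(\Bbbk)}(C,\Omega)$ is the set of homotopy types. $\grave{\mathfrak{P}}_\Omega$ and $\grave{T\mathfrak{P}}_\Omega$ are the set-valued presheaves on $ho\,\mathbf{ccdgC}(\Bbbk)$ sending $C$ to $\mathrm{Hom}_{ho\,\mathbf{ccdgC}(\Bbbk)}(C,\Omega)$, respectively $\mathrm{THom}_{ho\,\mathbf{ccdgC}(\Bbbk)}(C,\Omega)$, and $[f]:C\to C'$ to precomposition with $f$, $[g']\mapsto[g'\circ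 f]$, respectively $[\upsilon']\mapsto[\upsilon'\circ f]$.
   Formalization: Homotopy pairs with values in the complete Ω are taken as power series in t that are polynomial modulo every filtration step F^n, instead of polynomials in t; with honest polynomials exp is not well defined on homotopy types (e.g. C = k, Ω the completion of T(x,y) with dx = y). *)

(* Defs.v *)
From HB Require Import structures.
From mathcomp Require Import all_boot all_order all_algebra.
From mathcomp Require Import boolp classical_sets functions cardinality fsbigop.
From Stdlib Require Import Relation_Operators.

Set Implicit Arguments.
Unset Strict Implicit.
Unset Printing Implicit Defensive.

Import GRing.Theory.
Local Open Scope quotient_scope.
Local Open Scope classical_set_scope.
Local Open Scope ring_scope.

(** * Tensor products of vector spaces *)

Section Bilinear.
Variables (k : fieldType) (V W U : lmodType k).

Definition bilin (B : V -> W -> U) : Prop :=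
  (forall w, linear (B^~ w)) /\ (forall v, linear (B v)).

Variable B : V -> W -> U.
Hypothesis bB : bilin B.

Lemma bilinDl u v w : B (u + v) w = B u w + B v w.
Proof. by have := bB.1 w 1 u v; rewrite !scale1r. Qed.

Lemma bilinDr u v w : B u (v + w) = B u v + B u w.
Proof. by have := bB.2 u 1 v w; rewrite !scale1r. Qed.

Lemma bilin0l w : B 0 w = 0.
Proof. by have /(canLR (addrK _)) := bilinDl 0 0 w; rewrite addr0 subrr. Qed.

Lemma bilin0r v : B v 0 = 0.
Proof. by have /(canLR (addrK _)) := bilinDr v 0 0; rewrite addr0 subrr. Qed.

Lemma bilinZl a v w : B (a *: v) w = a *: B v w.
Proof. by have := bB.1 w a v 0; rewrite !addr0 bilin0l addr0. Qed.

Lemma bilinZr a v w : B v (a *: w) = a *: B v w.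
Proof. by have := bB.2 v a w 0; rewrite !addr0 bilin0r addr0. Qed.

Lemma bilin_suml I (r : seq I) (P : pred I) F w :
  B (\sum_(i <- r | P i) F i) w = \sum_(i <- r | P i) B (F i) w.
Proof.
by apply: (big_morph (B^~ w)) => [u v|]; rewrite ?bilinDl ?bilin0l.
Qed.

Lemma bilin_sumr I (r : seq I) (P : pred I) F v :
  B v (\sum_(i <- r | P i) F i) = \sum_(i <- r | P i) B v (F i).
Proof.
by apply: (big_morph (B v)) => [u w|]; rewrite ?bilinDr ?bilin0r.
Qed.

End Bilinear.

Section Tensor.
Variables (k : fieldType) (V W : lmodType k).

(* [:: (v1, w1); ...; (vn, wn)] stands for the sum of the vi (x) wi; two formal
   sums are identified when no bilinear map separates them. *)
Definition tens_rel (s t : seq (V * W)) : bool :=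
  `[< forall (U : lmodType k) (B : V -> W -> U), bilin B ->
        \sum_(p <- s) B p.1 p.2 = \sum_(p <- t) B p.1 p.2 >].

Lemma tens_rel_refl : reflexive tens_rel.
Proof. by move=> s; apply/asboolP. Qed.

Lemma tens_rel_sym : symmetric tens_rel.
Proof.
by move=> s t; apply/asboolP/asboolP => h U B bB; rewrite h.
Qed.

Lemma tens_rel_trans : transitive tens_rel.
Proof.
move=> t s u /asboolP h1 /asboolP h2; apply/asboolP => U B bB.
by rewrite h1 // h2.
Qed.

Canonical tens_equiv :=
  EquivRel tens_rel tens_rel_refl tens_rel_sym tens_rel_trans.

Definition tens := {eq_quot tens_equiv}.
HB.instance Definition _ := Choice.on tens.
HB.instance Definition _ := EqQuotient.on tens.

Definition tens_mk (s : seq (V * W)) : tens := \pi_tens s.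

Definition tpure (v : V) (w : W) : tens := tens_mk [:: (v, w)].

Definition tlift (U : lmodType k) (B : V -> W -> U) (x : tens) : U :=
  \sum_(p <- repr x) B p.1 p.2.

Lemma tlift_mk (U : lmodType k) (B : V -> W -> U) s :
  bilin B -> tlift B (tens_mk s) = \sum_(p <- s) B p.1 p.2.
Proof.
move=> bB; rewrite /tlift /tens_mk.
have /eqquotP/asboolP : repr (\pi_tens s) = s %[mod tens] by rewrite reprK.
exact.
Qed.

Lemma tens_ext (x y : tens) :
  (forall (U : lmodType k) (B : V -> W -> U), bilin B -> tlift B x = tlift B y)
  -> x = y.
Proof.
move=> h; rewrite -[x]reprK -[y]reprK; apply/eqquotP/asboolP.
exact: h.
Qed.

Definition tens_zero : tens := tens_mk [::].
Definition tens_add (x y : tens) : tens := tens_mk (repr x ++ repr y).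
Definition tens_scale (a : k) (x : tens) : tens :=
  tens_mk [seq (a *: p.1, p.2) | p <- repr x].
Definition tens_opp (x : tens) : tens := tens_scale (-1) x.

Section Lift.
Variables (U : lmodType k) (B : V -> W -> U).
Hypothesis bB : bilin B.

Fact tlift_zero : tlift B tens_zero = 0.
Proof. by rewrite tlift_mk // big_nil. Qed.

Fact tlift_add x y : tlift B (tens_add x y) = tlift B x + tlift B y.
Proof. by rewrite tlift_mk // big_cat. Qed.

Fact tlift_scale a x : tlift B (tens_scale a x) = a *: tlift B x.
Proof.
rewrite tlift_mk // big_map scaler_sumr; apply: eq_bigr => p _ /=.
exact: bilinZl.
Qed.
End Lift.

Fact tens_addA : associative tens_add.
Proof. by move=> x y z; apply: tens_ext => U B b; rewrite !tlift_add // addrA. Qed.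
Fact tens_addC : commutative tens_add.
Proof. by move=> x y; apply: tens_ext => U B b; rewrite !tlift_add // addrC. Qed.
Fact tens_add0 : left_id tens_zero tens_add.
Proof.
by move=> x; apply: tens_ext => U B b; rewrite !tlift_add // tlift_zero // add0r.
Qed.
Fact tens_addN : left_inverse tens_zero tens_opp tens_add.
Proof.
move=> x; apply: tens_ext => U B b.
by rewrite !tlift_add // tlift_zero // tlift_scale // scaleN1r addNr.
Qed.

HB.instance Definition _ :=
  GRing.isZmodule.Build tens tens_addA tens_addC tens_add0 tens_addN.

Fact tens_scaleA a b x : tens_scale a (tens_scale b x) = tens_scale (a * b) x.
Proof. by apply: tens_ext => U B bB; rewrite !tlift_scale // scalerA. Qed.
Fact tens_scale1 : left_id 1 tens_scale.
Proof. by move=> x; apply: tens_ext => U B bB; rewrite !tlift_scale // scale1r. Qed.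
Fact tens_scaleDr : right_distributive tens_scale +%R.
Proof.
move=> a x y; apply: tens_ext => U B bB.
by rewrite ?(tlift_scale, tlift_add) // scalerDr.
Qed.
Fact tens_scaleDl x : {morph tens_scale^~ x : a b / a + b}.
Proof.
move=> a b; apply: tens_ext => U B bB.
by rewrite ?(tlift_scale, tlift_add) // scalerDl.
Qed.

HB.instance Definition _ := GRing.Zmodule_isLmodule.Build k tens
  tens_scaleA tens_scale1 tens_scaleDr tens_scaleDl.

Lemma tliftP (U : lmodType k) (B : V -> W -> U) :
  bilin B -> linear (tlift B).
Proof. by move=> bB a x y; rewrite -tlift_scale // -tlift_add. Qed.

Lemma tlift_pure (U : lmodType k) (B : V -> W -> U) v w :
  bilin B -> tlift B (tpure v w) = B v w.
Proof. by move=> bB; rewrite tlift_mk // big_seq1. Qed.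

Lemma tpure_bilin : bilin tpure.
Proof.
by split=> [w a u v|v a u w]; apply: tens_ext => U B bB;
  rewrite tliftP // !tlift_pure // ?bB.1 ?bB.2.
Qed.

Lemma tens_sum (x : tens) : x = \sum_(p <- repr x) tpure p.1 p.2.
Proof.
apply: tens_ext => U B bB.
rewrite (big_morph (tlift B) (id1 := 0) (op1 := +%R)) => [|u v|].
- by apply: eq_bigr => p _; rewrite tlift_pure.
- exact: tlift_add.
- exact: tlift_zero.
Qed.

Lemma tens_linear_ext (U : lmodType k) (f g : tens -> U) :
  linear f -> linear g ->
  (forall v w, f (tpure v w) = g (tpure v w)) -> f =1 g.
Proof.
move=> lf lg h x.
have L (e : tens -> U) : linear e ->
    forall s, e (\sum_(p <- s) tpure p.1 p.2) = \sum_(p <- s) e (tpure p.1 p.2).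
  move=> le s.
  have e0 : e 0 = 0.
    by have := le (-1) 0 0; rewrite scaler0 addr0 scaleN1r addNr.
  apply: (big_morph e) => // u v.
  by have := le 1 u v; rewrite !scale1r.
by rewrite [x]tens_sum !L //; apply: eq_bigr => p _.
Qed.

End Tensor.

Arguments tlift {k V W U} B x.
Arguments tpure {k V W} v w.

Section TensorMaps.
Variable k : fieldType.
Implicit Types V W : lmodType k.

(* without Koszul sign: the tensor product of maps if g has degree 0, see [gtmap]
   for the general case *)
Definition tmap V W V' W' (f : V -> V') (g : W -> W') : tens V W -> tens V' W' :=
  tlift (fun x y => tpure (f x) (g y)).

Definition tassoc V W X : tens (tens V W) X -> tens V (tens W X) :=
  tlift (fun t z => tlift (fun x y => tpure x (tpure y z)) t).

(* [tpow V n] is the (n+1)-st tensor power of V *)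
Fixpoint tpow V (n : nat) : lmodType k :=
  if n is n'.+1 then tens V (tpow V n') else V.

Fixpoint tpow_map V W (f : V -> W) (n : nat) {struct n} :
    tpow V n -> tpow W n :=
  if n is n'.+1 return tpow V n -> tpow W n then tmap f (@tpow_map V W f n')
  else f.

End TensorMaps.

(** * Graded vector spaces and chain complexes *)

Section DG.
Variable k : fieldType.

(* A chain complex structure on V: [gpr n] is the projection onto the degree n
   summand, and the degree n part V_n is the image of [gpr n]. *)
Record dgmod (V : lmodType k) := DGmod {
  gpr : int -> {linear V -> V};
  gdif : {linear V -> V};
  gpr_idem : forall i j v, gpr i (gpr j v) = if i == j then gpr j v else 0;
  gpr_fin : forall v, finite_set [set i | gpr i v != 0];
  gpr_sum : forall v, v = \sum_(i \in [set: int]) gpr i v;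
  gdif_deg : forall i v, gdif (gpr i v) = gpr (i - 1) (gdif v);
  gdif_dif : forall v, gdif (gdif v) = 0
}.

Definition homog (V : lmodType k) (X : dgmod V) (n : int) : set V :=
  [set v | gpr X n v = v].

Definition degmap (V W : lmodType k) (X : dgmod V) (Y : dgmod W) (n : int)
    (f : V -> W) : Prop :=
  forall i v, homog X i v -> homog Y (i + n) (f v).

Definition hom_dif (V W : lmodType k) (X : dgmod V) (Y : dgmod W) (n : nat)
    (f : V -> W) (v : V) : W :=
  gdif Y (f v) - (-1) ^+ n *: f (gdif X v).

(* v |-> (-1)^(n |v|) v *)
Definition ksgn (V : lmodType k) (X : dgmod V) (n : nat) (v : V) : V :=
  \sum_(i \in [set: int]) (-1) ^+ (n * absz i) *: gpr X i v.

(* (v, w) |-> (-1)^(|v| |w|) B v w *)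
Definition koszul (V W U : lmodType k) (X : dgmod V) (Y : dgmod W)
    (B : V -> W -> U) (v : V) (w : W) : U :=
  \sum_(j \in [set: int]) B (ksgn X (absz j) v) (gpr Y j w).

(* f (x) g for g of degree n: x (x) y |-> (-1)^(n |x|) f x (x) g y *)
Definition gtmap (V W V' W' : lmodType k) (X : dgmod V) (n : nat)
    (f : V -> V') (g : W -> W') : tens V W -> tens V' W' :=
  tmap (f \o ksgn X n) g.

Definition tswap (V W : lmodType k) (X : dgmod V) (Y : dgmod W) :
    tens V W -> tens W V :=
  tlift (koszul X Y (fun x y => tpure y x)).

Definition tdif (V W : lmodType k) (X : dgmod V) (Y : dgmod W) (t : tens V W) :
    tens V W :=
  tmap (gdif X) id t + gtmap X 1 id (gdif Y) t.

Definition subspace (V : lmodType k) (P : set V) : Prop :=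
  P 0 /\ forall a u v, P u -> P v -> P (a *: u + v).

Definition lspan (V : lmodType k) (S : set V) : set V :=
  [set v | forall P : set V, subspace P -> S `<=` P -> P v].

Definition thomog (V W : lmodType k) (X : dgmod V) (Y : dgmod W) (n : int) :
    set (tens V W) :=
  lspan [set t | exists i j v w,
    [/\ i + j = n, homog X i v, homog Y j w & t = tpure v w]].

End DG.

(** * Filtrations and completion *)

Section Filtration.
Variable k : fieldType.

Record filt (V : lmodType k) := Filt {
  fil :> nat -> set V;
  fil_sub : forall n, subspace (fil n);
  fil_dec : forall n, fil n.+1 `<=` fil n
}.

Section FiltTheory.
Variables (V : lmodType k) (F : filt V) (n : nat).

Lemma fil0 : F n 0. Proof. exact: (fil_sub F n).1. Qed.
Lemma filZ a u : F n u -> F n (a *: u).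
Proof. by move=> h; have := (fil_sub F n).2 a u 0 h fil0; rewrite addr0. Qed.
Lemma filD u v : F n u -> F n v -> F n (u + v).
Proof. by move=> h h'; have := (fil_sub F n).2 1 u v h h'; rewrite scale1r. Qed.
Lemma filN u : F n u -> F n (- u).
Proof. by move=> h; rewrite -scaleN1r; apply: filZ. Qed.
Lemma filB u v : F n u -> F n v -> F n (u - v).
Proof. by move=> h h'; apply/filD/filN. Qed.
Lemma filC u v : F n (u - v) -> F n (v - u).
Proof. by move=> h; rewrite -opprB; apply: filN. Qed.
End FiltTheory.

Lemma lspan_sub (V : lmodType k) (S : set V) : subspace (lspan S).
Proof.
split=> [P [P0 _] _ //|a u v hu hv P sP SP].
by apply: sP.2; [apply: hu|apply: hv].
Qed.

Section TensFilt.
Variables (V W : lmodType k) (F : filt V) (G : filt W).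

Definition tfil (n : nat) : set (tens V W) :=
  lspan [set t | exists i j v w,
    [/\ (i + j)%N = n, F i v, G j w & t = tpure v w]].

Fact tfil_dec n : tfil n.+1 `<=` tfil n.
Proof.
move=> t; apply; first exact: lspan_sub.
move=> _ [[|i] [j [v [w [ijn Fv Gw ->]]]]] P _; apply.
- by exists 0, n, v, w; split=> //; apply: fil_dec; rewrite -ijn.
- by exists i, j, v, w; split=> //; [case: ijn|apply: fil_dec].
Qed.

Definition tens_filt : filt (tens V W) :=
  Filt (fun n => lspan_sub _) tfil_dec.
End TensFilt.

Section Completion.
Variables (V : lmodType k) (F : filt V).

(* A point of lim_n V / F^n is represented by a sequence s, whose n-th term
   represents its component in V / F^n. *)
Definition coherent (s : nat -> V) : Prop := forall n, F n (s n.+1 - s n).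

Definition cseq := {s : nat -> V | `[< coherent s >]}.

Definition cpl_rel (s t : cseq) : bool :=
  `[< forall n, F n (val s n - val t n) >].

Fact cpl_rel_refl : reflexive cpl_rel.
Proof. by move=> s; apply/asboolP => n; rewrite subrr; exact: fil0. Qed.
Fact cpl_rel_sym : symmetric cpl_rel.
Proof. by move=> s t; apply/asboolP/asboolP => h n; apply: filC. Qed.
Fact cpl_rel_trans : transitive cpl_rel.
Proof.
move=> t s u /asboolP h /asboolP h'; apply/asboolP => n.
by rewrite -(subrKA (val t n)); apply: filD.
Qed.

Canonical cpl_equiv :=
  EquivRel cpl_rel cpl_rel_refl cpl_rel_sym cpl_rel_trans.

Definition cpl := {eq_quot cpl_equiv}.
HB.instance Definition _ := Choice.on cpl.
HB.instance Definition _ := EqQuotient.on cpl.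

Fact coherent_cst v : `[< coherent (fun=> v) >].
Proof. by apply/asboolP => n; rewrite subrr; exact: fil0. Qed.

Definition cseq0 : cseq :=
  exist (fun s => `[< coherent s >]) (fun=> 0) (coherent_cst 0).

(* the point represented by s, if s is coherent; the point 0 otherwise *)
Definition cpl_mk (s : nat -> V) : cpl :=
  \pi_cpl (insubd cseq0 s).

(* a representative in V of the component of x in V / F^n *)
Definition cpl_at (x : cpl) (n : nat) : V := val (repr x) n.

Definition cpl_eta (v : V) : cpl := cpl_mk (fun=> v).

Lemma cpl_at_coherent x : coherent (cpl_at x).
Proof. by apply/asboolP; exact: (valP (repr x)). Qed.

Lemma cpl_at_mk s n : coherent s -> F n (cpl_at (cpl_mk s) n - s n).
Proof.
move=> cs; rewrite /cpl_at /cpl_mk; set z := insubd _ s.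
have -> : s = val z by rewrite val_insubd; case: asboolP.
have /eqquotP/asboolP : repr (\pi_cpl z) = z %[mod cpl] by rewrite reprK.
exact.
Qed.

Lemma cpl_ext x y : (forall n, F n (cpl_at x n - cpl_at y n)) -> x = y.
Proof. by move=> h; rewrite -[x]reprK -[y]reprK; apply/eqquotP/asboolP. Qed.

Lemma cpl_mkP x s : coherent s -> (forall n, F n (cpl_at x n - s n)) ->
  x = cpl_mk s.
Proof.
move=> cs h; apply: cpl_ext => n; rewrite -(subrKA (s n)); apply: filD => //.
by apply: filC; exact: cpl_at_mk.
Qed.

Lemma cpl_at_eta v n : F n (cpl_at (cpl_eta v) n - v).
Proof. by apply: cpl_at_mk => m; rewrite subrr; exact: fil0. Qed.

Definition cpl_add (x y : cpl) : cpl := cpl_mk (fun n => cpl_at x n + cpl_at y n).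
Definition cpl_scale (a : k) (x : cpl) : cpl := cpl_mk (fun n => a *: cpl_at x n).
Definition cpl_opp (x : cpl) : cpl := cpl_scale (-1) x.
Definition cpl_zero : cpl := cpl_eta 0.

Fact cpl_at_add x y n :
  F n (cpl_at (cpl_add x y) n - (cpl_at x n + cpl_at y n)).
Proof.
apply: (cpl_at_mk (s := fun n => _)) => m.
by rewrite opprD addrACA; apply: filD; exact: cpl_at_coherent.
Qed.

Fact cpl_at_scale a x n : F n (cpl_at (cpl_scale a x) n - a *: cpl_at x n).
Proof.
apply: (cpl_at_mk (s := fun n => _)) => m.
by rewrite -scalerBr; apply: filZ; exact: cpl_at_coherent.
Qed.

(* congruence modulo F^n *)
Let eqm n (u v : V) := F n (u - v).
Let eqmT n v u w : eqm n u v -> eqm n v w -> eqm n u w.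
Proof. by move=> h h'; rewrite /eqm -(subrKA v); apply: filD. Qed.
Let eqmS n u v : eqm n u v -> eqm n v u.
Proof. exact: filC. Qed.
Let eqmD n u v u' v' : eqm n u v -> eqm n u' v' -> eqm n (u + u') (v + v').
Proof. by move=> h h'; rewrite /eqm opprD addrACA; apply: filD. Qed.
Let eqmZ n a u v : eqm n u v -> eqm n (a *: u) (a *: v).
Proof. by move=> h; rewrite /eqm -scalerBr; apply: filZ. Qed.
Let eqmR n u : eqm n u u.
Proof. by rewrite /eqm subrr; exact: fil0. Qed.

Fact cpl_addA : associative cpl_add.
Proof.
move=> x y z; apply: cpl_ext => n; rewrite -/(eqm n _ _).
apply: eqmT (cpl_at_add _ _ _) _; apply: eqmS; apply: eqmT (cpl_at_add _ _ _) _.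
apply: eqmT (eqmD (cpl_at_add _ _ _) (eqmR _ _)) _; rewrite -addrA.
by apply: eqmD; [exact: eqmR|apply: eqmS; exact: cpl_at_add].
Qed.
Fact cpl_addC : commutative cpl_add.
Proof. by move=> x y; rewrite /cpl_add; congr cpl_mk; apply/funext => n; rewrite addrC. Qed.
Fact cpl_add0 : left_id cpl_zero cpl_add.
Proof.
move=> x; apply: cpl_ext => n; rewrite -/(eqm n _ _).
apply: eqmT (cpl_at_add _ _ _) _.
by have := eqmD (cpl_at_eta 0 n) (eqmR n (cpl_at x n)); rewrite add0r.
Qed.
Fact cpl_addN : left_inverse cpl_zero cpl_opp cpl_add.
Proof.
move=> x; apply: cpl_ext => n; rewrite -/(eqm n _ _).
apply: eqmT (cpl_at_add _ _ _) _.
apply: eqmT (eqmD (cpl_at_scale _ _ _) (eqmR _ _)) _.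
by rewrite scaleN1r addNr; apply: eqmS; exact: cpl_at_eta.
Qed.

HB.instance Definition _ :=
  GRing.isZmodule.Build cpl cpl_addA cpl_addC cpl_add0 cpl_addN.

Fact cpl_scaleA a b x : cpl_scale a (cpl_scale b x) = cpl_scale (a * b) x.
Proof.
apply: cpl_ext => n; rewrite -/(eqm n _ _).
apply: eqmT (cpl_at_scale _ _ _) _; apply: eqmT (eqmZ _ (cpl_at_scale _ _ _)) _.
by rewrite scalerA; apply: eqmS; exact: cpl_at_scale.
Qed.
Fact cpl_scale1 : left_id 1 cpl_scale.
Proof.
move=> x; apply: cpl_ext => n; rewrite -/(eqm n _ _).
by apply: eqmT (cpl_at_scale _ _ _) _; rewrite scale1r; exact: eqmR.
Qed.
Fact cpl_scaleDr : right_distributive cpl_scale +%R.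
Proof.
move=> a x y; apply: cpl_ext => n; rewrite -/(eqm n _ _).
apply: eqmT (cpl_at_scale _ _ _) _; apply: eqmT (eqmZ _ (cpl_at_add _ _ _)) _.
apply: eqmS; apply: eqmT (cpl_at_add _ _ _) _; rewrite scalerDr.
by apply: eqmD; exact: cpl_at_scale.
Qed.
Fact cpl_scaleDl x : {morph cpl_scale^~ x : a b / a + b}.
Proof.
move=> a b; apply: cpl_ext => n; rewrite -/(eqm n _ _).
apply: eqmT (cpl_at_scale _ _ _) _; apply: eqmS.
apply: eqmT (cpl_at_add _ _ _) _; rewrite scalerDl.
by apply: eqmD; exact: cpl_at_scale.
Qed.

HB.instance Definition _ := GRing.Zmodule_isLmodule.Build k cpl
  cpl_scaleA cpl_scale1 cpl_scaleDr cpl_scaleDl.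

End Completion.

(* Extension by continuity of filtered maps to completions *)

Definition cpl_map (V W : lmodType k) (F : filt V) (G : filt W)
    (f : V -> W) (x : cpl F) : cpl G :=
  cpl_mk G (fun n => f (cpl_at x n)).

Definition cpl_map2 (V V' W : lmodType k) (F : filt V) (F' : filt V')
    (G : filt W) (B : V -> V' -> W) (x : cpl F) (y : cpl F') : cpl G :=
  cpl_mk G (fun n => B (cpl_at x n) (cpl_at y n)).

Definition cpl_bind (V W : lmodType k) (F : filt V) (G : filt W)
    (f : V -> cpl G) (x : cpl F) : cpl G :=
  cpl_mk G (fun n => cpl_at (f (cpl_at x n)) n).

(* The inverse limit of (V (x) W) / F^n. For graded V and W it contains, in each
   degree, the inverse limit of the graded quotients; homogeneous points are those
   having homogeneous representatives modulo every F^n. *)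
Definition ctens (V W : lmodType k) (F : filt V) (G : filt W) : lmodType k :=
  cpl (tens_filt F G).

Definition series_sum (V : lmodType k) (F : filt V) (a : nat -> V) (s : V) :
    Prop :=
  forall n, exists N, forall m, (N <= m)%N -> F n (s - \sum_(i < m) a i).

End Filtration.

(** * ccdg-coalgebras *)

Section Coalgebra.
Variable k : fieldType.

Record ccdgc := Ccdgc {
  ccar :> lmodType k;
  cdg :> dgmod ccar;
  ceps : {linear ccar -> k^o};
  cdel : {linear ccar -> tens ccar ccar};
  ceps_deg : forall i x, i != 0 -> ceps (gpr cdg i x) = 0;
  ceps_dif : forall x, ceps (gdif cdg x) = 0;
  cdel_deg : forall i x, homog cdg i x -> thomog cdg cdg i (cdel x);
  cdel_dif : forall x, cdel (gdif cdg x) = tdif cdg cdg (cdel x);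
  cdel_assoc : forall x,
    tassoc (tmap cdel id (cdel x)) = tmap id cdel (cdel x);
  cdel_epsl : forall x, tlift (fun y z => ceps y *: z) (cdel x) = x;
  cdel_epsr : forall x, tlift (fun y z => ceps z *: y) (cdel x) = x;
  cdel_comm : forall x, tswap cdg cdg (cdel x) = cdel x
}.

(* [cdel_iter C n] is the (n+1)-fold iterated coproduct *)
Fixpoint cdel_iter (C : ccdgc) (n : nat) {struct n} : C -> tpow C n :=
  if n is n'.+1 return C -> tpow C n then
    fun x => tmap id (@cdel_iter C n') (cdel C x)
  else id.

Record chom (C D : ccdgc) := Chom {
  chom_fun :> {linear C -> D};
  chom_deg : degmap C D 0 chom_fun;
  chom_dif : forall x, chom_fun (gdif C x) = gdif D (chom_fun x);
  chom_eps : forall x, ceps D (chom_fun x) = ceps C x;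
  chom_del : forall x, cdel D (chom_fun x) = tmap chom_fun chom_fun (cdel C x)
}.

(* A homotopy pair: f(t) = sum_i (f i) t^i and xi(t) = sum_i (xi i) t^i with
   coefficients vanishing from N on; equations between polynomials in t are
   stated coefficientwise. *)
Record chtpy (C D : ccdgc) (f xi : nat -> {linear C -> D}) (N : nat) : Prop :=
  Chtpy {
  chtpy_bound : forall i, (N <= i)%N -> f i =1 \0 /\ xi i =1 \0;
  chtpy_deg : forall i, degmap C D 0 (f i) /\ degmap C D 1 (xi i);
  chtpy_deriv : forall i x, i.+1%:R *: f i.+1 x = hom_dif C D 1 (xi i) x;
  chtpy_eps : forall i x, ceps D (xi i x) = 0;
  chtpy_del : forall n x, cdel D (xi n x) =
    \sum_(i < n.+1) (gtmap C 1 (f i) (xi (n - i)%N) (cdel C x)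
                     + tmap (xi i) (f (n - i)%N) (cdel C x))
}.

Definition chomotopic (C D : ccdgc) (g g' : chom C D) : Prop :=
  exists f xi N, [/\ chtpy f xi N, f 0%N =1 g &
    forall x, g' x = \sum_(i < N) f i x].

End Coalgebra.

(** * Complete ccdg-Hopf algebras *)

Section Hopf.
Variable k : fieldType.

(* [aug_pow e n] is the n-th power of the ideal ker e, the whole of A if n = 0 *)
Definition aug_pow (A : algType k) (e : A -> k) (n : nat) : set A :=
  if n is 0%N then setT else
  lspan [set x | exists s : seq A,
    [/\ size s = n, forall y, y \in s -> e y = 0 & x = \prod_(y <- s) y]].

(* (a (x) b)(c (x) d) = (-1)^(|b| |c|) ac (x) bd *)
Definition tmul (A : algType k) (X : dgmod A) (s t : tens A A) : tens A A :=
  tlift (fun a b => tlift (fun c d =>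
    koszul X X (fun b c => tpure (a * c) (b * d)) b c) t) s.

(* [hfil] is the filtration F^n of a completion with respect to the powers of the
   augmentation ideal I. It is part of the data because in a completion F^n is the
   closure of I^n, which can be larger than I^n. [hdel] takes values in the
   completed tensor square, and the axioms on [hdel] are stated after extending
   the algebraic maps to the completions by continuity. *)
Record chopf := Chopf {
  hcar :> algType k;
  hdg :> dgmod hcar;
  hfil : filt hcar;
  heps : {linear hcar -> k^o};
  hdel : {linear hcar -> ctens hfil hfil};
  hanti : {linear hcar -> hcar};
  (* unital associative dg-algebra *)
  h1_deg : homog hdg 0 1;
  hmul_deg : forall i j x y,
    homog hdg i x -> homog hdg j y -> homog hdg (i + j) (x * y);
  hmul_dif : forall x y,
    gdif hdg (x * y) = gdif hdg x * y + ksgn hdg 1 x * gdif hdg y;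
  (* the counit is a morphism of dg-algebras *)
  heps_deg : forall i x, i != 0 -> heps (gpr hdg i x) = 0;
  heps_dif : forall x, heps (gdif hdg x) = 0;
  heps1 : heps 1 = 1;
  hepsM : forall x y, heps (x * y) = (heps x * heps y : k);
  (* filtration and completeness; H is identified degreewise with lim_n H / F^n *)
  hfil0 : forall x, hfil 0%N x;
  hfil1 : forall x, hfil 1%N x <-> heps x = 0;
  hfil_pow : forall n x, hfil n x <->
    forall m, exists2 y, aug_pow heps n y & hfil m (x - y);
  hfil_gr : forall n i x, hfil n x -> hfil n (gpr hdg i x);
  hfil_mul : forall i j x y, hfil i x -> hfil j y -> hfil (i + j)%N (x * y);
  hfil_dif : forall n x, hfil n x -> hfil n (gdif hdg x);
  hfil_sep : forall x, (forall n, hfil n x) -> x = 0;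
  hfil_cpl : forall i (s : nat -> hcar),
    (forall n, homog hdg i (s n)) -> coherent hfil s ->
    exists2 x, homog hdg i x & forall n, hfil n (x - s n);
  (* the coproduct *)
  hdel_fil : forall n x, hfil n x ->
    tens_filt hfil hfil n (cpl_at (hdel x) n);
  hdel_deg : forall i x n, homog hdg i x ->
    exists2 t, thomog hdg hdg i t &
      tens_filt hfil hfil n (cpl_at (hdel x) n - t);
  hdel_dif : forall x, hdel (gdif hdg x) =
    cpl_map (tens_filt hfil hfil) (tdif hdg hdg) (hdel x);
  hdel_assoc : forall x,
    cpl_bind (G := tens_filt hfil (tens_filt hfil hfil))
      (tlift (fun y z => cpl_map _ (fun t => tassoc (tpure t z)) (hdel y)))
      (hdel x) =
    cpl_bind (tlift (fun y z => cpl_map _ (tpure y) (hdel z))) (hdel x);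
  hdel_epsl : forall x,
    cpl_map hfil (tlift (fun y z => heps y *: z)) (hdel x) = cpl_eta hfil x;
  hdel_epsr : forall x,
    cpl_map hfil (tlift (fun y z => heps z *: y)) (hdel x) = cpl_eta hfil x;
  hdel_comm : forall x,
    cpl_map (tens_filt hfil hfil) (tswap hdg hdg) (hdel x) = hdel x;
  hdel1 : hdel 1 = cpl_eta (tens_filt hfil hfil) (tpure 1 1);
  hdelM : forall x y, hdel (x * y) =
    cpl_map2 (tens_filt hfil hfil) (tmul hdg) (hdel x) (hdel y);
  (* the antipode *)
  hanti_deg : degmap hdg hdg 0 hanti;
  hanti_fil : forall n x, hfil n x -> hfil n (hanti x);
  hantil : forall x,
    cpl_map hfil (tlift (fun y z => hanti y * z)) (hdel x) =
    cpl_eta hfil (heps x *: 1);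
  hantir : forall x,
    cpl_map hfil (tlift (fun y z => y * hanti z)) (hdel x) =
    cpl_eta hfil (heps x *: 1)
}.
End Hopf.

(** * Morphisms and homotopies into a complete ccdg-Hopf algebra *)

Section Morphisms.
Variables (k : fieldType) (C : ccdgc k) (H : chopf k).

(* u_H o eps_C *)
Definition hunit (x : C) : H := ceps C x *: 1.

Record mhom := Mhom {
  mhom_fun :> {linear C -> H};
  mhom_deg : degmap C (hdg H) 0 mhom_fun;
  mhom_dif : forall x, mhom_fun (gdif C x) = gdif (hdg H) (mhom_fun x);
  mhom_eps : forall x, heps H (mhom_fun x) = ceps C x;
  mhom_del : forall x, hdel H (mhom_fun x) =
    cpl_eta _ (tmap mhom_fun mhom_fun (cdel C x))
}.

(* Since H is complete, so are the polynomials in t with coefficients in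
   Hom(C, H): f(t) = sum_i (f i) t^i is polynomial modulo F^n for every n, i.e.
   the coefficients tend to 0, uniformly on C. Honest polynomials would be too
   few here: a polynomial in t with grouplike values is constant, so that the
   exponentials of homotopic maps would in general not be homotopic. *)
Record mhtpy (f xi : nat -> {linear C -> H}) : Prop := Mhtpy {
  mhtpy_bound : forall n, exists N, forall i x, (N <= i)%N ->
    hfil H n (f i x) /\ hfil H n (xi i x);
  mhtpy_deg : forall i,
    degmap C (hdg H) 0 (f i) /\ degmap C (hdg H) 1 (xi i);
  mhtpy_deriv : forall i x,
    i.+1%:R *: f i.+1 x = hom_dif C (hdg H) 1 (xi i) x;
  mhtpy_eps : forall i x, heps H (xi i x) = 0;
  mhtpy_del : forall n x, hdel H (xi n x) = cpl_eta _
    (\sum_(i < n.+1) (gtmap C 1 (f i) (xi (n - i)%N) (cdel C x)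
                      + tmap (xi i) (f (n - i)%N) (cdel C x)))
}.

Definition mhomotopic (g g' : mhom) : Prop :=
  exists f xi, [/\ mhtpy f xi, f 0%N =1 g &
    forall x, series_sum (hfil H) (fun i => f i x) (g' x)].

Record thom := Thom {
  thom_fun :> {linear C -> H};
  thom_deg : degmap C (hdg H) 0 thom_fun;
  thom_dif : forall x, hom_dif C (hdg H) 0 thom_fun x = 0;
  thom_eps : forall x, heps H (thom_fun x) = 0;
  thom_del : forall x, hdel H (thom_fun x) =
    cpl_eta _ (tmap hunit thom_fun (cdel C x) + tmap thom_fun hunit (cdel C x))
}.

Record thtpy (f s : nat -> {linear C -> H}) : Prop := Thtpy {
  thtpy_bound : forall n, exists N, forall i x, (N <= i)%N ->
    hfil H n (f i x) /\ hfil H n (s i x);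
  thtpy_deg : forall i,
    degmap C (hdg H) 0 (f i) /\ degmap C (hdg H) 1 (s i);
  thtpy_deriv : forall i x,
    i.+1%:R *: f i.+1 x = hom_dif C (hdg H) 1 (s i) x;
  thtpy_eps : forall i x, heps H (s i x) = 0;
  thtpy_del : forall i x, hdel H (s i x) = cpl_eta _
    (gtmap C 1 hunit (s i) (cdel C x) + tmap (s i) hunit (cdel C x))
}.

Definition thomotopic (v v' : thom) : Prop :=
  exists f s, [/\ thtpy f s, f 0%N =1 v &
    forall x, series_sum (hfil H) (fun i => f i x) (v' x)].

End Morphisms.

(* m^(n+1), on the (n+1)-st tensor power *)
Fixpoint hmul_iter (k : fieldType) (H : chopf k) (n : nat) {struct n} :
    tpow H n -> H :=
  if n is n'.+1 return tpow H n -> H then tlift (fun x t => x * @hmul_iter k H n' t)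
  else id.

(* m^(n) o (f (x) ... (x) f) o Delta_C^(n) for n >= 1. The values of
   f (x) ... (x) f lie in the algebraic tensor power of H, on which the extension
   of m^(n) to the completed tensor power is m^(n) itself. *)
Definition hconv (k : fieldType) (C : ccdgc k) (H : chopf k) (f : C -> H)
    (n : nat) (x : C) : H :=
  hmul_iter (tpow_map f (cdel_iter n.-1 x)).

Definition is_exp (k : fieldType) (C : ccdgc k) (H : chopf k)
    (v : thom C H) (g : mhom C H) : Prop :=
  forall x, series_sum (hfil H)
    (fun i => i.+1`!%:R^-1 *: hconv v i.+1 x) (g x - hunit H x).

Definition is_ln (k : fieldType) (C : ccdgc k) (H : chopf k)
    (g : mhom C H) (v : thom C H) : Prop :=
  forall x, series_sum (hfil H)
    (fun i => - ((-1) ^+ i.+1 / i.+1%:R *: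
       hconv (fun y => g y - hunit H y) i.+1 x)) (v x).

(** * Homotopy types *)

Section Classes.
Variables (T : choiceType) (R : T -> T -> Prop).

Definition gen_rel (x y : T) : bool := `[< clos_refl_sym_trans T R x y >].

Fact gen_rel_refl : reflexive gen_rel.
Proof. by move=> x; apply/asboolP; exact: rst_refl. Qed.
Fact gen_rel_sym : symmetric gen_rel.
Proof. by move=> x y; apply/asboolP/asboolP; exact: rst_sym. Qed.
Fact gen_rel_trans : transitive gen_rel.
Proof.
by move=> y x z /asboolP h /asboolP h'; apply/asboolP; apply: rst_trans h h'.
Qed.

Canonical gen_equiv := EquivRel gen_rel gen_rel_refl gen_rel_sym gen_rel_trans.

Definition classes := {eq_quot gen_equiv}.
HB.instance Definition _ := Choice.on classes.
HB.instance Definition _ := EqQuotient.on classes.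

Definition class_of (x : T) : classes := \pi_classes x.
Definition class_repr (c : classes) : T := repr c.

Lemma class_reprK c : class_of (class_repr c) = c.
Proof. exact: reprK. Qed.

Lemma class_eqP x y : class_of x = class_of y <-> clos_refl_sym_trans T R x y.
Proof. by split=> [/eqquotP/asboolP|h] //; apply/eqquotP/asboolP. Qed.

Lemma class_repr_of x : clos_refl_sym_trans T R (class_repr (class_of x)) x.
Proof. by apply/class_eqP; exact: class_reprK. Qed.

End Classes.

Lemma rst_map (T T' : Type) (R : T -> T -> Prop) (R' : T' -> T' -> Prop)
    (h : T -> T') x y :
  (forall x y, R x y -> R' (h x) (h y)) ->
  clos_refl_sym_trans T R x y -> clos_refl_sym_trans T' R' (h x) (h y).
Proof.
move=> hR; elim=> [u v /hR|u|u v _|u v w _ + _].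
- exact: rst_step.
- exact: rst_refl.
- exact: rst_sym.
- exact: rst_trans.
Qed.

HB.instance Definition _ (k : fieldType) (C D : ccdgc k) := gen_eqMixin (chom C D).
HB.instance Definition _ (k : fieldType) (C D : ccdgc k) := gen_choiceMixin (chom C D).
HB.instance Definition _ (k : fieldType) (C : ccdgc k) (H : chopf k) :=
  gen_eqMixin (mhom C H).
HB.instance Definition _ (k : fieldType) (C : ccdgc k) (H : chopf k) :=
  gen_choiceMixin (mhom C H).
HB.instance Definition _ (k : fieldType) (C : ccdgc k) (H : chopf k) :=
  gen_eqMixin (thom C H).
HB.instance Definition _ (k : fieldType) (C : ccdgc k) (H : chopf k) :=
  gen_choiceMixin (thom C H).

Definition ho_hom (k : fieldType) (C D : ccdgc k) := classes (@chomotopic k C D).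
Definition ho_mhom (k : fieldType) (C : ccdgc k) (H : chopf k) :=
  classes (@mhomotopic k C H).
Definition ho_thom (k : fieldType) (C : ccdgc k) (H : chopf k) :=
  classes (@thomotopic k C H).

Section TensorTheory.
Variable k : fieldType.
Implicit Types V W : lmodType k.

Lemma linear_sum_tlift V W (U U' : lmodType k) (B : V -> W -> U)
    (f : {linear U -> U'}) t :
  f (tlift B t) = tlift (fun v w => f (B v w)) t.
Proof. by rewrite /tlift raddf_sum. Qed.

Lemma eq_tlift V W (U : lmodType k) (B B' : V -> W -> U) t :
  (forall v w, B v w = B' v w) -> tlift B t = tlift B' t.
Proof. by move=> h; apply: eq_bigr => p _. Qed.

Lemma tmap_bilin V W V' W' (f : V -> V') (g : W -> W') :
  linear f -> linear g -> bilin (fun x y => tpure (f x) (g y)).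
Proof.
move=> lf lg; have [b1 b2] := tpure_bilin V' W'.
by split=> [w a u v|v a u w]; rewrite ?lf ?lg ?b1 ?b2.
Qed.

Lemma tmap_linear V W V' W' (f : V -> V') (g : W -> W') :
  linear f -> linear g -> linear (tmap f g).
Proof. by move=> lf lg; apply/tliftP/tmap_bilin. Qed.

Lemma tmap_pure V W V' W' (f : V -> V') (g : W -> W') v w :
  linear f -> linear g -> tmap f g (tpure v w) = tpure (f v) (g w).
Proof. by move=> lf lg; apply/tlift_pure/tmap_bilin. Qed.

Lemma eq_tmap V W V' W' (f f' : V -> V') (g g' : W -> W') t :
  f =1 f' -> g =1 g' -> tmap f g t = tmap f' g' t.
Proof. by move=> hf hg; apply: eq_tlift => v w; rewrite hf hg. Qed.

Lemma linear_comp V W (U : lmodType k) (f : W -> U) (g : V -> W) :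
  linear f -> linear g -> linear (f \o g).
Proof. by move=> lf lg a u v /=; rewrite lg lf. Qed.

Lemma tmap_comp V W V' W' V'' W'' (f : V -> V') (g : W -> W')
    (f' : V' -> V'') (g' : W' -> W'') t :
  linear f -> linear g -> linear f' -> linear g' ->
  tmap f' g' (tmap f g t) = tmap (f' \o f) (g' \o g) t.
Proof.
move=> lf lg lf' lg'; move: t; apply: tens_linear_ext.
- by apply: (linear_comp (f := tmap f' g')); apply: tmap_linear.
- by apply: tmap_linear; apply: linear_comp.
move=> v w; rewrite !tmap_pure //; exact: linear_comp.
Qed.

Lemma tmap_id V W (t : tens V W) : tmap id id t = t.
Proof. by rewrite [RHS]tens_sum. Qed.

Lemma tmap0l V W V' W' (f : V -> V') (g : W -> W') t :
  f =1 \0 -> linear g -> tmap f g t = 0.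
Proof.
move=> hf lg; rewrite /tmap /tlift big1 // => p _.
by rewrite hf (bilin0l (tpure_bilin _ _)).
Qed.

Lemma tmap0r V W V' W' (f : V -> V') (g : W -> W') t :
  g =1 \0 -> linear f -> tmap f g t = 0.
Proof.
move=> hg lg; rewrite /tmap /tlift big1 // => p _.
by rewrite hg (bilin0r (tpure_bilin _ _)).
Qed.

End TensorTheory.

Section GradedTheory.
Variable k : fieldType.

Lemma gpr_cover (V : lmodType k) (X : dgmod V) (u v : V) : exists r : seq int,
  uniq r /\ forall i, i \notin r -> gpr X i u = 0 /\ gpr X i v = 0.
Proof.
have /finite_seqP[s hs] := gpr_fin X u; have /finite_seqP[t ht] := gpr_fin X v.
exists (undup (s ++ t)); split=> [|i]; first exact: undup_uniq.
rewrite mem_undup mem_cat negb_or => /andP[si ti]; split; apply/eqP.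
- by apply: contraNT si => nz; have : [set i | gpr X i u != 0] i := nz; rewrite hs.
- by apply: contraNT ti => nz; have : [set i | gpr X i v != 0] i := nz; rewrite ht.
Qed.

Lemma gsum_cover (V W : lmodType k) (X : dgmod V) (F : int -> V -> W) v (r : seq int) :
  uniq r -> (forall i, i \notin r -> gpr X i v = 0) -> (forall i, F i 0 = 0) ->
  \sum_(i \in [set: int]) F i (gpr X i v) = \sum_(i <- r) F i (gpr X i v).
Proof.
move=> ur hr F0; rewrite (fsbigE r) //; last by move=> i _ /hr ->.
by apply: eq_bigl => i; rewrite in_setT.
Qed.

Lemma ksgn_cover (V : lmodType k) (X : dgmod V) n v (r : seq int) :
  uniq r -> (forall i, i \notin r -> gpr X i v = 0) ->
  ksgn X n v = \sum_(i <- r) (-1) ^+ (n * absz i) *: gpr X i v.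
Proof.
by move=> ur hr; rewrite /ksgn (gsum_cover (F := fun i x => _ *: x) ur hr) // => i; rewrite scaler0.
Qed.

Lemma gpr_sum_cover (V : lmodType k) (X : dgmod V) v (r : seq int) :
  uniq r -> (forall i, i \notin r -> gpr X i v = 0) ->
  v = \sum_(i <- r) gpr X i v.
Proof.
by move=> ur hr; rewrite {1}[v](gpr_sum X) (gsum_cover (F := fun i x => x) ur hr).
Qed.

Lemma ksgn_linear (V : lmodType k) (X : dgmod V) n : linear (ksgn X n).
Proof.
move=> a u v; have [r [ur hr]] := gpr_cover X u v.
rewrite !(ksgn_cover n ur); try by move=> i /hr[].
  2: by move=> i /hr[hu hv]; rewrite linearP hu hv scaler0 addr0.
rewrite scaler_sumr -big_split; apply: eq_bigr => i _ /=.
by rewrite linearP scalerDr !scalerA mulrC.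
Qed.

Lemma koszul_bilin (V W U : lmodType k) (X : dgmod V) (Y : dgmod W)
    (B : V -> W -> U) : bilin B -> bilin (koszul X Y B).
Proof.
move=> bB.
have K v w r : uniq r -> (forall i, i \notin r -> gpr Y i w = 0) ->
    koszul X Y B v w = \sum_(j <- r) B (ksgn X (absz j) v) (gpr Y j w).
  move=> ur hr; apply: (gsum_cover (F := fun j y => B (ksgn X (absz j) v) y)) => //.
  by move=> i; rewrite (bilin0r bB).
split=> [w a u v|v a u w].
  have [r [ur hr]] := gpr_cover Y w w.
  rewrite !(K _ _ _ ur) => [|i /hr[] //|i /hr[] //|i /hr[] //].
  rewrite scaler_sumr -big_split; apply: eq_bigr => i _ /=.
  by rewrite ksgn_linear bB.1.
have [r [ur hr]] := gpr_cover Y u w.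
rewrite !(K _ _ _ ur); try by move=> i /hr[].
  2: by move=> i /hr[hu hv]; rewrite linearP hu hv scaler0 addr0.
rewrite scaler_sumr -big_split; apply: eq_bigr => i _ /=.
by rewrite linearP bB.2.
Qed.

Lemma ksgn0 (V : lmodType k) (X : dgmod V) v : ksgn X 0 v = v.
Proof.
have [r [ur hr]] := gpr_cover X v v.
have hv i : i \notin r -> gpr X i v = 0 by case/hr.
rewrite (ksgn_cover 0 ur hv) [RHS](gpr_sum_cover ur hv).
by apply: eq_bigr => i _; rewrite expr0 scale1r.
Qed.

Lemma gpr_homog (V : lmodType k) (X : dgmod V) i v : homog X i (gpr X i v).
Proof. by rewrite /homog /= gpr_idem eqxx. Qed.

Lemma degmap0_gpr (V W : lmodType k) (X : dgmod V) (Y : dgmod W)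
    (f : {linear V -> W}) i v :
  degmap X Y 0 f -> gpr Y i (f v) = f (gpr X i v).
Proof.
move=> df; have [r [ur hr]] := gpr_cover X v v.
have hv j : j \notin r -> gpr X j v = 0 by case/hr.
have E j : gpr Y i (f (gpr X j v)) = f (gpr X i (gpr X j v)).
  have h : gpr Y j (f (gpr X j v)) = f (gpr X j v).
    by have := df _ _ (gpr_homog X j v); rewrite addr0.
  rewrite -h !gpr_idem; case: eqP => [_|_]; last by rewrite linear0.
  by rewrite h.
rewrite {1 2}(gpr_sum_cover ur hv) !linear_sum /=.
by apply: eq_bigr => j _; rewrite E.
Qed.

Lemma degmap0_ksgn (V W : lmodType k) (X : dgmod V) (Y : dgmod W)
    (f : {linear V -> W}) n v :
  degmap X Y 0 f -> ksgn Y n (f v) = f (ksgn X n v).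
Proof.
move=> df; have [r [ur hr]] := gpr_cover X v v.
have hv j : j \notin r -> gpr X j v = 0 by case/hr.
have hw j : j \notin r -> gpr Y j (f v) = 0.
  by move=> /hv e; rewrite (degmap0_gpr j v df) e linear0.
rewrite (ksgn_cover n ur hv) (ksgn_cover n ur hw) linear_sum.
by apply: eq_bigr => j _ /=; rewrite linearZ (degmap0_gpr j v df).
Qed.

Lemma gtmap_comp (V W V' W' V'' W'' : lmodType k) (X : dgmod V) n
    (f : V -> V') (g : W -> W') (f' : V' -> V'') (g' : W' -> W'') t :
  linear f -> linear g -> linear f' -> linear g' ->
  tmap f' g' (gtmap X n f g t) = gtmap X n (f' \o f) (g' \o g) t.
Proof.
move=> lf lg lf' lg'; rewrite /gtmap tmap_comp //.
by apply: linear_comp => //; exact: ksgn_linear.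
Qed.

Lemma gtmap_precomp (V W V' W' V'' : lmodType k) (X : dgmod V) (X' : dgmod V')
    n (f : {linear V -> V'}) (g : W -> W') (f' : V' -> V'') (W'' : lmodType k)
    (g' : W' -> W'') t :
  degmap X X' 0 f -> linear g -> linear f' -> linear g' ->
  gtmap X' n f' g' (tmap f g t) = gtmap X n (f' \o f) (g' \o g) t.
Proof.
move=> df lg lf' lg'; rewrite /gtmap tmap_comp //; first 1 last.
- exact: linearP.
- by apply: linear_comp => //; exact: ksgn_linear.
by apply: eq_tmap => // v /=; rewrite (degmap0_ksgn _ _ df).
Qed.

Lemma hom_dif_comp (V W U : lmodType k) (X : dgmod V) (Y : dgmod W)
    (Z : dgmod U) n (f : V -> W) (g : {linear W -> U}) v :
  (forall w, g (gdif Y w) = gdif Z (g w)) ->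
  g (hom_dif X Y n f v) = hom_dif X Z n (g \o f) v.
Proof. by move=> dg; rewrite /hom_dif linearB linearZ /= dg. Qed.

Lemma hom_dif_precomp (V W U : lmodType k) (X : dgmod V) (Y : dgmod W)
    (Z : dgmod U) n (f : V -> W) (g : W -> U) v :
  (forall v, f (gdif X v) = gdif Y (f v)) ->
  hom_dif Y Z n g (f v) = hom_dif X Z n (g \o f) v.
Proof. by move=> df; rewrite /hom_dif /= df. Qed.

Lemma degmap_comp (V W U : lmodType k) (X : dgmod V) (Y : dgmod W)
    (Z : dgmod U) m n (f : V -> W) (g : W -> U) :
  degmap X Y m f -> degmap Y Z n g -> degmap X Z (m + n) (g \o f).
Proof. by move=> df dg i v hv /=; rewrite addrA; apply/dg/df. Qed.

End GradedTheory.

(** * The homotopy category of ccdg-coalgebras *)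

Record category := Category {
  ob :> Type;
  arr : ob -> ob -> Type;
  idm : forall a, arr a a;
  cmp : forall a b c, arr b c -> arr a b -> arr a c;
  comp1m : forall a b (f : arr a b), cmp (idm b) f = f;
  compm1 : forall a b (f : arr a b), cmp f (idm a) = f;
  compA : forall a b c d (h : arr c d) (g : arr b c) (f : arr a b),
    cmp h (cmp g f) = cmp (cmp h g) f
}.

Record presheaf (A : category) := Presheaf {
  psh_ob :> A -> Type;
  psh_arr : forall a b : A, arr a b -> psh_ob b -> psh_ob a;
  psh_id : forall (a : A) (x : psh_ob a), psh_arr (idm a) x = x;
  psh_comp : forall (a b c : A) (g : arr b c) (f : arr a b) (x : psh_ob c),
    psh_arr (cmp g f) x = psh_arr f (psh_arr g x)
}.

Record nattrans (A : category) (P Q : presheaf A) := Nattrans {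
  nt_fun :> forall a : A, P a -> Q a;
  nt_nat : forall (a b : A) (f : arr a b) (x : P b),
    nt_fun (psh_arr f x) = psh_arr f (nt_fun x)
}.
Arguments nt_fun {A P Q} n a _.

Section HoCategory.
Variable k : fieldType.
Implicit Types A B C D : ccdgc k.

Fact chom_id_del C x : cdel C x = tmap (@idfun C) (@idfun C) (cdel C x).
Proof. by rewrite tmap_id. Qed.

Fact chom_id_deg C : degmap C C 0 (@idfun C).
Proof. by move=> i v; rewrite addr0. Qed.

Definition chom_id C : chom C C :=
  @Chom k C C idfun (@chom_id_deg C) (fun x => erefl) (fun x => erefl)
    (@chom_id_del C).

Section Comp.
Variables (C D E : ccdgc k) (g : chom D E) (f : chom C D).

Fact chom_comp_deg : degmap C E 0 (g \o f).
Proof. exact: degmap_comp (@chom_deg _ _ _ f) (@chom_deg _ _ _ g). Qed.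
Fact chom_comp_dif x : g (f (gdif C x)) = gdif E (g (f x)).
Proof. by rewrite !chom_dif. Qed.
Fact chom_comp_eps x : ceps E (g (f x)) = ceps C x.
Proof. by rewrite !chom_eps. Qed.
Fact chom_comp_del x : cdel E (g (f x)) = tmap (g \o f) (g \o f) (cdel C x).
Proof. by rewrite !chom_del tmap_comp //; exact: linearP. Qed.

Definition chom_comp : chom C E :=
  @Chom k C E (g \o f) chom_comp_deg chom_comp_dif chom_comp_eps chom_comp_del.
End Comp.

Lemma chomotopic_ext C D (f g : chom C D) : f =1 g -> chomotopic f g.
Proof.
move=> fg; exists (fun i => if i is 0%N then chom_fun f else \0), (fun=> \0), 1%N.
split=> // [|x]; last by rewrite big_ord1 fg.
have l0 (U V : lmodType k) : linear (\0 : U -> V).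
  by move=> a u v; rewrite /= scaler0 addr0.
have d0 n : degmap C D n (\0 : C -> D) by move=> i v _; rewrite /homog /= linear0.
split=> [[|i] //|[|i]|i x|i x|n x]; rewrite ?linear0 //.
- by split=> //; exact: chom_deg.
- by rewrite /hom_dif /= linear0 !scaler0 subr0.
- rewrite big1 // => i _; rewrite /gtmap tmap0r // ?tmap0l ?addr0 //; first exact: linearP.
  by apply: linear_comp; [exact: linearP|exact: ksgn_linear].
Qed.

Lemma chomotopic_compl C D E (g : chom D E) (f f' : chom C D) :
  chomotopic f f' -> chomotopic (chom_comp g f) (chom_comp g f').
Proof.
case=> p [q [N [h p0 p1]]].
exists (fun i => g \o p i), (fun i => g \o q i), N; split=> [|x|x].
- split=> [i iN|i|i x|i x|n x].
  + have [pi qi] := chtpy_bound h iN.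
    by split=> x /=; rewrite ?pi ?qi linear0.
  + have [pi qi] := chtpy_deg h i.
    have dg := @chom_deg _ _ _ g.
    split; first exact: degmap_comp pi dg.
    by have := degmap_comp qi dg; rewrite addr0.
  + rewrite /= -linearZ (chtpy_deriv h) /=.
    by apply: hom_dif_comp => w; rewrite chom_dif.
  + by rewrite /= chom_eps (chtpy_eps h).
  + rewrite /= chom_del (chtpy_del h).
    have lt := tmap_linear (linearP g) (linearP g).
    pose T : {linear _ -> _} := HB.pack (tmap g g)
      (GRing.isLinear.Build _ _ _ _ _ lt).
    rewrite -[LHS]/(T _) linear_sum; apply: eq_bigr => i _.
    rewrite linearD /= gtmap_comp ?tmap_comp //; exact: linearP.
- by rewrite /= p0.
- by rewrite /= p1 linear_sum.
Qed.

Lemma chomotopic_compr C D E (g g' : chom D E) (f : chom C D) :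
  chomotopic g g' -> chomotopic (chom_comp g f) (chom_comp g' f).
Proof.
case=> p [q [N [h p0 p1]]].
exists (fun i => p i \o f), (fun i => q i \o f), N; split=> [|x|x].
- split=> [i iN|i|i x|i x|n x].
  + have [pi qi] := chtpy_bound h iN.
    by split=> x /=; rewrite ?pi ?qi.
  + have [pi qi] := chtpy_deg h i.
    have df := @chom_deg _ _ _ f.
    split; first exact: degmap_comp df pi.
    by have := degmap_comp df qi; rewrite add0r.
  + rewrite /= (chtpy_deriv h).
    by apply: hom_dif_precomp => w; rewrite chom_dif.
  + by rewrite /= (chtpy_eps h).
  + rewrite /= (chtpy_del h); apply: eq_bigr => i _.
    rewrite chom_del (gtmap_precomp _ _ (@chom_deg _ _ _ f)) ?tmap_comp //;
    exact: linearP.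
- by rewrite /= p0.
- by rewrite /= p1.
Qed.

Definition ho_id C : ho_hom C C := class_of _ (chom_id C).

Definition ho_comp C D E (g : ho_hom D E) (f : ho_hom C D) : ho_hom C E :=
  class_of _ (chom_comp (class_repr g) (class_repr f)).

Lemma ho_compE C D E (g : chom D E) (f : chom C D) :
  ho_comp (class_of _ g) (class_of _ f) = class_of _ (chom_comp g f).
Proof.
apply/class_eqP; apply: rst_trans (_ : clos_refl_sym_trans _ _ _ (chom_comp g _)) _.
  apply: (rst_map (h := fun g => chom_comp g _)) (class_repr_of _ _).
  by move=> *; exact: chomotopic_compr.
apply: (rst_map (h := chom_comp g)) (class_repr_of _ _).
by move=> *; exact: chomotopic_compl.
Qed.

Fact ho_comp1m C D (f : ho_hom C D) : ho_comp (ho_id D) f = f.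
Proof.
rewrite -[f]class_reprK ho_compE; apply/class_eqP/rst_step.
exact: chomotopic_ext.
Qed.

Fact ho_compm1 C D (f : ho_hom C D) : ho_comp f (ho_id C) = f.
Proof.
rewrite -[f]class_reprK ho_compE; apply/class_eqP/rst_step.
exact: chomotopic_ext.
Qed.

Fact ho_compA A B C D (h : ho_hom C D) (g : ho_hom B C) (f : ho_hom A B) :
  ho_comp h (ho_comp g f) = ho_comp (ho_comp h g) f.
Proof.
rewrite -[h]class_reprK -[g]class_reprK -[f]class_reprK !ho_compE.
by apply/class_eqP/rst_step; exact: chomotopic_ext.
Qed.

Definition ho_ccdgc : category := Category ho_comp1m ho_compm1 ho_compA.

End HoCategory.

(** * The presheaves of homotopy types of morphisms into H *)

Section PresheafP.
Variables (k : fieldType) (H : chopf k).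
Implicit Types C D : ccdgc k.

Section Pre.
Variables (C D : ccdgc k) (g : mhom D H) (f : chom C D).

Fact mhom_pre_deg : degmap C (hdg H) 0 (g \o f).
Proof. exact: degmap_comp (@chom_deg _ _ _ f) (@mhom_deg _ _ _ g). Qed.
Fact mhom_pre_dif x : g (f (gdif C x)) = gdif (hdg H) (g (f x)).
Proof. by rewrite chom_dif mhom_dif. Qed.
Fact mhom_pre_eps x : heps H (g (f x)) = ceps C x.
Proof. by rewrite mhom_eps chom_eps. Qed.
Fact mhom_pre_del x :
  hdel H (g (f x)) = cpl_eta _ (tmap (g \o f) (g \o f) (cdel C x)).
Proof. by rewrite mhom_del chom_del tmap_comp //; exact: linearP. Qed.

Definition mhom_pre : mhom C H :=
  @Mhom k C H (g \o f) mhom_pre_deg mhom_pre_dif mhom_pre_eps mhom_pre_del.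
End Pre.

Lemma mhomotopic_ext C (g g' : mhom C H) : g =1 g' -> mhomotopic g g'.
Proof.
move=> gg; exists (fun i => if i is 0%N then mhom_fun g else \0), (fun=> \0).
split=> // [|x n]; last first.
  exists 1%N => -[//|m] _; rewrite big_ord_recl big1 // addr0 gg subrr.
  exact: fil0.
have d0 n : degmap C (hdg H) n (\0 : C -> H).
  by move=> i v _; rewrite /homog /= linear0.
split=> [n|[|i]|i x|i x|n x]; rewrite ?linear0 //.
- by exists 1%N => -[//|i] x _; split; exact: fil0.
- by split=> //; exact: mhom_deg.
- by rewrite /hom_dif /= linear0 !scaler0 subr0.
- rewrite big1 // => i _; rewrite /gtmap tmap0r // ?tmap0l ?addr0 //; first exact: linearP.
  by apply: linear_comp; [exact: linearP|exact: ksgn_linear].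
Qed.

Lemma mhomotopic_prel C D (g : mhom D H) (f f' : chom C D) :
  chomotopic f f' -> mhomotopic (mhom_pre g f) (mhom_pre g f').
Proof.
case=> p [q [N [h p0 p1]]].
exists (fun i => g \o p i), (fun i => g \o q i); split=> [|x|x n].
- split=> [n|i|i x|i x|n x].
  + exists N => i x iN; have [pi qi] := chtpy_bound h iN.
    by rewrite /= pi qi linear0; split; exact: fil0.
  + have [pi qi] := chtpy_deg h i.
    have dg := @mhom_deg _ _ _ g.
    split; first exact: degmap_comp pi dg.
    by have := degmap_comp qi dg; rewrite addr0.
  + rewrite /= -linearZ (chtpy_deriv h) /=.
    by apply: hom_dif_comp => w; rewrite mhom_dif.
  + by rewrite /= mhom_eps (chtpy_eps h).
  + rewrite /= mhom_del (chtpy_del h); congr (cpl_eta _ _).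
    have lt := tmap_linear (linearP g) (linearP g).
    pose T : {linear _ -> _} := HB.pack (tmap g g)
      (GRing.isLinear.Build _ _ _ _ _ lt).
    rewrite -[LHS]/(T _) linear_sum; apply: eq_bigr => i _.
    rewrite linearD /= gtmap_comp ?tmap_comp //; exact: linearP.
- by rewrite /= p0.
- exists N => m Nm; rewrite /= p1 linear_sum.
  rewrite -(subnKC Nm) big_split_ord /= [X in _ - (_ + X)]big1 ?addr0 ?subrr.
    exact: fil0.
  move=> i _; have [-> _] := chtpy_bound h (leq_addr i N).
  by rewrite linear0.
Qed.

Lemma mhomotopic_prer C D (g g' : mhom D H) (f : chom C D) :
  mhomotopic g g' -> mhomotopic (mhom_pre g f) (mhom_pre g' f).
Proof.
case=> p [q [h p0 p1]].
exists (fun i => p i \o f), (fun i => q i \o f); split=> [|x|x].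
- split=> [n|i|i x|i x|n x].
  + by have [N hN] := mhtpy_bound h n; exists N => i x; exact: hN.
  + have [pi qi] := mhtpy_deg h i.
    have df := @chom_deg _ _ _ f.
    split; first exact: degmap_comp df pi.
    by have := degmap_comp df qi; rewrite add0r.
  + rewrite /= (mhtpy_deriv h).
    by apply: hom_dif_precomp => w; rewrite chom_dif.
  + by rewrite /= (mhtpy_eps h).
  + rewrite /= (mhtpy_del h); congr (cpl_eta _ _); apply: eq_bigr => i _.
    rewrite chom_del (gtmap_precomp _ _ (@chom_deg _ _ _ f)) ?tmap_comp //;
    exact: linearP.
- by rewrite /= p0.
- exact: p1.
Qed.

Definition hoP_ob C := ho_mhom C H.

Definition hoP_arr C D (f : ho_hom C D) (g : ho_mhom D H) : ho_mhom C H :=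
  class_of _ (mhom_pre (class_repr g) (class_repr f)).

Lemma hoP_arrE C D (f : chom C D) (g : mhom D H) :
  hoP_arr (class_of _ f) (class_of _ g) = class_of _ (mhom_pre g f).
Proof.
apply/class_eqP; apply: rst_trans (_ : clos_refl_sym_trans _ _ _ (mhom_pre g _)) _.
  apply: (rst_map (h := fun g => mhom_pre g _)) (class_repr_of _ _).
  by move=> *; exact: mhomotopic_prer.
apply: (rst_map (h := mhom_pre g)) (class_repr_of _ _).
by move=> *; exact: mhomotopic_prel.
Qed.

Fact hoP_id C (g : ho_mhom C H) : hoP_arr (ho_id C) g = g.
Proof.
rewrite -[g]class_reprK hoP_arrE; apply/class_eqP/rst_step.
exact: mhomotopic_ext.
Qed.

Fact hoP_comp C D E (g : ho_hom D E) (f : ho_hom C D) (x : ho_mhom E H) :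
  hoP_arr (ho_comp g f) x = hoP_arr f (hoP_arr g x).
Proof.
rewrite -[x]class_reprK -[g]class_reprK -[f]class_reprK ho_compE !hoP_arrE.
by apply/class_eqP/rst_step; exact: mhomotopic_ext.
Qed.

Definition psh_P : presheaf (ho_ccdgc k) :=
  @Presheaf (ho_ccdgc k) hoP_ob hoP_arr hoP_id hoP_comp.

End PresheafP.

Section PresheafTP.
Variables (k : fieldType) (char_k : [pchar k] =i pred0) (H : chopf k).
Implicit Types C D : ccdgc k.


Lemma hunit_linear C : linear (@hunit k C H).
Proof.
by move=> a u v; rewrite /hunit linearP scalerDl -scalerA.
Qed.

Lemma hunit_comp C D (f : chom C D) : @hunit k D H \o f =1 @hunit k C H.
Proof. by move=> x; rewrite /hunit /= chom_eps. Qed.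

Section Pre.
Variables (C D : ccdgc k) (v : thom D H) (f : chom C D).

Fact thom_pre_deg : degmap C (hdg H) 0 (v \o f).
Proof. exact: degmap_comp (@chom_deg _ _ _ f) (@thom_deg _ _ _ v). Qed.
Fact thom_pre_dif x : hom_dif C (hdg H) 0 (v \o f) x = 0.
Proof.
rewrite -(@hom_dif_precomp _ _ _ _ _ D) ?thom_dif // => w.
by rewrite chom_dif.
Qed.
Fact thom_pre_eps x : heps H (v (f x)) = 0.
Proof. by rewrite thom_eps. Qed.
Fact thom_pre_del x : hdel H (v (f x)) = cpl_eta _
  (tmap (@hunit k C H) (v \o f) (cdel C x) + tmap (v \o f) (@hunit k C H) (cdel C x)).
Proof.
rewrite thom_del chom_del !tmap_comp; try exact: linearP; try exact: hunit_linear.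
by congr (cpl_eta _ (_ + _)); apply: eq_tmap => // y; rewrite hunit_comp.
Qed.

Definition thom_pre : thom C H :=
  @Thom k C H (v \o f) thom_pre_deg thom_pre_dif thom_pre_eps thom_pre_del.
End Pre.

Lemma thomotopic_ext C (v v' : thom C H) : v =1 v' -> thomotopic v v'.
Proof.
move=> vv; exists (fun i => if i is 0%N then thom_fun v else \0), (fun=> \0).
split=> // [|x n]; last first.
  exists 1%N => -[//|m] _; rewrite big_ord_recl big1 // addr0 vv subrr.
  exact: fil0.
have d0 n : degmap C (hdg H) n (\0 : C -> H).
  by move=> i w _; rewrite /homog /= linear0.
split=> [n|[|i]|i x|i x|n x]; rewrite ?linear0 //.
- by exists 1%N => -[//|i] x _; split; exact: fil0.
- by split=> //; exact: thom_deg.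
- by rewrite /hom_dif /= linear0 !scaler0 subr0.
- rewrite /gtmap tmap0r // ?tmap0l ?addr0 //; first exact: hunit_linear.
  by apply: linear_comp; [exact: hunit_linear|exact: ksgn_linear].
Qed.

Lemma chtpy_eps0 C D (f xi : nat -> {linear C -> D}) N i x :
  chtpy f xi N -> ceps D (f i.+1 x) = 0.
Proof.
move=> h; have := congr1 (ceps D) (chtpy_deriv h i x).
rewrite linearZ /hom_dif linearB linearZ /= ceps_dif (chtpy_eps h).
rewrite scaler0 subrr => /eqP; rewrite scaler_eq0 => /orP[|/eqP //].
by rewrite ((pcharf0P k).1 char_k).
Qed.

Lemma thomotopic_prel C D (v : thom D H) (f f' : chom C D) :
  chomotopic f f' -> thomotopic (thom_pre v f) (thom_pre v f').
Proof.
case=> p [q [N [h p0 p1]]].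
exists (fun i => v \o p i), (fun i => v \o q i); split=> [|x|x n].
- split=> [n|i|i x|i x|n x].
  + exists N => i x iN; have [pi qi] := chtpy_bound h iN.
    by rewrite /= pi qi linear0; split; exact: fil0.
  + have [pi qi] := chtpy_deg h i.
    have dv := @thom_deg _ _ _ v.
    split; first exact: degmap_comp pi dv.
    by have := degmap_comp qi dv; rewrite addr0.
  + rewrite /= -linearZ (chtpy_deriv h) /=.
    apply: hom_dif_comp => w; have := thom_dif v w.
    by rewrite /hom_dif expr0 scale1r => /eqP; rewrite subr_eq0 => /eqP ->.
  + by rewrite /= thom_eps.
  + rewrite /= thom_del (chtpy_del h); congr (cpl_eta _ _).
    have lh := @hunit_linear D; have lv := linearP v.
    pose T : {linear _ -> _} := HB.pack (tmap (@hunit k D H) v)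
      (GRing.isLinear.Build _ _ _ _ _ (tmap_linear lh lv)).
    pose T' : {linear _ -> _} := HB.pack (tmap v (@hunit k D H))
      (GRing.isLinear.Build _ _ _ _ _ (tmap_linear lv lh)).
    have e0 i : @hunit k D H \o q i =1 \0.
      by move=> y; rewrite /= /hunit (chtpy_eps h) scale0r.
    have e1 i : @hunit k D H \o p i.+1 =1 \0.
      by move=> y; rewrite /= /hunit (chtpy_eps0 _ _ h) scale0r.
    have e2 : @hunit k D H \o p 0 =1 @hunit k C H.
      by move=> y; rewrite /= p0 -(hunit_comp f).
    have lq i : linear (v \o q i) by exact: linearP.
    have lp i : linear (v \o p i) by exact: linearP.
    have lk : linear (ksgn C 1) by exact: ksgn_linear.
    have key (i : 'I_n.+1) : let y := gtmap C 1 (p i) (q (n - i)%N) (cdel C x)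
          + tmap (q i) (p (n - i)%N) (cdel C x) in T y + T' y =
        (if i == ord0 then gtmap C 1 (@hunit k C H) (v \o q n) (cdel C x) else 0) +
        (if i == ord_max then tmap (v \o q n) (@hunit k C H) (cdel C x) else 0).
      move=> y; rewrite /y (linearD T) (linearD T') /=.
      rewrite !gtmap_comp ?tmap_comp; try exact: linearP; try exact: hunit_linear.
      rewrite [X in _ + X + _]tmap0l // addr0.
      rewrite [gtmap _ _ (v \o _) _ _]/gtmap [X in _ + (X + _)]tmap0r //; last exact: linear_comp.
      rewrite add0r; congr (_ + _).
        case: eqP => [->|/eqP ni]; first by rewrite subn0; apply: eq_tmap => // z; rewrite /= -e2.
        have : (0 < i)%N.
          by rewrite lt0n; apply: contra_neq ni => e; apply: val_inj.
        case: (nat_of_ord i) => // j _.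
        by rewrite /gtmap tmap0l // => z; rewrite /= -[LHS]/((@hunit k D H \o p j.+1) _) e1.
      case: eqP => [->|/eqP ni]; first by rewrite /= subnn; apply: eq_tmap.
      have : (0 < n - i)%N.
        rewrite subn_gt0 ltn_neqAle -ltnS ltn_ord andbT.
        by apply: contra_neq ni => e; apply: val_inj.
      by case: (n - i)%N => // j _; rewrite tmap0r.
    rewrite -[X in X + _]/(T _) -[X in _ + X]/(T' _) !linear_sum -big_split.
    rewrite (eq_bigr _ (fun i _ => key i)) big_split -!big_mkcond /=.
    by rewrite !big_pred1_eq.
- by rewrite /= p0.
- exists N => m Nm; rewrite /= p1 linear_sum.
  rewrite -(subnKC Nm) big_split_ord /= [X in _ - (_ + X)]big1 ?addr0 ?subrr.
    exact: fil0.
  move=> i _; have [-> _] := chtpy_bound h (leq_addr i N).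
  by rewrite linear0.
Qed.

Lemma thomotopic_prer C D (v v' : thom D H) (f : chom C D) :
  thomotopic v v' -> thomotopic (thom_pre v f) (thom_pre v' f).
Proof.
case=> p [q [h p0 p1]].
exists (fun i => p i \o f), (fun i => q i \o f); split=> [|x|x].
- split=> [n|i|i x|i x|i x].
  + by have [N hN] := thtpy_bound h n; exists N => i x; exact: hN.
  + have [pi qi] := thtpy_deg h i.
    have df := @chom_deg _ _ _ f.
    split; first exact: degmap_comp df pi.
    by have := degmap_comp df qi; rewrite add0r.
  + rewrite /= (thtpy_deriv h).
    by apply: hom_dif_precomp => w; rewrite chom_dif.
  + by rewrite /= (thtpy_eps h).
  + rewrite /= (thtpy_del h) chom_del.
    rewrite (gtmap_precomp _ _ (@chom_deg _ _ _ f)) ?tmap_comp;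
      try exact: linearP; try exact: hunit_linear.
    congr (cpl_eta _ (_ + _)); apply: eq_tmap => // y; last by rewrite hunit_comp.
    by rewrite /= -[LHS]/((@hunit k D H \o f) _) hunit_comp.
- by rewrite /= p0.
- exact: p1.
Qed.

Definition hoTP_ob C := ho_thom C H.

Definition hoTP_arr C D (f : ho_hom C D) (v : ho_thom D H) : ho_thom C H :=
  class_of _ (thom_pre (class_repr v) (class_repr f)).

Lemma hoTP_arrE C D (f : chom C D) (v : thom D H) :
  hoTP_arr (class_of _ f) (class_of _ v) = class_of _ (thom_pre v f).
Proof.
apply/class_eqP; apply: rst_trans (_ : clos_refl_sym_trans _ _ _ (thom_pre v _)) _.
  apply: (rst_map (h := fun v => thom_pre v _)) (class_repr_of _ _).
  by move=> *; exact: thomotopic_prer.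
apply: (rst_map (h := thom_pre v)) (class_repr_of _ _).
by move=> *; exact: thomotopic_prel.
Qed.

Fact hoTP_id C (v : ho_thom C H) : hoTP_arr (ho_id C) v = v.
Proof.
rewrite -[v]class_reprK hoTP_arrE; apply/class_eqP/rst_step.
exact: thomotopic_ext.
Qed.

Fact hoTP_comp C D E (g : ho_hom D E) (f : ho_hom C D) (x : ho_thom E H) :
  hoTP_arr (ho_comp g f) x = hoTP_arr f (hoTP_arr g x).
Proof.
rewrite -[x]class_reprK -[g]class_reprK -[f]class_reprK ho_compE !hoTP_arrE.
by apply/class_eqP/rst_step; exact: thomotopic_ext.
Qed.

Definition psh_TP : presheaf (ho_ccdgc k) :=
  @Presheaf (ho_ccdgc k) hoTP_ob hoTP_arr hoTP_id hoTP_comp.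

End PresheafTP.

(* Main.v *)
Require Import Defs.
From HB Require Import structures.
From mathcomp Require Import all_boot all_order all_algebra.
From mathcomp Require Import boolp classical_sets functions cardinality fsbigop.
From mathcomp Require Import zify.
From Stdlib Require Import Relation_Operators.

Set Implicit Arguments.
Unset Strict Implicit.
Unset Printing Implicit Defensive.

Import GRing.Theory.
Local Open Scope ring_scope.
Local Open Scope classical_set_scope.

(** The maps [C -> H] form a complete filtered algebra under the convolution
    product [f * g = m o (f (x) g) o Delta_C], in which the two formulas are the
    power series [exp] and [ln (1 + x)]; they are inverse to each other because
    the truncated polynomials are.

    For degree 0 maps, cocommutativity of [C] gives the interchange law
    [(f | g) * (f' | g') = (f * f' | g * g')] for [(f | g) = (f (x) g) o Delta_C].
    Hence if [v] is tangent, [Delta_H o v^n] is the binomial sum of the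
    [(v^i | v^(n-i))], and [exp v] is grouplike. Conversely, if [g = exp a] is
    grouplike then so is [exp (m a) = g^m] for all [m]; modulo each [F^n] this is a
    polynomial identity in [m], whose linear coefficient says that [a] is tangent.

    Homotopies need no separate computation: a homotopy pair [(f(t), xi(t))] is a
    single map [f(t) + xi(t) dt] from the ccdg-coalgebra [K (x) C], with [K] dual
    to [k[t, dt]], whose coefficients tend to 0. So [exp] and [ln] of a homotopy
    are obtained by applying the above to [K (x) C] in place of [C]. *)

(** * Tensors, gradings and filtrations *)

(** Three features of the definitions shape the argument. A homotopy pair constrains the counit and
    coproduct of xi(t) and of f(0) only. To read it as one morphism from [K (x) C], the same
    conditions on the later coefficients of f(t) are recovered from (i + 1) f_(i+1) = d xi_i,
    dividing by i + 1 in characteristic zero. Next, [H] is complete degree by degree: a series is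
    summed on homogeneous arguments and extended by linearity, and separatedness makes the sum
    unique, which yields naturality and the inverse laws. Finally, t = 0 is a coalgebra morphism
    from [C] to [K (x) C], but t = 1 is not: it would be the infinite sum of all the duals of t^i.
    The endpoint of a homotopy is therefore followed by a Cauchy product argument, which uses that
    the coefficients tend to 0 uniformly on [C]. For the logarithm, working with the natural powers
    [g^m] avoids a calculus of logarithms in the completed tensor square. *)

Section LinearFacts.
Variables (k : fieldType) (V W : lmodType k) (f : V -> W).
Hypothesis lf : linear f.

(** Convolutions and tensor products of maps are plain functions with a separate proof of linearity;
    the local bundle gives them the algebraic lemmas on linear maps. *)
Let T : {linear V -> W} := HB.pack f (GRing.isLinear.Build _ _ _ _ f lf).

Lemma lin0 : f 0 = 0. Proof. exact: (linear0 T). Qed.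
Lemma linD u v : f (u + v) = f u + f v. Proof. exact: (linearD T). Qed.
Lemma linB u v : f (u - v) = f u - f v. Proof. exact: (linearB T). Qed.
Lemma linZ a v : f (a *: v) = a *: f v. Proof. exact: (linearZ_LR T). Qed.
Lemma lin_sum I (r : seq I) (P : pred I) F :
  f (\sum_(i <- r | P i) F i) = \sum_(i <- r | P i) f (F i).
Proof. exact: (linear_sum T). Qed.
Lemma lin_tlift (X Y : lmodType k) (B : X -> Y -> V) t :
  f (tlift B t) = tlift (fun x y => f (B x y)) t.
Proof. exact: (linear_sum_tlift _ T). Qed.
End LinearFacts.

Section Spans.
Variables (k : fieldType) (V : lmodType k).

Lemma linear_idfun : linear (id : V -> V). Proof. by []. Qed.

Lemma linear_scale (W : lmodType k) (f : V -> W) a :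
  linear f -> linear (fun v => a *: f v).
Proof. by move=> lf b u v; rewrite lf scalerDr !scalerA mulrC. Qed.

Lemma linear_add (W : lmodType k) (f g : V -> W) :
  linear f -> linear g -> linear (fun v => f v + g v).
Proof. by move=> lf lg b u v; rewrite lf lg scalerDr addrACA. Qed.

Lemma linear_bigsum (W : lmodType k) I (r : seq I) (P : pred I) (F : I -> V -> W) :
  (forall i, linear (F i)) -> linear (fun v => \sum_(i <- r | P i) F i v).
Proof.
move=> lF b u v; rewrite scaler_sumr -big_split.
by apply: eq_bigr => i _; rewrite lF.
Qed.

Lemma subspace_sum (P : set V) I (r : seq I) (Q : pred I) F :
  subspace P -> (forall i, Q i -> P (F i)) -> P (\sum_(i <- r | Q i) F i).
Proof.
move=> [P0 Pl] PF; elim/big_rec: _ => // i x Qi Px.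
by have := Pl 1 _ _ (PF i Qi) Px; rewrite scale1r.
Qed.

Lemma subspaceB (P : set V) u v : subspace P -> P u -> P v -> P (u - v).
Proof. by case=> _ Pl Pu Pv; have := Pl (-1) _ _ Pv Pu; rewrite scaleN1r addrC. Qed.

Lemma subspaceD (P : set V) u v : subspace P -> P u -> P v -> P (u + v).
Proof. by case=> _ Pl Pu Pv; have := Pl 1 _ _ Pu Pv; rewrite scale1r. Qed.

Lemma subspaceZ (P : set V) a v : subspace P -> P v -> P (a *: v).
Proof. by case=> P0 Pl Pv; have := Pl a _ _ Pv P0; rewrite addr0. Qed.

Lemma lspan_gen (S : set V) v : S v -> lspan S v.
Proof. by move=> Sv P _; apply. Qed.

Lemma lspan_map (W : lmodType k) (f : V -> W) (S : set V) (P : set W) :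
  linear f -> subspace P -> (forall v, S v -> P (f v)) ->
  forall v, lspan S v -> P (f v).
Proof.
move=> lf sP SP v /(_ [set v | P (f v)]); apply; last exact: SP.
by split=> [|a u w] /=; rewrite ?(lin0 lf) ?lf; [exact: sP.1|apply: sP.2].
Qed.

Lemma lspan_eq (W : lmodType k) (f g : V -> W) (S : set V) :
  linear f -> linear g -> (forall v, S v -> f v = g v) ->
  forall v, lspan S v -> f v = g v.
Proof.
move=> lf lg fg v /(_ [set v | f v = g v]); apply; last exact: fg.
by split=> [|a u w] /=; rewrite ?(lin0 lf) ?(lin0 lg) // lf lg => -> ->.
Qed.

Lemma homog_subspace (X : dgmod V) i : subspace (homog X i).
Proof.
by split=> [|a u v]; rewrite /homog /= ?linear0 // linearP => -> ->.
Qed.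

(** The values at the nodes 0, ..., n - 1 suffice: these are distinct in characteristic zero, so the
    Vandermonde matrix is invertible and its inverse writes each coefficient as a combination of
    values. *)
Lemma subspace_coef (P : set V) n (z : 'I_n -> V) :
  [pchar k] =i pred0 -> subspace P ->
  (forall m : nat, P (\sum_(i < n) m%:R ^+ i *: z i)) -> forall i, P (z i).
Proof.
move=> ch sP h i.
pose M := Vandermonde (R := k) n (\row_(j < n) (j : nat)%:R).
have uM : M \in unitmx.
  rewrite unitmxE det_Vandermonde unitfE; apply/prodf_neq0 => a _; apply/prodf_neq0 => b ab.
  rewrite !mxE -natrB ?(ltnW ab) //.
  by rewrite ((pcharf0P k).1 ch) subn_eq0 -ltnNge.
have -> : z i = \sum_(m < n) (invmx M) m i *: (\sum_(j < n) (m : nat)%:R ^+ j *: z j).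
  have e j : \sum_m M j m * invmx M m i = (j == i)%:R.
    by have /matrixP/(_ j i) := mulmxV uM; rewrite !mxE.
  under eq_bigr do rewrite scaler_sumr.
  rewrite exchange_big /= -[LHS]scale1r.
  transitivity (\sum_j (j == i)%:R *: z j).
    rewrite (bigD1 i) //= eqxx [X in _ + X]big1 ?addr0 // => j /negbTE ->.
    by rewrite scale0r.
  apply: eq_bigr => j _; rewrite -e scaler_suml; apply: eq_bigr => m _.
  by rewrite !mxE scalerA mulrC.
by apply: subspace_sum => // m _; apply: subspaceZ.
Qed.

End Spans.

Section TensorCalculus.
Variable k : fieldType.
Implicit Types V W U : lmodType k.

Lemma tlift_linearl V W U (Y : lmodType k) (B : Y -> V -> W -> U) (t : tens V W) :
  (forall v w, linear (fun y => B y v w)) -> linear (fun y => tlift (B y) t).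
Proof. by move=> lB; apply: linear_bigsum. Qed.

Lemma tlift_sum V W U I (r : seq I) (P : pred I) (B : I -> V -> W -> U) t :
  tlift (fun v w => \sum_(i <- r | P i) B i v w) t = \sum_(i <- r | P i) tlift (B i) t.
Proof. exact: exchange_big. Qed.

Lemma tlift_add2 V W U (B B' : V -> W -> U) t :
  tlift (fun v w => B v w + B' v w) t = tlift B t + tlift B' t.
Proof. exact: big_split. Qed.

Lemma tlift_scale2 V W U a (B : V -> W -> U) t :
  tlift (fun v w => a *: B v w) t = a *: tlift B t.
Proof. by rewrite /tlift scaler_sumr. Qed.

Lemma tlift_tmap V W V' W' U (f : V -> V') (g : W -> W') (B : V' -> W' -> U) t :
  linear f -> linear g -> bilin B ->
  tlift B (tmap f g t) = tlift (fun v w => B (f v) (g w)) t.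
Proof.
move=> lf lg bB; rewrite /tmap (lin_tlift (tliftP bB)).
by apply: eq_tlift => v w; rewrite tlift_pure.
Qed.

Lemma bilin_comp V W V' W' U (f : V -> V') (g : W -> W') (B : V' -> W' -> U) :
  linear f -> linear g -> bilin B -> bilin (fun v w => B (f v) (g w)).
Proof. by move=> lf lg [b1 b2]; split=> [w a u v|v a u w]; rewrite ?lf ?lg ?b1 ?b2. Qed.

Lemma bilin_lin V W U U' (f : U -> U') (B : V -> W -> U) :
  linear f -> bilin B -> bilin (fun v w => f (B v w)).
Proof. by move=> lf [b1 b2]; split=> [w a u v|v a u w]; rewrite ?b1 ?b2 lf. Qed.

Lemma bilin_swap V W U (B : V -> W -> U) : bilin B -> bilin (fun w v => B v w).
Proof. by case=> b1 b2; split. Qed.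

Lemma bilin_mul (A : algType k) : bilin (fun x y : A => x * y).
Proof.
by split=> [w a u v|v a u w]; rewrite ?mulrDl ?mulrDr -?scalerAl -?scalerAr.
Qed.

Lemma tfil_pure V W (F : filt V) (G : filt W) i j v w :
  F i v -> G j w -> tens_filt F G (i + j)%N (tpure v w).
Proof. by move=> Fv Gw; apply: lspan_gen; exists i, j, v, w. Qed.

Lemma fil_le V (F : filt V) m n v : (m <= n)%N -> F n v -> F m v.
Proof. by move/subnK <-; elim: (n - m)%N => // d IH /fil_dec. Qed.

Lemma fil_sum V (F : filt V) n I (r : seq I) (P : pred I) (f : I -> V) :
  (forall i, P i -> F n (f i)) -> F n (\sum_(i <- r | P i) f i).
Proof. by move=> h; apply: subspace_sum => //; exact: fil_sub. Qed.

Lemma tlift_fil V W U (F : filt U) n (B : V -> W -> U) t :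
  (forall v w, F n (B v w)) -> F n (tlift B t).
Proof. by move=> h; apply: fil_sum. Qed.

Lemma tmap_fil V W V' W' (F : filt V') (G : filt W') i j (f : V -> V') (g : W -> W') t :
  (forall v, F i (f v)) -> (forall w, G j (g w)) ->
  tens_filt F G (i + j)%N (tmap f g t).
Proof. by move=> Ff Gg; apply: tlift_fil => v w; apply: tfil_pure. Qed.

End TensorCalculus.

Section GradedCalculus.
Variable k : fieldType.
Implicit Types V W U : lmodType k.

Lemma homog_ind V (X : dgmod V) (P : set V) :
  subspace P -> (forall i v, homog X i v -> P v) -> forall v, P v.
Proof.
move=> sP hP v; have [r [ur hr]] := gpr_cover X v v.
rewrite [v](gpr_sum_cover (X := X) ur) => [|i /hr[] //].
by apply: subspace_sum => // i _; apply: hP; exact: gpr_homog.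
Qed.

Lemma homog_ext V W (X : dgmod V) (f g : V -> W) :
  linear f -> linear g -> (forall i v, homog X i v -> f v = g v) -> f =1 g.
Proof.
move=> lf lg fg; apply: (homog_ind (X := X) (P := [set v | f v = g v])) => //.
by split=> [|a u v] /=; rewrite ?(lin0 lf) ?(lin0 lg) // lf lg => -> ->.
Qed.

Lemma tens_homog_ext V W U (X : dgmod V) (Y : dgmod W) (f g : tens V W -> U) :
  linear f -> linear g ->
  (forall i j v w, homog X i v -> homog Y j w -> f (tpure v w) = g (tpure v w)) ->
  f =1 g.
Proof.
move=> lf lg fg; apply: tens_linear_ext => // v w.
have [b1 b2] := tpure_bilin V W.
move: v; apply: (homog_ext (X := X)) => [a x y|a x y|i v hv]; rewrite ?b1 ?lf ?lg //.
move: w; apply: (homog_ext (X := Y)) => [a x y|a x y|j w hw]; rewrite ?b2 ?lf ?lg //.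
exact: fg hv hw.
Qed.

Lemma homog_gpr V (X : dgmod V) i j v :
  homog X i v -> gpr X j v = if j == i then v else 0.
Proof. by move=> hv; rewrite -{1}hv gpr_idem hv. Qed.

Lemma ksgn_homog V (X : dgmod V) n i v :
  homog X i v -> ksgn X n v = (-1) ^+ (n * absz i) *: v.
Proof.
move=> hv; rewrite (@ksgn_cover _ _ X n v [:: i]) ?big_seq1 ?hv // => j.
by rewrite inE => ji; rewrite (homog_gpr j hv) (negbTE ji).
Qed.

Lemma koszul_homogr V W U (X : dgmod V) (Y : dgmod W) (B : V -> W -> U) v j w :
  bilin B -> homog Y j w -> koszul X Y B v w = B (ksgn X (absz j) v) w.
Proof.
move=> bB hw.
rewrite /koszul (gsum_cover (r := [:: j]) (F := fun j w => B (ksgn X (absz j) v) w)) //.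
- by rewrite big_seq1 hw.
- by move=> i; rewrite inE => ij; rewrite (homog_gpr _ hw) (negbTE ij).
- by move=> i; rewrite (bilin0r bB).
Qed.

(** The absolute value is not additive on integers, but its parity is. *)
Lemma sign_absD (i j : int) n :
  (-1) ^+ (n * absz (i + j)) = (-1) ^+ (n * absz i) * (-1) ^+ (n * absz j) :> k.
Proof.
rewrite -exprD -mulnDr -signr_odd -[RHS]signr_odd; congr (_ ^+ nat_of_bool _).
rewrite !oddM; congr (_ && _).
by case: i j => [i|i] [j|j]; rewrite ?oddD //; lia.
Qed.

Lemma sign_sq n : (-1) ^+ n * (-1) ^+ n = 1 :> k.
Proof. by rewrite -expr2 sqrr_sign. Qed.

Lemma ksgnD V (X : dgmod V) m n v : ksgn X m (ksgn X n v) = ksgn X (m + n) v.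
Proof.
move: v; apply: (homog_ext (X := X)).
- by apply: linear_comp; exact: ksgn_linear.
- exact: ksgn_linear.
move=> i v hv; rewrite (ksgn_homog n hv) (linZ (ksgn_linear X m)) !(ksgn_homog _ hv).
by rewrite scalerA -exprD -mulnDl addnC.
Qed.

Lemma ksgn_odd V (X : dgmod V) n v : ksgn X (odd n) v = ksgn X n v.
Proof.
move: v; apply: (homog_ext (X := X)); try exact: ksgn_linear.
by move=> i v hv; rewrite !(ksgn_homog _ hv) -signr_odd -[in RHS]signr_odd !oddM oddb.
Qed.

Lemma ksgn2 V (X : dgmod V) n v : ksgn X n (ksgn X n v) = v.
Proof. by rewrite ksgnD -ksgn_odd addnn odd_double ksgn0. Qed.

Lemma ksgn_degmap V W (X : dgmod V) (Y : dgmod W) (d n : nat) (f : V -> W) v :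
  linear f -> degmap X Y d%:Z f -> ksgn Y n (f v) = (-1) ^+ (n * d) *: f (ksgn X n v).
Proof.
move=> lf df; move: v; apply: (homog_ext (X := X)).
- by apply: (linear_comp (f := ksgn Y n)) => //; exact: ksgn_linear.
- by apply: linear_scale; apply: linear_comp => //; exact: ksgn_linear.
move=> i v hv; rewrite (ksgn_homog n (df _ _ hv)) (ksgn_homog _ hv) (linZ lf) scalerA.
by rewrite sign_absD mulrC.
Qed.

Lemma homog_dif V (X : dgmod V) i v : homog X i v -> homog X (i - 1) (gdif X v).
Proof. by move=> hv; rewrite /homog /= -gdif_deg hv. Qed.

Lemma ksgn_dif V (X : dgmod V) n v : ksgn X n (gdif X v) = (-1) ^+ n *: gdif X (ksgn X n v).
Proof.
move: v; apply: (homog_ext (X := X)).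
- by apply: (linear_comp (f := ksgn X n)); [exact: ksgn_linear|exact: linearP].
- by apply: linear_scale; apply: (linear_comp (f := gdif X)); [exact: linearP|exact: ksgn_linear].
move=> i v hv; rewrite (ksgn_homog n (homog_dif hv)) (ksgn_homog _ hv) linearZ /= scalerA.
by rewrite sign_absD mulrC muln1.
Qed.

Lemma gtmap_linear V W V' W' (X : dgmod V) n (f : V -> V') (g : W -> W') :
  linear f -> linear g -> linear (gtmap X n f g).
Proof.
by move=> lf lg; apply: tmap_linear => //; apply: linear_comp => //; exact: ksgn_linear.
Qed.

Lemma tdif_linear V W (X : dgmod V) (Y : dgmod W) : linear (tdif X Y).
Proof.
apply: linear_add; first by apply: tmap_linear; [exact: linearP|].
by apply: gtmap_linear => //; exact: linearP.
Qed.

Lemma tdif_pure V W (X : dgmod V) (Y : dgmod W) v w :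
  tdif X Y (tpure v w) = tpure (gdif X v) w + tpure (ksgn X 1 v) (gdif Y w).
Proof.
rewrite /tdif /gtmap !tmap_pure //; try exact: linearP.
by apply: (linear_comp (f := id)) => //; exact: ksgn_linear.
Qed.

Lemma tlift_tdif V W U (X : dgmod V) (Y : dgmod W) (B : V -> W -> U) t : bilin B ->
  tlift B (tdif X Y t) =
  tlift (fun v w => B (gdif X v) w) t + tlift (fun v w => B (ksgn X 1 v) (gdif Y w)) t.
Proof.
move=> bB; rewrite /tdif (linD (tliftP bB)) /gtmap !tlift_tmap //; try exact: linearP.
by apply: (linear_comp (f := id)) => //; exact: ksgn_linear.
Qed.

End GradedCalculus.

Definition trilin (k : fieldType) (V1 V2 V3 U : lmodType k) (T : V1 -> V2 -> V3 -> U) :=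
  [/\ forall v w, linear (fun u => T u v w), forall u w, linear (fun v => T u v w)
    & forall u v, linear (T u v)].

Section KoszulCalculus.
Variable k : fieldType.
Implicit Types V W U : lmodType k.

Lemma koszul_cover V W U (X : dgmod V) (Y : dgmod W) (B : V -> W -> U) v w r :
  bilin B -> uniq r -> (forall i, i \notin r -> gpr Y i w = 0) ->
  koszul X Y B v w = \sum_(j <- r) B (ksgn X (absz j) v) (gpr Y j w).
Proof.
move=> bB ur hr; apply: (gsum_cover (F := fun j y => B (ksgn X (absz j) v) y)) => //.
by move=> i; rewrite (bilin0r bB).
Qed.

(** The finite list of degrees depends on [w] alone, so one list serves all values of the
    parameter. *)
Lemma koszul_param V W U (L : lmodType k) (X : dgmod V) (Y : dgmod W)
    (B : L -> V -> W -> U) v w :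
  (forall a, bilin (B a)) -> (forall v w, linear (fun a => B a v w)) ->
  linear (fun a => koszul X Y (B a) v w).
Proof.
move=> bB lB; have [r [ur hr]] := gpr_cover Y w w.
have hw j : j \notin r -> gpr Y j w = 0 by case/hr.
have -> : (fun a => koszul X Y (B a) v w) =
    fun a => \sum_(j <- r) B a (ksgn X (absz j) v) (gpr Y j w).
  by apply/funext => a; apply: koszul_cover.
exact: linear_bigsum.
Qed.

Lemma lin_koszul V W U U' (X : dgmod V) (Y : dgmod W) (f : U -> U') (B : V -> W -> U) v w :
  linear f -> bilin B -> f (koszul X Y B v w) = koszul X Y (fun v w => f (B v w)) v w.
Proof.
move=> lf bB; have [r [ur hr]] := gpr_cover Y w w.
have hw j : j \notin r -> gpr Y j w = 0 by case/hr.
rewrite !(koszul_cover _ _ _ ur hw) //; last exact: bilin_lin.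
exact: lin_sum.
Qed.

Lemma koszul_map V W V' W' U (X : dgmod V) (Y : dgmod W) (X' : dgmod V') (Y' : dgmod W')
    (B : V' -> W' -> U) (f : {linear V -> V'}) (g : {linear W -> W'}) v w :
  bilin B -> degmap X X' 0 f -> degmap Y Y' 0 g ->
  koszul X' Y' B (f v) (g w) = koszul X Y (fun v w => B (f v) (g w)) v w.
Proof.
move=> bB df dg; have [r [ur hr]] := gpr_cover Y w w.
have hw j : j \notin r -> gpr Y j w = 0 by case/hr.
have hw' j : j \notin r -> gpr Y' j (g w) = 0.
  by move=> /hw e; rewrite (degmap0_gpr j w dg) e linear0.
rewrite (koszul_cover _ _ bB ur hw').
rewrite (koszul_cover _ _ (bilin_comp (linearP f) (linearP g) bB) ur hw).
by apply: eq_bigr => j _; rewrite (degmap0_gpr j w dg) (degmap0_ksgn _ _ df).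
Qed.

(** The sign on [v] sees only the absolute value of the degree of [w], hence the two cases with a
    natural number [j]. *)
Lemma koszul_fil V W U (X : dgmod V) (Y : dgmod W) (F : filt U) n
    (B : V -> W -> U) v w : bilin B ->
  (forall j, F n (B (ksgn X j v) (gpr Y j%:Z w)) /\
             F n (B (ksgn X j v) (gpr Y (- j%:Z) w))) -> F n (koszul X Y B v w).
Proof.
move=> bB h; have [r [ur hr]] := gpr_cover Y w w.
rewrite (koszul_cover X v bB ur) => [|j /hr[]//].
apply: fil_sum => j _; case: (intP j) => [|m|m]; first by have [] := h 0%N.
  by have [] := h m.+1.
by rewrite abszN; have [] := h m.+1.
Qed.

End KoszulCalculus.

(** * Convolution *)

Section Sweedler.
Variables (k : fieldType) (C : ccdgc k).
Implicit Types U : lmodType k.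

Lemma cs_linear U (B : C -> C -> U) : bilin B -> linear (fun x => tlift B (cdel C x)).
Proof. by move=> bB a u v; rewrite linearP tliftP. Qed.

(** This is coassociativity in Sweedler form: the axiom, an equality of threefold tensors, is tested
    on the linear map induced by [T]. *)
Lemma cdel_coassoc U (T : C -> C -> C -> U) x : trilin T ->
  tlift (fun y z => tlift (fun y1 y2 => T y1 y2 z) (cdel C y)) (cdel C x) =
  tlift (fun y z => tlift (fun z1 z2 => T y z1 z2) (cdel C z)) (cdel C x).
Proof.
case=> l1 l2 l3; have b u : bilin (T u) by split.
have bB : bilin (fun u t => tlift (T u) t).
  split=> [t|u]; last exact: tliftP.
  exact: tlift_linearl.
have b12 z : bilin (fun y1 y2 => T y1 y2 z) by split.
have bp := tpure_bilin; have lc := linearP (cdel C).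
have := congr1 (tlift (fun u t => tlift (T u) t)) (cdel_assoc x).
rewrite (tlift_tmap (f := id)) // => <-.
have ba z : bilin (fun v w : C => tpure v (tpure w z)).
  split=> [w a u v|v a u w]; first by rewrite (bp _ _ _).1.
  by rewrite (bp _ _ _).1 (bp _ _ _).2.
rewrite /tassoc tlift_tmap //; last first.
  split=> [z|t]; first exact: tliftP.
  apply: tlift_linearl => v w a z z'.
  by rewrite !(bp _ _ _).2.
rewrite (lin_tlift (tliftP bB)); apply: eq_tlift => y z.
rewrite (lin_tlift (tliftP bB)); apply: eq_tlift => y1 y2.
by rewrite !tlift_pure.
Qed.

Lemma cdel_cocomm U (B : C -> C -> U) x : bilin B ->
  tlift (koszul C C (fun b c => B c b)) (cdel C x) = tlift B (cdel C x).
Proof.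
move=> bB; rewrite -{2}(cdel_comm x) /tswap (lin_tlift (tliftP bB)).
apply: eq_tlift => v w; rewrite lin_koszul; last 2 first.
- exact: tliftP.
- exact/bilin_swap/tpure_bilin.
by congr (koszul _ _ _ _ _); apply/funext => a; apply/funext => b; rewrite tlift_pure.
Qed.

(** The sign is multiplicative in the degree, and the coproduct of a homogeneous element is spanned
    by pure tensors of the same total degree. *)
Lemma cdel_ksgn n x : cdel C (ksgn C n x) = tmap (ksgn C n) (ksgn C n) (cdel C x).
Proof.
have ls := ksgn_linear C n; move: x; apply: (homog_ext (X := C)).
- by apply: (linear_comp (f := cdel C)); first exact: linearP.
- by apply: (linear_comp (f := tmap _ _)); [exact: tmap_linear|exact: linearP].
move=> i x hx; rewrite (ksgn_homog n hx) linearZ /=; symmetry.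
apply: (@lspan_eq k _ _ (tmap (ksgn C n) (ksgn C n))
  (fun t => (-1) ^+ (n * absz i) *: t) _ _ _ _ _ (cdel_deg hx)).
- exact: tmap_linear.
- exact: (@linear_scale k _ _ id).
move=> _ [a [b [v [w [ab hv hw ->]]]]]; rewrite tmap_pure //.
rewrite !(ksgn_homog _ hv, ksgn_homog _ hw) (bilinZl (tpure_bilin _ _)).
by rewrite (bilinZr (tpure_bilin _ _)) scalerA -ab sign_absD.
Qed.

Lemma ceps_ksgn n x : ceps C (ksgn C n x) = ceps C x.
Proof.
have ls := ksgn_linear C n; move: x; apply: (homog_ext (X := C)).
- by apply: (linear_comp (f := ceps C)); first exact: linearP.
- exact: linearP.
move=> i x hx; rewrite (ksgn_homog n hx) linearZ /=.
have [->|i0] := eqVneq i 0; first by rewrite muln0 scale1r.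
by rewrite -hx ceps_deg // scaler0.
Qed.

End Sweedler.

Section Convolution.
Variables (k : fieldType) (C : ccdgc k) (A : algType k).
Implicit Types (f g h : C -> A) (p q : {poly k}).

Definition conv f g (x : C) : A := tlift (fun y z => f y * g z) (cdel C x).

(** The unit of the convolution product; for a Hopf algebra it is convertible to [hunit]. *)
Definition cunit (x : C) : A := ceps C x *: 1.

Lemma cunit_linear : linear cunit.
Proof. by move=> a u v; rewrite /cunit linearP scalerDl -scalerA. Qed.

Lemma conv_bilin f g : linear f -> linear g -> bilin (fun y z => f y * g z).
Proof. by move=> lf lg; apply: bilin_comp => //; exact: bilin_mul. Qed.

Lemma conv_linear f g : linear f -> linear g -> linear (conv f g).
Proof. by move=> lf lg; apply/cs_linear/conv_bilin. Qed.

Lemma convA f g h x : linear f -> linear g -> linear h ->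
  conv (conv f g) h x = conv f (conv g h) x.
Proof.
move=> lf lg lh; have [m1 m2] := bilin_mul A.
have T : trilin (fun y1 y2 z => f y1 * g y2 * h z).
  by split=> v w a b c; rewrite ?lf ?lg ?lh !(m1, m2).
transitivity (tlift (fun y z => tlift (fun y1 y2 => f y1 * g y2 * h z) (cdel C y)) (cdel C x)).
  by apply: eq_tlift => y z; exact: (lin_tlift (m1 (h z))).
rewrite cdel_coassoc //; apply: eq_tlift => y z; rewrite (lin_tlift (m2 (f y))).
by apply: eq_tlift => z1 z2; rewrite mulrA.
Qed.

Lemma conv1l f x : linear f -> conv cunit f x = f x.
Proof.
move=> lf; rewrite -[in RHS](cdel_epsl x) (lin_tlift lf); apply: eq_tlift => y z.
by rewrite /cunit -scalerAl mul1r (linZ lf).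
Qed.

Lemma conv1r f x : linear f -> conv f cunit x = f x.
Proof.
move=> lf; rewrite -[in RHS](cdel_epsr x) (lin_tlift lf); apply: eq_tlift => y z.
by rewrite /cunit -scalerAr mulr1 (linZ lf).
Qed.

Lemma conv_suml I (r : seq I) (P : pred I) (F : I -> C -> A) g x :
  conv (fun x => \sum_(i <- r | P i) F i x) g x = \sum_(i <- r | P i) conv (F i) g x.
Proof. by rewrite /conv -tlift_sum; apply: eq_tlift => y z; rewrite mulr_suml. Qed.

Lemma conv_sumr I (r : seq I) (P : pred I) (F : I -> C -> A) f x :
  conv f (fun x => \sum_(i <- r | P i) F i x) x = \sum_(i <- r | P i) conv f (F i) x.
Proof. by rewrite /conv -tlift_sum; apply: eq_tlift => y z; rewrite mulr_sumr. Qed.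

Lemma convZl a f g x : conv (fun x => a *: f x) g x = a *: conv f g x.
Proof. by rewrite /conv -tlift_scale2; apply: eq_tlift => y z; rewrite scalerAl. Qed.

Lemma convZr a f g x : conv f (fun x => a *: g x) x = a *: conv f g x.
Proof. by rewrite /conv -tlift_scale2; apply: eq_tlift => y z; rewrite scalerAr. Qed.

Lemma convBB f g f' g' x :
  conv f g x - conv f' g' x = conv (f \- f') g x + conv f' (g \- g') x.
Proof.
apply/eqP; rewrite subr_eq /conv -!tlift_add2; apply/eqP/eq_tlift => y z /=.
by rewrite mulrBl mulrBr addrA !subrK.
Qed.

Fixpoint cpow f n : C -> A := if n is n'.+1 then conv f (cpow f n') else cunit.

Lemma cpow_linear f n : linear f -> linear (cpow f n).
Proof.
by move=> lf; elim: n => [|n IH]; [exact: cunit_linear|exact: conv_linear].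
Qed.

Lemma cpowD f i j x : linear f -> cpow f (i + j) x = conv (cpow f i) (cpow f j) x.
Proof.
move=> lf; have lp n := cpow_linear n lf.
elim: i x => [|i IH] x; first by rewrite /= conv1l.
by rewrite /= convA //; apply: eq_tlift => y z; rewrite IH.
Qed.

(** Substitution of [f] for the variable. It is multiplicative and compatible with composition, so
    identities between power series of maps reduce to identities in [{poly k}]. *)
Definition ev f (p : {poly k}) x := \sum_(i < size p) p`_i *: cpow f i x.

Lemma ev_widen f p n x : (size p <= n)%N -> ev f p x = \sum_(i < n) p`_i *: cpow f i x.
Proof.
move=> pn; rewrite /ev (big_ord_widen _ (fun i => p`_i *: cpow f i x) pn).
rewrite big_mkcond; apply: eq_bigr => i _; case: ltnP => // /(nth_default 0) ->.
by rewrite scale0r.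
Qed.

Lemma ev_linear f p : linear f -> linear (ev f p).
Proof.
by move=> lf; apply: linear_bigsum => i; apply: linear_scale; exact: cpow_linear.
Qed.

Lemma ev_is_linear f x : linear (fun p => ev f p x).
Proof.
move=> a p q; pose n := maxn (size (a *: p + q)) (maxn (size p) (size q)).
rewrite !(@ev_widen f _ n) ?leq_max ?leqnn ?orbT //.
rewrite scaler_sumr -big_split; apply: eq_bigr => i _ /=.
by rewrite coefD coefZ scalerDl scalerA.
Qed.

Lemma evXn f n x : ev f 'X^n x = cpow f n x.
Proof.
rewrite /ev size_polyXn big_ord_recr /= coefXn eqxx scale1r big1 ?add0r // => i _.
by rewrite coefXn (ltn_eqF (ltn_ord i)) scale0r.
Qed.

Lemma evM f p q x : linear f -> ev f (p * q) x = conv (ev f p) (ev f q) x.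
Proof.
move=> lf; have mon i j : ev f ('X^i * 'X^j) x = conv (ev f 'X^i) (ev f 'X^j) x.
  rewrite -exprD evXn cpowD //.
  by apply: eq_tlift => y z; rewrite !evXn.
rewrite -[p in LHS]coefK -[q in LHS]coefK !poly_def mulr_suml (lin_sum (ev_is_linear f x)).
rewrite conv_suml; apply: eq_bigr => i _; rewrite mulr_sumr (lin_sum (ev_is_linear f x)).
rewrite conv_sumr; apply: eq_bigr => j _.
rewrite -scalerAl -scalerAr !(linZ (ev_is_linear f x)) mon convZl convZr.
by congr (_ *: (_ *: _)); apply: eq_tlift => y z; rewrite !evXn.
Qed.

Lemma ev_exp f p n x : linear f -> ev f (p ^+ n) x = cpow (ev f p) n x.
Proof.
move=> lf; elim: n x => [|n IH] x; first by rewrite expr0 -(expr0 'X) evXn.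
by rewrite exprS evM //; apply: eq_tlift => y z; rewrite IH.
Qed.

Lemma ev_comp f p q x : linear f -> ev (ev f q) p x = ev f (p \Po q) x.
Proof.
move=> lf; rewrite comp_polyE (lin_sum (ev_is_linear f x)).
by apply: eq_bigr => i _; rewrite (linZ (ev_is_linear f x)) ev_exp.
Qed.

End Convolution.

Lemma cunit_pre (k : fieldType) (C D : ccdgc k) (A : algType k) (h : chom C D) x :
  cunit A (h x) = cunit A x.
Proof. by rewrite /cunit chom_eps. Qed.

(** Precomposition with a coalgebra morphism is a morphism of convolution algebras. This gives both
    the naturality of the two series and their restriction to t = 0. *)
Lemma conv_pre (k : fieldType) (C D : ccdgc k) (A : algType k) (h : chom C D)
    (f g : D -> A) x :
  linear f -> linear g -> conv f g (h x) = conv (f \o h) (g \o h) x.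
Proof.
move=> lf lg; rewrite /conv chom_del tlift_tmap //; try exact: linearP.
exact: conv_bilin.
Qed.

Lemma cpow_pre (k : fieldType) (C D : ccdgc k) (A : algType k) (h : chom C D)
    (f : D -> A) n x : linear f -> cpow f n (h x) = cpow (f \o h) n x.
Proof.
move=> lf; elim: n x => [|n IH] x /=; first exact: cunit_pre.
rewrite conv_pre //; last exact: cpow_linear.
by apply: eq_tlift => y z; rewrite /= IH.
Qed.

(** * Coproducts in the completed tensor square *)

Section CompletionCalculus.
Variables (k : fieldType) (V : lmodType k) (F : filt V).
Implicit Types (X : cpl F) (v : V).

(** [cpl_mk] returns 0 on incoherent sequences, so coherence has to be checked; here it follows from
    the closeness to [v]. *)
Lemma cpl_mk_eta (s : nat -> V) v : (forall n, F n (s n - v)) -> cpl_mk F s = cpl_eta F v.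
Proof.
move=> h; symmetry; apply: cpl_mkP => n.
  rewrite -(subrKA v); apply: filD; first exact: fil_dec.
  exact/filC/h.
by rewrite -(subrKA v); apply: filD; [exact: cpl_at_eta|exact/filC/h].
Qed.

Lemma cpl_eta_linear : linear (cpl_eta F).
Proof.
move=> a u v; symmetry; apply: cpl_mk_eta => n; have Fe := cpl_at_eta F.
rewrite opprD addrACA; apply: filD; last exact: Fe.
rewrite -(subrKA (a *: cpl_at (cpl_eta F u) n)); apply: filD.
  exact: cpl_at_scale.
by rewrite -scalerBr; apply: filZ; exact: Fe.
Qed.

(** The kernel of the projection of the completion to V / F^n. Equalities of coproducts are proved
    modulo each of these and then follow by separatedness. *)
Definition cfil (n : nat) : set (cpl F) := [set X | F n (cpl_at X n)].

Lemma cfil_eta n v : cfil n (cpl_eta F v) <-> F n v.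
Proof.
have h := cpl_at_eta F v n; split=> h'.
  by rewrite -(subrK (cpl_at (cpl_eta F v) n) v); apply: filD => //; exact: filC.
by rewrite /cfil /= -(subrK v (cpl_at _ _)); apply: filD.
Qed.

Lemma cfil_subspace n : subspace (cfil n).
Proof.
split=> [|a X Y hX hY]; first exact/cfil_eta/fil0.
rewrite /cfil /= -[cpl_at _ _](subrK (cpl_at (cpl_scale a X) n + cpl_at Y n)).
apply: filD; first exact: cpl_at_add.
apply: filD => //; rewrite -[cpl_at _ _](subrK (a *: cpl_at X n)).
by apply: filD; [exact: cpl_at_scale|exact: filZ].
Qed.

Lemma cfil_dec n X : cfil n.+1 X -> cfil n X.
Proof.
rewrite /cfil /= => h; rewrite -[cpl_at X n](subKr (cpl_at X n.+1)).
by apply: filB; [exact: fil_dec|exact: cpl_at_coherent].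
Qed.

Lemma cfil_le m n X : (m <= n)%N -> cfil n X -> cfil m X.
Proof. by move/subnK <-; elim: (n - m)%N => // d IH /cfil_dec. Qed.

Lemma cfil_sep X : (forall n, cfil n X) -> X = 0.
Proof.
move=> h; apply: cpl_ext => n; apply: filB; first exact: h.
exact/cfil_eta/fil0.
Qed.

Lemma cfil_eq X Y : (forall n, cfil n (X - Y)) -> X = Y.
Proof. by move/cfil_sep/eqP; rewrite subr_eq0 => /eqP. Qed.

End CompletionCalculus.

Lemma cpl_map_eta (k : fieldType) (V W : lmodType k) (F : filt V) (G : filt W)
    (f : V -> W) v : linear f -> (forall n v, F n v -> G n (f v)) ->
  cpl_map G f (cpl_eta F v) = cpl_eta G (f v).
Proof.
move=> lf Ff; apply: cpl_mk_eta => n; rewrite -(linB lf); apply: Ff; exact: cpl_at_eta.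
Qed.

Section HopfTensors.
Variables (k : fieldType) (H : chopf k).
Local Notation X := (hdg H).
Local Notation F := (hfil H).
Local Notation F2 := (tens_filt F F).

Lemma hfil_ksgn n m (x : H) : F n x -> F n (ksgn X m x).
Proof.
move=> Fx; have [r [ur hr]] := gpr_cover X x x.
rewrite (ksgn_cover m ur) => [|i /hr[]//].
by apply: fil_sum => i _; apply: filZ; exact: hfil_gr.
Qed.

(** The outer factors come first, so that [koszul] can be applied to the remaining function of the
    two factors that change places. *)
Definition mulmid (a d b c : H) : tens H H := tpure (a * c) (b * d).

Lemma mulmid_bilin a d : bilin (mulmid a d).
Proof.
have [p1 p2] := tpure_bilin H H; have [m1 m2] := bilin_mul H.
by split=> [c u b b'|b u c c']; rewrite /mulmid ?m1 ?m2 ?p1 ?p2.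
Qed.

Lemma mulmid_linl d b c : linear (fun a => mulmid a d b c).
Proof.
have [p1 p2] := tpure_bilin H H; have [m1 m2] := bilin_mul H.
by move=> u a a'; rewrite /mulmid m1 p1.
Qed.

Lemma mulmid_linr a b c : linear (fun d => mulmid a d b c).
Proof.
have [p1 p2] := tpure_bilin H H; have [m1 m2] := bilin_mul H.
by move=> u a' d; rewrite /mulmid m2 p2.
Qed.

Lemma mulmid_kbilin a b : bilin (fun c d => koszul X X (mulmid a d) b c).
Proof.
split=> [d|c]; first exact: (koszul_bilin _ _ (mulmid_bilin a d)).2.
apply: (@koszul_param _ _ _ _ _ _ _ (mulmid a)) => *; first exact: mulmid_bilin.
exact: mulmid_linr.
Qed.

Lemma mulmid_tbilin t : bilin (fun a b => tlift (fun c d => koszul X X (mulmid a d) b c) t).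
Proof.
split=> [b|a]; apply: tlift_linearl => c d.
  apply: (@koszul_param _ _ _ _ _ _ _ (fun a => mulmid a d)) => *.
    exact: mulmid_bilin.
  exact: mulmid_linl.
exact: (koszul_bilin _ _ (mulmid_bilin a d)).1.
Qed.

Lemma tmul_bilin : bilin (tmul X).
Proof.
split=> [t|s]; first exact/tliftP/mulmid_tbilin.
by apply: tlift_linearl => a b; exact/tliftP/mulmid_kbilin.
Qed.

Lemma tmul_pure a b c d : tmul X (tpure a b) (tpure c d) = koszul X X (mulmid a d) b c.
Proof.
rewrite /tmul tlift_pure; last exact: mulmid_tbilin.
by rewrite tlift_pure //; exact: mulmid_kbilin.
Qed.

Lemma tmul_fil m n s t : F2 m s -> F2 n t -> F2 (m + n)%N (tmul X s t).
Proof.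
have [b1 b2] := tmul_bilin; move=> hs ht.
apply: (lspan_map (b1 t) (fil_sub F2 _) _ hs) => _ [i [j [a [b [ij Fa Fb ->]]]]].
apply: (lspan_map (b2 _) (fil_sub F2 _) _ ht) => _ [p [q [c [d [pq Fc Fd ->]]]]].
rewrite tmul_pure -ij -pq addnACA; apply: koszul_fil; first exact: mulmid_bilin.
move=> l; split; apply: tfil_pure; apply: hfil_mul => //; first [exact: hfil_gr|exact: hfil_ksgn].
Qed.

Lemma tens_fil0 (s : tens H H) : F2 0%N s.
Proof.
rewrite [s]tens_sum; apply: fil_sum => p _; rewrite -[0%N]/(0 + 0)%N.
by apply: tfil_pure; exact: hfil0.
Qed.

Lemma tmul_fill n s t : F2 n s -> F2 n (tmul X s t).
Proof. by move=> hs; rewrite -[n]addn0; apply: tmul_fil => //; exact: tens_fil0. Qed.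

Lemma tmul_filr n s t : F2 n t -> F2 n (tmul X s t).
Proof. by move=> ht; rewrite -[n]add0n; apply: tmul_fil => //; exact: tens_fil0. Qed.

(** Grouplike and tangent maps have their coproducts in the algebraic tensor square; by this lemma
    such coproducts can be multiplied there, without passing to the completion. *)
Lemma hdelM_eta (x y : H) s t : hdel H x = cpl_eta F2 s -> hdel H y = cpl_eta F2 t ->
  hdel H (x * y) = cpl_eta F2 (tmul X s t).
Proof.
have [b1 b2] := tmul_bilin; move=> xs yt; rewrite hdelM xs yt; apply: cpl_mk_eta => n.
rewrite -(subrKA (tmul X s (cpl_at (cpl_eta F2 t) n))) -(linB (b1 _)) -(linB (b2 _)).
by apply: filD; [apply: tmul_fill|apply: tmul_filr]; exact: cpl_at_eta.
Qed.

Lemma tdif_fil n t : F2 n t -> F2 n (tdif X X t).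
Proof.
move=> ht; apply: (lspan_map (tdif_linear X X) (fil_sub F2 n) _ ht).
move=> _ [i [j [v [w [<- Fv Fw ->]]]]]; rewrite tdif_pure.
by apply: filD; apply: tfil_pure => //; first [exact: hfil_dif|exact: hfil_ksgn].
Qed.

Lemma hdel_dif_eta x t : hdel H x = cpl_eta F2 t ->
  hdel H (gdif X x) = cpl_eta F2 (tdif X X t).
Proof. by move=> e; rewrite hdel_dif e cpl_map_eta //; [exact: tdif_linear|exact: tdif_fil]. Qed.

Lemma hdel_cfil n x : F n x -> cfil n (hdel H x).
Proof. exact: hdel_fil. Qed.

End HopfTensors.

(** * The interchange law for convolution and tensor products *)

Section Interchange.
Variables (k : fieldType) (C : ccdgc k) (H : chopf k).
Local Notation X := (hdg H).
Local Notation F := (hfil H).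
Local Notation F2 := (tens_filt F F).

(* Coassociativity brings the two middle factors of the fourfold coproduct
   together; cocommutativity then absorbs the Koszul sign of their exchange. *)
Lemma tmul_interchange (f g f' g' : {linear C -> H}) x :
  degmap C X 0 g -> degmap C X 0 f' ->
  tlift (fun y z => tmul X (tmap f g (cdel C y)) (tmap f' g' (cdel C z))) (cdel C x) =
  tmap (conv f f') (conv g g') (cdel C x).
Proof.
move=> dg df'; have [p1 p2] := tpure_bilin H H; have [m1 m2] := bilin_mul H.
have lfun := @linearP _ _ _ _.
pose P a c b d : tens H H := tpure (f a * f' c) (g b * g' d).
have Pa c b d : linear (fun a => P a c b d) by move=> r u v; rewrite /P lfun m1 p1.
have Pc a b d : linear (fun c => P a c b d) by move=> r u v; rewrite /P lfun m2 p1.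
have Pb a c d : linear (fun b => P a c b d) by move=> r u v; rewrite /P lfun m1 p2.
have Pd a c b : linear (fun d => P a c b d) by move=> r u v; rewrite /P lfun m2 p2.
have Pcb a d : bilin (fun b c => P a c b d) by split.
(* [P] has the middle factors already exchanged; [Q] adds the Koszul sign of the exchange. The sign
   can be computed in [C] because [g] and [f'] have degree 0. *)
pose Q a b c d := koszul C C (fun b c => P a c b d) b c.
have Qa b c d : linear (fun a => Q a b c d).
  by apply: (@koszul_param _ _ _ _ _ _ _ (fun a b c => P a c b d)).
have Qb a c d : linear (fun b => Q a b c d) by exact: (koszul_bilin _ _ (Pcb a d)).1.
have Qc a b d : linear (fun c => Q a b c d) by exact: (koszul_bilin _ _ (Pcb a d)).2.
have Qd a b c : linear (fun d => Q a b c d).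
  by apply: (@koszul_param _ _ _ _ _ _ _ (fun d b c => P a c b d)).
have E y z : tmul X (tmap f g (cdel C y)) (tmap f' g' (cdel C z)) =
    tlift (fun a b => tlift (fun c d => Q a b c d) (cdel C z)) (cdel C y).
  rewrite /tmul tlift_tmap //; try exact: linearP; last exact: mulmid_tbilin.
  apply: eq_tlift => a b.
  rewrite tlift_tmap //; try exact: linearP; last exact: mulmid_kbilin.
  by apply: eq_tlift => c d; rewrite (koszul_map _ _ (mulmid_bilin _ _) dg df').
transitivity (tlift (fun y z => tlift (fun a b =>
  tlift (fun c d => Q a b c d) (cdel C z)) (cdel C y)) (cdel C x)).
  by apply: eq_tlift => y z; exact: E.
rewrite (@cdel_coassoc _ _ _ (fun a b z => tlift (fun c d => Q a b c d) (cdel C z))); last first.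
  split=> u v; try by apply: tlift_linearl.
  by apply: cs_linear; split.
transitivity (tlift (fun a w => tlift (fun c z =>
  tlift (fun b d => P a c b d) (cdel C z)) (cdel C w)) (cdel C x)).
  apply: eq_tlift => a w.
  rewrite -(@cdel_coassoc _ _ _ (fun b c d => Q a b c d)); last by split.
  rewrite -(@cdel_coassoc _ _ _ (fun c b d => P a c b d)); last by split.
  (* The factors [b] and [c] are now the two halves of the coproduct of [u], and cocommutativity at
     [u] replaces [Q] by [P]. *)
  apply: eq_tlift => u d.
  by rewrite -(@cdel_cocomm _ _ _ (fun c b => P a c b d)) //; exact/bilin_swap.
rewrite -(@cdel_coassoc _ _ _ (fun a c z => tlift (fun b d => P a c b d) (cdel C z))); last first.
  split=> u v; try by apply: tlift_linearl.
  by apply: cs_linear; split.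
apply: eq_tlift => y z.
rewrite /conv (lin_tlift (p1 _)); apply: eq_tlift => a c.
by rewrite (lin_tlift (p2 _)).
Qed.

End Interchange.

(** * Truncated power series *)

Section SumRearrangement.
Variable V : zmodType.

Lemma sum_triangle (B : nat -> nat -> V) n :
  \sum_(d < n) \sum_(i < d.+1) B i (d - i)%N = \sum_(i < n) \sum_(j < n - i) B i j.
Proof.
elim: n => [|n IH]; first by rewrite !big_ord0.
rewrite big_ord_recr /= IH big_ord_recr [RHS]big_ord_recr /= subnn subSnn big_ord1 addrA.
congr (_ + _); rewrite -big_split; apply: eq_bigr => i _ /=.
by rewrite subSn ?(ltnW (ltn_ord i)) // big_ord_recr.
Qed.

Lemma sum_ord_rev (F : nat -> nat -> V) n :
  \sum_(i < n.+1) F i (n - i)%N = \sum_(i < n.+1) F (n - i)%N i.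
Proof.
rewrite (reindex_inj rev_ord_inj); apply: eq_bigr => i _ /=.
by rewrite subSS subKn // -ltnS.
Qed.

(** Both sides run over the triples of natural numbers with sum [n]. *)
Lemma sum_assoc (T : nat -> nat -> nat -> V) n :
  \sum_(i < n.+1) \sum_(j < i.+1) T j (i - j)%N (n - i)%N =
  \sum_(i < n.+1) \sum_(j < (n - i).+1) T i j (n - i - j)%N.
Proof.
have := sum_triangle (fun i j => T i j (n - (i + j))%N) n.+1.
under eq_bigr => i _.
  under eq_bigr => j _ do rewrite subnKC -1?ltnS //.
  over.
move=> ->; apply: eq_bigr => i _; rewrite subSn -1?ltnS //.
by apply: eq_bigr => j _; rewrite subnDA.
Qed.

Lemma sum_pairs (F : nat -> V) n :
  \sum_(i < n.*2) F i = \sum_(i < n) (F i.*2 + F i.*2.+1).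
Proof.
elim: n => [|n IH]; first by rewrite !big_ord0.
by rewrite doubleS !big_ord_recr /= IH addrA.
Qed.

End SumRearrangement.

(** Both sides collect the [K i j] with i + j = n + 1; the boundary terms missing on the left are
    killed by the two vanishing conditions. *)
Lemma sum_shift (k : fieldType) (V : lmodType k) (P Q : nat -> nat -> k)
    (K : nat -> nat -> V) n :
  (forall j, P 0%N j = 0) -> (forall i, Q i 0%N = 0) ->
  \sum_(i < n.+1) (P i.+1 (n - i)%N *: K i.+1 (n - i)%N + Q i (n - i).+1 *: K i (n - i).+1) =
  \sum_(i < n.+2) (P i (n.+1 - i)%N + Q i (n.+1 - i)%N) *: K i (n.+1 - i)%N.
Proof.
move=> P0 Q0; under [RHS]eq_bigr do rewrite scalerDl.
rewrite [LHS]big_split [RHS]big_split /=; congr (_ + _).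
  by rewrite [RHS]big_ord_recl P0 scale0r add0r.
rewrite [RHS]big_ord_recr /= subnn Q0 scale0r addr0; apply: eq_bigr => i _.
by rewrite subSn // -ltnS.
Qed.

(** The Leibniz rule for a product of two power series, read off at the coefficient of degree [n].
    It drives the binomial formula for tangent maps and the integration of homotopies. *)
Lemma sum_deriv (k : fieldType) (V : lmodType k) (B : nat -> nat -> V) n :
  \sum_(i < n.+1) (i.+1%:R *: B i.+1 (n - i)%N + (n - i).+1%:R *: B i (n - i).+1) =
  n.+1%:R *: \sum_(i < n.+2) B i (n.+1 - i)%N.
Proof.
rewrite (sum_shift (P := fun i _ => i%:R) (Q := fun _ j => j%:R)) // scaler_sumr.
by apply: eq_bigr => i _; rewrite -natrD subnKC // -ltnS.
Qed.

Section TruncatedSeries.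
Variable k : fieldType.
Hypothesis char_k : [pchar k] =i pred0.
Implicit Types (p q r : {poly k}) (c : nat -> k).

Definition ptrunc n c : {poly k} := \poly_(i < n) c i.

Definition pcong n p q : Prop := 'X^n %| p - q.

Lemma natS_neq0 n : n.+1%:R != 0 :> k.
Proof. by rewrite ((pcharf0P k).1 char_k). Qed.

Lemma fact_neq0 n : n`!%:R != 0 :> k.
Proof. by rewrite ((pcharf0P k).1 char_k) -lt0n fact_gt0. Qed.

Lemma pcongP n p q : pcong n p q <-> forall i, (i < n)%N -> p`_i = q`_i.
Proof.
split=> [/dvdpP[r e] i ilt|h].
  by apply/eqP; rewrite -subr_eq0 -coefB e coefMXn ilt.
rewrite /pcong -[p - q](poly_take_drop n) (_ : take_poly n _ = 0).
  by rewrite add0r dvdp_mull.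
apply/polyP => i; rewrite coef_take_poly coef0; case: ifP => // /h e.
by rewrite coefB e subrr.
Qed.

Lemma pcong_refl n p : pcong n p p.
Proof. exact/pcongP. Qed.

Lemma pcong_sym n p q : pcong n p q -> pcong n q p.
Proof. by move=> /pcongP h; apply/pcongP => i /h. Qed.

Lemma pcong_trans n p q r : pcong n p q -> pcong n q r -> pcong n p r.
Proof. by move=> /pcongP h /pcongP h'; apply/pcongP => i il; rewrite h // h'. Qed.

Lemma pcongM n p q p' q' : pcong n p q -> pcong n p' q' -> pcong n (p * p') (q * q').
Proof.
move=> h h'; rewrite /pcong -(subrKA (q * p')) -mulrBl -mulrBr.
by apply: dvdp_add; [exact: dvdp_mulr|exact: dvdp_mull].
Qed.

Lemma dvdXn_exp n p : p`_0 = 0 -> 'X^n %| p ^+ n.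
Proof.
move=> p0; rewrite dvdp_exp2r // -[_ %| _]/('X %| p).
by rewrite -['X]subr0 -polyC0 dvdp_XsubCl rootE horner_coef0 p0.
Qed.

Lemma coef0_comp p q : q`_0 = 0 -> (p \Po q)`_0 = p`_0.
Proof. by move=> q0; rewrite -[LHS]horner_coef0 horner_comp horner_coef0 q0 horner_coef0. Qed.

Lemma comp_poly1 p : 1 \Po p = 1.
Proof. by rewrite -polyC1 comp_polyC. Qed.

Lemma pcong_comp n p q r : r`_0 = 0 -> pcong n p q -> pcong n (p \Po r) (q \Po r).
Proof.
move=> r0 /dvdpP[s e]; rewrite /pcong -linearB /= e rmorphM /= comp_Xn_poly.
by apply: dvdp_mull; exact: dvdXn_exp.
Qed.

(** Integration gains one order of precision; dividing by i + 1 uses characteristic zero. *)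
Lemma pcong_deriv n p q : p`_0 = q`_0 -> pcong n p^`() q^`() -> pcong n.+1 p q.
Proof.
move=> e0 /pcongP h; apply/pcongP => -[//|i] /h; rewrite !coef_deriv.
by rewrite -[LHS]mulr_natr -[RHS]mulr_natr => e; exact: (mulIf (natS_neq0 i) e).
Qed.

Definition exp_coef i : k := i`!%:R^-1.
(** Removing the constant term from exp makes the series invertible under composition, with inverse
    ln (1 + X). *)
Definition expm1_coef i : k := if i is 0%N then 0 else exp_coef i.
Definition ln1p_coef i : k := if i is 0%N then 0 else - ((-1) ^+ i / i%:R).

Let En n := ptrunc n expm1_coef.
Let Ln n := ptrunc n ln1p_coef.

Lemma ptrunc_coef0 n c : c 0%N = 0 -> (ptrunc n c)`_0 = 0.
Proof. by move=> c0; rewrite coef_poly c0 if_same. Qed.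

Lemma deriv_expm1 n : pcong n (En n.+1)^`() (1 + En n.+1).
Proof.
apply/pcongP => i il; rewrite coef_deriv coefD coef1 !coef_poly !ltnS il (ltnW il) /=.
rewrite -[LHS]mulr_natr /exp_coef factS natrM invfM mulrAC mulVf ?natS_neq0 // mul1r.
by case: i il => [|i] _ /=; rewrite ?invr1 ?addr0 ?add0r.
Qed.

Lemma deriv_ln1p n : pcong n ((1 + 'X) * (Ln n.+1)^`()) 1.
Proof.
have e i : (i < n)%N -> (Ln n.+1)^`()`_i = (-1) ^+ i.
  move=> il; rewrite coef_deriv coef_poly ltnS il /= -[LHS]mulr_natr mulNr divfK ?natS_neq0 //.
  by rewrite exprS mulN1r opprK.
apply/pcongP => -[|i] il; rewrite mulrDl mul1r coefD coefXM coef1 ?e //=; first by rewrite addr0.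
  by rewrite exprS mulN1r addNr.
exact: ltnW.
Qed.

(** By E' = 1 + E and (1 + X) L' = 1, the derivative of L(E) is L'(E) (1 + E) = 1, up to the
    truncation order. *)
Lemma ln1p_expm1 n : pcong n (Ln n \Po En n) 'X.
Proof.
case: n => [|n]; first exact/pcongP.
have E0 : (En n.+1)`_0 = 0 by exact: ptrunc_coef0.
apply: pcong_deriv.
  by rewrite coefX coef0_comp ?ptrunc_coef0.
rewrite deriv_comp derivX.
apply: pcong_trans (pcongM (pcong_refl n _) (deriv_expm1 n)) _.
have := pcong_comp E0 (deriv_ln1p n).
by rewrite rmorphM /= (comp_poly1 (En n.+1)) comp_polyD comp_poly1 comp_polyX mulrC.
Qed.

(** Here the derivative of Q = E(L) involves Q itself. It satisfies (1 + X) Q' = 1 + Q with Q(0) =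
    0, and the coefficients of a solution are determined recursively. *)
Lemma expm1_ln1p n : pcong n (En n \Po Ln n) 'X.
Proof.
case: n => [|n]; first exact/pcongP.
have L0 : (Ln n.+1)`_0 = 0 by exact: ptrunc_coef0.
set Q := _ \Po _.
have Q0 : Q`_0 = 0.
  by rewrite coef0_comp ?ptrunc_coef0.
have /pcongP h : pcong n ((1 + 'X) * Q^`()) (1 + Q).
  rewrite deriv_comp mulrCA.
  apply: pcong_trans (pcongM (pcong_refl n _) (deriv_ln1p n)) _; rewrite mulr1.
  have := pcong_comp L0 (deriv_expm1 n).
  by rewrite comp_polyD comp_poly1.
(* The differential equation at degree [i]: (i + 1) Q_(i+1) = [i = 0] + Q_i - i Q_i. It forces Q_1 =
   1, then Q_2 = 0 because the two terms in Q_1 cancel, and all later coefficients vanish. *)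
have st i : (i < n)%N -> Q`_i.+1 *+ i.+1 = (i == 0%N)%:R + Q`_i - Q`_i *+ i.
  move=> /h; rewrite mulrDl mul1r !coefD coefXM coef1 !coef_deriv => <-.
  by case: i => [|i] /=; rewrite ?mulr0n ?subr0 ?addrK ?addr0.
apply/pcongP => i; rewrite coefX; case: i => [//|i]; elim: i => [|i IH] il.
  by have := st 0%N il; rewrite Q0 mulr1n mul0rn subr0 addr0.
have := st i.+1 il; rewrite IH ?(ltnW il) // add0r.
have -> : (i.+1 == 1)%:R - (i.+1 == 1)%:R *+ i.+1 = 0 :> k.
  by case: (i) => [|j] /=; rewrite ?mulr1n ?subrr // mul0rn subr0.
by rewrite -[LHS]mulr_natr => /eqP; rewrite mulf_eq0 (negbTE (natS_neq0 _)) orbF => /eqP.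
Qed.

(** The truncated form of exp(X)^m = exp(m X): the induction step is the binomial theorem for (m +
    1)^d divided by d!. *)
Lemma exp_pow n m : pcong n (ptrunc n exp_coef ^+ m) (ptrunc n (fun i => m%:R ^+ i * exp_coef i)).
Proof.
elim: m => [|m IH].
  apply/pcongP => i il; rewrite expr0 coef1 coef_poly il expr0n.
  by case: i il => [|i] _ /=; rewrite ?mul0r // mul1r /exp_coef invr1.
rewrite exprS; apply: pcong_trans (pcongM (pcong_refl n _) IH) _.
apply/pcongP => d dn; rewrite coefM coef_poly dn -natr1 exprDn mulr_suml.
apply: eq_bigr => i _; have id : (i <= d)%N by rewrite -ltnS.
rewrite !coef_poly (leq_ltn_trans id dn) (leq_ltn_trans (leq_subr _ _) dn).
rewrite expr1n mulr1 -[_ *+ 'C(_, _)]mulr_natr /exp_coef -(bin_fact id) !natrM.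
have nz : 'C(d, i)%:R != 0 :> k by rewrite ((pcharf0P k).1 char_k) -lt0n bin_gt0.
by rewrite !invfM -mulrA mulVKf // mulrCA.
Qed.

End TruncatedSeries.

(** * Exponential and logarithm of a single map *)

Section ConvolutionHopf.
Variables (k : fieldType) (C : ccdgc k) (H : chopf k).
Local Notation X := (hdg H).
Local Notation F := (hfil H).
Local Notation F2 := (tens_filt F F).
Implicit Types f g a : C -> H.

Lemma conv_deg f g : linear f -> linear g ->
  degmap C X 0 f -> degmap C X 0 g -> degmap C X 0 (conv f g).
Proof.
move=> lf lg df dg i x hx; rewrite addr0.
apply: (lspan_map (tliftP (conv_bilin lf lg)) (homog_subspace X i) _ (cdel_deg hx)).
move=> _ [p [q [v [w [<- hv hw ->]]]]]; rewrite tlift_pure; last exact: conv_bilin.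
by apply: hmul_deg; [have := df _ _ hv|have := dg _ _ hw]; rewrite addr0.
Qed.

Lemma cunit_deg : degmap C X 0 (cunit (C := C) H).
Proof.
move=> i x hx; rewrite addr0 /cunit.
have [->|i0] := eqVneq i 0; first exact/(subspaceZ _ (homog_subspace X 0))/h1_deg.
by rewrite -hx ceps_deg // scale0r; exact: (homog_subspace X i).1.
Qed.

Lemma cpow_deg a n : linear a -> degmap C X 0 a -> degmap C X 0 (cpow a n).
Proof.
move=> la da; elim: n => [|n IH]; first exact: cunit_deg.
by apply: conv_deg => //; exact: cpow_linear.
Qed.

Definition chain f := forall x, f (gdif C x) = gdif X (f x).

Lemma gdif1 : gdif X 1 = 0.
Proof.
(* The Leibniz rule for the product 1 * 1 reads d1 = d1 + d1. *)
have := hmul_dif (c := H) 1 1; rewrite (ksgn_homog 1 (h1_deg H)) muln0 expr0 scale1r.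
by rewrite !(mul1r, mulr1) => /(canLR (addrK _)); rewrite subrr => <-.
Qed.

Lemma cunit_chain : chain (cunit (C := C) H).
Proof. by move=> x; rewrite /cunit ceps_dif scale0r linearZ /= gdif1 scaler0. Qed.

Lemma conv_chain f g : linear f -> linear g -> degmap C X 0 f ->
  chain f -> chain g -> chain (conv f g).
Proof.
move=> lf lg df cf cg x; rewrite /conv cdel_dif tlift_tdif; last exact: conv_bilin.
rewrite linear_sum_tlift -tlift_add2; apply: eq_tlift => y z.
rewrite hmul_dif cf cg; congr (_ + _ * _).
by rewrite (@ksgn_degmap _ _ _ C X 0%N) // muln0 scale1r.
Qed.

Lemma cpow_chain a n : linear a -> degmap C X 0 a -> chain a -> chain (cpow a n).
Proof.
move=> la da ca; elim: n => [|n IH]; first exact: cunit_chain.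
by apply: conv_chain => //; exact: cpow_linear.
Qed.

Lemma conv_fil m n f g x : (forall x, F m (f x)) -> (forall x, F n (g x)) ->
  F (m + n)%N (conv f g x).
Proof. by move=> Ff Fg; apply: tlift_fil => y z; apply: hfil_mul. Qed.

Lemma cpow_fil a n x : (forall x, F 1%N (a x)) -> F n (cpow a n x).
Proof.
move=> Fa; elim: n x => [|n IH] x; first exact: hfil0.
exact: (conv_fil (m := 1)).
Qed.

Lemma conv_congr n f g f' g' x :
  (forall x, F n (f x - f' x)) -> (forall x, F n (g x - g' x)) ->
  F n (conv f g x - conv f' g' x).
Proof.
move=> hf hg; rewrite convBB; apply: filD.
  by rewrite -[n]addn0; apply: conv_fil => // y; exact: hfil0.
by rewrite -[n]add0n; apply: conv_fil => // y; exact: hfil0.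
Qed.

Lemma cpow_congr n f g i x :
  (forall x, F n (f x - g x)) -> F n (cpow f i x - cpow g i x).
Proof.
move=> h; elim: i x => [|i IH] x /=; first by rewrite subrr; exact: fil0.
exact: conv_congr.
Qed.

Lemma ev_congr n f g p x :
  (forall x, F n (f x - g x)) -> F n (ev f p x - ev g p x).
Proof.
move=> h; rewrite -sumrB; apply: fil_sum => i _; rewrite -scalerBr.
by apply: filZ; exact: cpow_congr.
Qed.

(** The bridge from polynomials to maps: the difference is a multiple of 'X^n, and [a^n] takes
    values in F^n. *)
Lemma ev_pcong n a p q x : linear a -> (forall x, F 1%N (a x)) ->
  pcong n p q -> F n (ev a p x - ev a q x).
Proof.
move=> la Fa /dvdpP[r e]; rewrite -(linB (ev_is_linear a x)) e mulrC evM //.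
rewrite -[n in F n]addn0; apply: conv_fil => y; last exact: hfil0.
by rewrite evXn; exact: cpow_fil.
Qed.

Lemma ev_ptrunc a n c x : ev a (ptrunc n c) x = \sum_(i < n) c i *: cpow a i x.
Proof.
rewrite (@ev_widen _ _ _ a (ptrunc n c) n) ?size_poly //.
by apply: eq_bigr => i _; rewrite coef_poly ltn_ord.
Qed.

(* [g = sum_i c_i a^i] for [a] with values in [F^1]: the powers [a^i], [i >= n],
   then have values in [F^n]. *)
Definition is_ps (c : nat -> k) a g := forall n x, F n (g x - ev a (ptrunc n c) x).

Section PowerSeries.
Variables (c : nat -> k) (a : C -> H).
Hypotheses (la : linear a) (da : degmap C X 0 a) (Fa : forall x, F 1%N (a x)).

Lemma ps_succ n x : F n (ev a (ptrunc n.+1 c) x - ev a (ptrunc n c) x).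
Proof.
rewrite !ev_ptrunc big_ord_recr /= addrAC subrr add0r.
by apply: filZ; exact: cpow_fil.
Qed.

(** The completeness axiom concerns sequences of one fixed degree, so limits are first taken at
    homogeneous arguments. *)
Lemma ps_homog i x : homog C i x -> exists2 y, homog X i y &
  forall n, F n (y - ev a (ptrunc n c) x).
Proof.
move=> hx; apply: hfil_cpl => n; last exact: ps_succ.
rewrite ev_ptrunc; apply: subspace_sum => [|j _]; first exact: homog_subspace.
apply: subspaceZ; first exact: homog_subspace.
by have := cpow_deg j la da hx; rewrite addr0.
Qed.

Lemma ps_value x : exists y, forall n, F n (y - ev a (ptrunc n c) x).
Proof.
move: x; apply: (homog_ind (X := C)) => [|i x /ps_homog[y _ hy]]; last by exists y.
split=> [|u x x' [y hy] [y' hy']]; have le n := ev_linear (ptrunc n c) la.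
  by exists 0 => n; rewrite (lin0 (le n)) subrr; exact: fil0.
exists (u *: y + y') => n; rewrite le opprD addrACA -scalerBr.
by apply: filD => //; exact: filZ.
Qed.

Lemma hfil_eq (x y : H) : (forall n, F n (x - y)) -> x = y.
Proof. by move/(@hfil_sep _ H)/eqP; rewrite subr_eq0 => /eqP. Qed.

Lemma is_ps_uniq g g' : is_ps c a g -> is_ps c a g' -> g =1 g'.
Proof.
move=> hg hg' x; apply: hfil_eq => n; rewrite -(subrKA (ev a (ptrunc n c) x)).
by apply: filD => //; exact: filC.
Qed.

Lemma is_ps_linear g : is_ps c a g -> linear g.
Proof.
move=> hg u x x'; apply: hfil_eq => n; have le := ev_linear (ptrunc n c) la.
rewrite -(subrKA (ev a (ptrunc n c) (u *: x + x'))); apply: filD => //.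
rewrite le opprD addrACA -scalerBr; apply: filD; last exact/filC.
exact/filZ/filC.
Qed.

(** The values are chosen independently of each other; linearity is then forced by the uniqueness of
    limits. *)
Lemma ps_exists : exists g : {linear C -> H}, is_ps c a g.
Proof.
have [g hg] := choice ps_value.
have gp : is_ps c a g by move=> n x.
pose G : {linear C -> H} := HB.pack g (GRing.isLinear.Build _ _ _ _ g (is_ps_linear gp)).
by exists G.
Qed.

Lemma is_ps_deg g : is_ps c a g -> degmap C X 0 g.
Proof.
move=> hg i x hx; have [y hy hn] := ps_homog hx; rewrite addr0.
suff -> : g x = y by [].
apply: hfil_eq => n; rewrite -(subrKA (ev a (ptrunc n c) x)).
by apply: filD => //; exact: filC.
Qed.

Lemma is_ps_chain g : chain a -> is_ps c a g -> chain g.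
Proof.
move=> ca hg x; apply: hfil_eq => n.
rewrite -(subrKA (ev a (ptrunc n c) (gdif C x))); apply: filD => //.
rewrite (_ : ev _ _ _ = gdif X (ev a (ptrunc n c) x)).
  by rewrite -linearB; apply: hfil_dif; exact: filC.
rewrite /ev linear_sum; apply: eq_bigr => i _.
by rewrite linearZ /= cpow_chain.
Qed.

Lemma is_ps_series g x : is_ps c a g -> series_sum F (fun i => c i *: cpow a i x) (g x).
Proof.
move=> hg n; exists n => m nm; rewrite -ev_ptrunc.
by apply: fil_le nm _; exact: hg.
Qed.

Lemma is_ps_fil1 g x : c 0%N = 0 -> is_ps c a g -> F 1%N (g x).
Proof.
move=> c0 /(_ 1%N x); rewrite ev_ptrunc big_ord1 c0 scale0r subr0.
exact.
Qed.

(** Modulo F^1, the kernel of the counit, only the constant term of the series is left. *)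
Lemma is_ps_eps g x : is_ps c a g -> heps H (g x) = c 0%N * ceps C x.
Proof.
have lh := linearP (heps H); move=> /(_ 1%N x)/hfil1.
rewrite ev_ptrunc big_ord1 (linB lh) /cunit !(linZ lh) heps1 => /eqP.
by rewrite subr_eq0 => /eqP ->; rewrite scalerA; exact: mulr1.
Qed.

End PowerSeries.

(** Modulo F^n the inner series may be replaced by its truncation, after which [ev_comp] turns the
    substitution into a composition of polynomials. *)
Lemma is_ps_comp (c d r : nat -> k) a b g :
  linear a -> (forall x, F 1%N (a x)) -> linear b -> (forall x, F 1%N (b x)) ->
  is_ps d a b -> is_ps c b g ->
  (forall n, pcong n (ptrunc n c \Po ptrunc n d) (ptrunc n r)) -> is_ps r a g.
Proof.
move=> la Fa lb Fb hb hg h n x.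
rewrite -(subrKA (ev b (ptrunc n c) x)); apply: filD => //.
rewrite -(subrKA (ev (ev a (ptrunc n d)) (ptrunc n c) x)); apply: filD.
  by apply: ev_congr => y; exact: hb.
by rewrite ev_comp //; exact: ev_pcong.
Qed.

Lemma is_ps_X a g : linear a -> (forall x, F 1%N (a x)) ->
  is_ps (fun i => (i == 1%N)%:R) a g <-> g =1 a.
Proof.
move=> la Fa; have h : is_ps (fun i => (i == 1%N)%:R) a a.
  move=> n x; rewrite -[in a x](conv1r x la) -[conv _ _ _]/(cpow a 1 x) -evXn.
  apply: ev_pcong => //; apply/pcongP => i il.
  by rewrite coefXn coef_poly il.
split=> [hg|e n x]; first exact: is_ps_uniq hg h.
by rewrite e; exact: h.
Qed.

End ConvolutionHopf.

Lemma is_ps_pre (k : fieldType) (C D : ccdgc k) (H : chopf k) (h : chom C D) c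
    (a g : D -> H) : linear a -> is_ps c a g -> is_ps c (a \o h) (g \o h).
Proof.
move=> la hg n x; have := hg n (h x); rewrite !ev_ptrunc.
by under eq_bigr do rewrite cpow_pre //.
Qed.

(** * Grouplike and tangent maps *)

Section Coproducts.
Variables (k : fieldType) (C : ccdgc k) (H : chopf k).
Hypothesis char_k : [pchar k] =i pred0.
Local Notation X := (hdg H).
Local Notation F := (hfil H).
Local Notation F2 := (tens_filt F F).
Local Notation e := (cunit (C := C) H).
Implicit Types f g a : C -> H.

(** The pairing (f | g) of the overview. *)
Definition ctmap f g x := tmap f g (cdel C x).

Lemma ctmap_linear f g : linear f -> linear g -> linear (ctmap f g).
Proof. by move=> lf lg; apply: (linear_comp (f := tmap f g)); [exact: tmap_linear|exact: linearP]. Qed.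

Lemma ctmap_suml I (r : seq I) (P : pred I) (f : I -> C -> H) g x :
  ctmap (fun y => \sum_(i <- r | P i) f i y) g x = \sum_(i <- r | P i) ctmap (f i) g x.
Proof.
rewrite /ctmap /tmap -tlift_sum; apply: eq_tlift => y z.
by rewrite (bilin_suml (tpure_bilin _ _)).
Qed.

Lemma ctmap_sumr I (r : seq I) (P : pred I) f (g : I -> C -> H) x :
  ctmap f (fun y => \sum_(i <- r | P i) g i y) x = \sum_(i <- r | P i) ctmap f (g i) x.
Proof.
rewrite /ctmap /tmap -tlift_sum; apply: eq_tlift => y z.
by rewrite (bilin_sumr (tpure_bilin _ _)).
Qed.

Lemma ctmapZ b c f g x :
  ctmap (fun y => b *: f y) (fun y => c *: g y) x = (b * c) *: ctmap f g x.
Proof.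
rewrite /ctmap /tmap -tlift_scale2; apply: eq_tlift => y z.
by rewrite (bilinZl (tpure_bilin _ _)) (bilinZr (tpure_bilin _ _)) scalerA.
Qed.

Lemma ctmap_congr n f g f' g' x :
  (forall x, F n (f x - f' x)) -> (forall x, F n (g x - g' x)) ->
  F2 n (ctmap f g x - ctmap f' g' x).
Proof.
move=> hf hg; have b := tpure_bilin H H.
rewrite -[X in F2 _ X]/(tmap f g (cdel C x) - tmap f' g' (cdel C x)).
rewrite (_ : _ - _ = tmap (f \- f') g (cdel C x) + tmap f' (g \- g') (cdel C x)).
  apply: filD; first by rewrite -[n]addn0; apply: tmap_fil => // y; exact: hfil0.
  by rewrite -[n]add0n; apply: tmap_fil => // y; exact: hfil0.
apply/eqP; rewrite subr_eq /tmap -!tlift_add2; apply/eqP/eq_tlift => y z /=.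
by rewrite -addrA -(bilinDr b) subrK -(bilinDl b) subrK.
Qed.

(** Convolution of maps into the tensor square. It is separate from [conv] because [tens H H]
    carries [tmul] as a bare operation, without an algebra structure. *)
Definition cmul (S T : C -> tens H H) x : tens H H :=
  tlift (fun y z => tmul X (S y) (T z)) (cdel C x).

Lemma cmul_addl S S' T x : cmul (fun y => S y + S' y) T x = cmul S T x + cmul S' T x.
Proof. by rewrite /cmul -tlift_add2; apply: eq_tlift => y z; rewrite (bilinDl (tmul_bilin H)). Qed.

Lemma cmul_sumr I (r : seq I) (P : pred I) S (T : I -> C -> tens H H) x :
  cmul S (fun y => \sum_(i <- r | P i) T i y) x = \sum_(i <- r | P i) cmul S (T i) x.
Proof. by rewrite /cmul -tlift_sum; apply: eq_tlift => y z; rewrite (bilin_sumr (tmul_bilin H)). Qed.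

Lemma cmulZr b S T x : cmul S (fun y => b *: T y) x = b *: cmul S T x.
Proof. by rewrite /cmul -tlift_scale2; apply: eq_tlift => y z; rewrite (bilinZr (tmul_bilin H)). Qed.

Lemma cmul_ctmap f g f' g' x : linear f -> linear g -> linear f' -> linear g' ->
  degmap C X 0 g -> degmap C X 0 f' ->
  cmul (ctmap f g) (ctmap f' g') x = ctmap (conv f f') (conv g g') x.
Proof.
move=> lf lg lf' lg'.
pose f1 : {linear C -> H} := HB.pack f (GRing.isLinear.Build _ _ _ _ f lf).
pose g1 : {linear C -> H} := HB.pack g (GRing.isLinear.Build _ _ _ _ g lg).
pose f2 : {linear C -> H} := HB.pack f' (GRing.isLinear.Build _ _ _ _ f' lf').
pose g2 : {linear C -> H} := HB.pack g' (GRing.isLinear.Build _ _ _ _ g' lg').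
exact: (@tmul_interchange _ _ _ f1 g1 f2 g2).
Qed.

(** Composition with the coproduct of [H] respects convolution because that coproduct is
    multiplicative. *)
Lemma hdel_conv f g S T x :
  (forall y, hdel H (f y) = cpl_eta F2 (S y)) ->
  (forall y, hdel H (g y) = cpl_eta F2 (T y)) ->
  hdel H (conv f g x) = cpl_eta F2 (cmul S T x).
Proof.
move=> hS hT; rewrite /conv linear_sum_tlift (lin_tlift (cpl_eta_linear F2)).
by apply: eq_tlift => y z; exact: hdelM_eta.
Qed.

Lemma ctmap_unit x : ctmap e e x = (ceps C x : k) *: tpure (1 : H) (1 : H).
Proof.
have b := tpure_bilin H H.
have l : linear (fun z => (ceps C z : k) *: tpure (1 : H) (1 : H) : tens H H).
  by move=> u y z; rewrite linearP scalerDl -scalerA.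
rewrite -[in RHS](cdel_epsl x) (lin_tlift l); apply: eq_tlift => y z.
by rewrite /cunit (bilinZl b) (bilinZr b) (linZ l) scalerA.
Qed.

Definition grouplike g := forall x, hdel H (g x) = cpl_eta F2 (ctmap g g x).

Definition tangent a := forall x, hdel H (a x) = cpl_eta F2 (ctmap e a x + ctmap a e x).

Lemma grouplike_cunit : grouplike e.
Proof.
move=> x; rewrite ctmap_unit (linZ (cpl_eta_linear F2)) /cunit linearZ /=.
by congr (_ *: _); exact: hdel1.
Qed.

Lemma grouplike_cpow g n : linear g -> degmap C X 0 g -> grouplike g ->
  grouplike (cpow g n).
Proof.
move=> lg dg gg; elim: n => [|n IH]; first exact: grouplike_cunit.
move=> x; rewrite (hdel_conv _ gg IH) cmul_ctmap //; try exact: cpow_linear.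
exact: cpow_deg.
Qed.

Section Powers.
Variable a : C -> H.
Hypotheses (la : linear a) (da : degmap C X 0 a).

(** A product of divided powers, (a^i / i! | a^j / j!); with it the binomial formula has no binomial
    coefficients. *)
Definition dpow i j x : tens H H :=
  (exp_coef k i * exp_coef k j) *: ctmap (cpow a i) (cpow a j) x.

Lemma dpow_fil i j x : (forall y, F 1%N (a y)) -> F2 (i + j)%N (dpow i j x).
Proof. by move=> Fa; apply: filZ; apply: tmap_fil => y; exact: cpow_fil. Qed.

Lemma hdel_cpow_tangent n x : tangent a -> hdel H (cpow a n x) =
  cpl_eta F2 (n`!%:R *: \sum_(i < n.+1) dpow i (n - i)%N x).
Proof.
move=> ta; have lp i := cpow_linear i la; have dp i := cpow_deg i la da.
have le : linear e := @cunit_linear _ _ _; have de := @cunit_deg _ C H.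
elim: n x => [|n IH] x.
  rewrite big_ord1 scale1r /dpow /exp_coef invr1 mulr1 scale1r.
  exact: grouplike_cunit.
rewrite (hdel_conv _ ta IH); congr (cpl_eta _ _).
rewrite cmulZr cmul_sumr factS mulnC natrM -scalerA.
(* Multiplication by (a | e) sends [dpow i j] to i + 1 times [dpow i.+1 j], and multiplication by (e
   | a) sends it to j + 1 times [dpow i j.+1], so the Leibniz form of the sum appears. *)
rewrite -(sum_deriv (fun i j => dpow i j x)); congr (_ *: _).
apply: eq_bigr => i _; rewrite /dpow cmulZr cmul_addl !cmul_ctmap //.
rewrite scalerDr addrC !scalerA; congr (_ *: _ + _ *: _).
- by rewrite /exp_coef factS natrM invfM !mulrA (mulfV (natS_neq0 char_k i)) mul1r.
- apply: eq_tlift => y z; congr tpure; last exact: conv1l.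
- rewrite /exp_coef factS natrM invfM mulrCA; congr (_ * _).
  by rewrite mulVKf ?(natS_neq0 char_k (n - i)).
- by apply: eq_tlift => y z; congr tpure; exact: conv1l.
Qed.

(** Here [q] truncates exp(s a). The pairing (q | q) sums over a square of indices, the other sum
    over the triangle i + j < n; the terms in between lie in F^n. The scalar [s] is 1 for the
    exponential and a natural number [m] for the logarithm. *)
Lemma ctmap_trunc n s x : (forall y, F 1%N (a y)) ->
  let q := ev a (ptrunc n (fun i => s ^+ i * exp_coef k i)) in
  F2 n (ctmap q q x - \sum_(d < n) s ^+ d *: \sum_(i < d.+1) dpow i (d - i)%N x).
Proof.
move=> Fa q; pose B i j := s ^+ (i + j) *: dpow i j x.
have -> : ctmap q q x = \sum_(i < n) \sum_(j < n) B i j.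
  transitivity (ctmap (fun y => \sum_(i < n) (s ^+ i * exp_coef k i) *: cpow a i y)
    (fun y => \sum_(i < n) (s ^+ i * exp_coef k i) *: cpow a i y) x).
    by apply: eq_tlift => y z; rewrite /q !ev_ptrunc.
  rewrite ctmap_suml; apply: eq_bigr => i _; rewrite ctmap_sumr; apply: eq_bigr => j _.
  by rewrite ctmapZ /B /dpow scalerA exprD mulrACA.
have -> : \sum_(d < n) s ^+ d *: \sum_(i < d.+1) dpow i (d - i)%N x =
    \sum_(i < n) \sum_(j < n - i) B i j.
  rewrite -sum_triangle; apply: eq_bigr => d _; rewrite scaler_sumr.
  by apply: eq_bigr => i _; rewrite /B subnKC // -ltnS.
rewrite -sumrB; apply: fil_sum => i _.
rewrite -!(big_mkord xpredT) (big_cat_nat _ _ (n := n - i)) ?leq_subr // addrAC subrr add0r.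
rewrite big_nat; apply: fil_sum => j /andP[ij _]; apply: filZ; apply: (fil_le _ (dpow_fil _ Fa)).
by rewrite -leq_subLR.
Qed.

Lemma exp_grouplike g : (forall y, F 1%N (a y)) -> tangent a ->
  is_ps (exp_coef k) a g -> grouplike g.
Proof.
move=> Fa ta hg x; apply: cfil_eq => n; have sP := @cfil_subspace _ _ F2 n.
(* The factor [1 ^+ i] gives [q] the shape of [ctmap_trunc] at s = 1. *)
pose q := ev a (ptrunc n (fun i => 1 ^+ i * exp_coef k i)).
have hq y : F n (g y - q y).
  rewrite /q (_ : ptrunc _ _ = ptrunc n (exp_coef k)); first exact: hg.
  by apply/polyP => i; rewrite !coef_poly expr1n mul1r.
rewrite -(subrKA (hdel H (q x))) -linearB; apply: (subspaceD sP).
  exact: hdel_cfil.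
have -> : hdel H (q x) = cpl_eta F2
    (\sum_(d < n) 1 ^+ d *: \sum_(i < d.+1) dpow i (d - i)%N x).
  rewrite /q ev_ptrunc linear_sum (lin_sum (cpl_eta_linear F2)); apply: eq_bigr => d _.
  rewrite linearZ /= hdel_cpow_tangent // -(linZ (cpl_eta_linear F2)) scalerA.
  by rewrite -mulrA mulVf ?mulr1 // (fact_neq0 char_k).
rewrite -(linB (cpl_eta_linear F2)) -(subrKA (ctmap q q x)); apply/cfil_eta/filD.
  by apply: filC; exact: ctmap_trunc.
by apply: ctmap_congr => y; apply: filC.
Qed.

(* The values [g^m = exp (m a)], [m : nat], are grouplike. Modulo [F^n] both sides
   of this condition are polynomials in [m], and the condition that [a] is
   tangent equates their linear coefficients. *)
Lemma log_tangent g : (forall y, F 1%N (a y)) -> linear g -> degmap C X 0 g ->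
  grouplike g -> is_ps (exp_coef k) a g -> tangent a.
Proof.
(* The level is raised by two so that the index d = 1 of the linear coefficient lies below it even
   when [n0] is 0. *)
move=> Fa lg dg gg hg x; apply: cfil_eq => n0; apply: (@cfil_le _ _ _ n0 n0.+2); first by rewrite !leqW.
have le := cpl_eta_linear F2; move En : n0.+2 => n.
have n1 : (1 < n)%N by rewrite -En.
have sP := @cfil_subspace _ _ F2 n.
(* The coefficient of m^d in the difference of the two sides of the grouplike condition for exp(m
   a). *)
pose z (d : 'I_n) : ctens F F := exp_coef k d *: hdel H (cpow a d x) -
  cpl_eta F2 (\sum_(i < d.+1) dpow i (d - i)%N x).
have zP : forall d, cfil n (z d).
  apply: (subspace_coef char_k sP) => m.
  pose q := ev a (ptrunc n (fun i => m%:R ^+ i * exp_coef k i)).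
  have hq y : F n (q y - cpow g m y).
    rewrite -(subrKA (ev a (ptrunc n (exp_coef k) ^+ m) y)); apply: filD.
      by apply: ev_pcong => //; exact/pcong_sym/exp_pow.
    by rewrite ev_exp //; apply/filC/cpow_congr.
  have -> : \sum_(d < n) m%:R ^+ d *: z d = hdel H (q x) -
      cpl_eta F2 (\sum_(d < n) m%:R ^+ d *: \sum_(i < d.+1) dpow i (d - i)%N x).
    rewrite /q ev_ptrunc linear_sum (lin_sum le) -sumrB; apply: eq_bigr => d _.
    by rewrite linearZ /= (linZ le) -scalerA -scalerBr.
  rewrite -(subrKA (hdel H (cpow g m x))) -linearB; apply: (subspaceD sP).
    exact: hdel_cfil.
  rewrite (grouplike_cpow m lg dg gg) -(linB le) -(subrKA (ctmap q q x)).
  apply/cfil_eta/filD; last exact: ctmap_trunc.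
  by apply: ctmap_congr => y; apply: filC.
have c1 : conv a e = a by apply/funext => y; exact: conv1r.
(* At d = 1 the sum consists of [dpow 0 1] and [dpow 1 0], that is, (e | a) + (a | e). *)
have := zP (Ordinal n1); rewrite /z !big_ord_recl big_ord0 addr0 /dpow.
by rewrite /exp_coef !invr1 mulr1 !scale1r /= c1.
Qed.

End Powers.

(** The constant term of exp(a) is the convolution unit, which moves to the other side. At level 0
    the truncations are empty and F^0 is everything. *)
Lemma is_ps_expm1 a g : linear a -> degmap C X 0 a -> (forall y, F 1%N (a y)) ->
  is_ps (exp_coef k) a g <-> is_ps (expm1_coef k) a (fun x => g x - e x).
Proof.
move=> la da Fa; have h n x : (0 < n)%N ->
    ev a (ptrunc n (exp_coef k)) x = ev a (ptrunc n (expm1_coef k)) x + e x.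
  case: n => // n _; rewrite !ev_ptrunc !big_ord_recl /= scale0r add0r addrC.
  by rewrite /exp_coef invr1 scale1r.
split=> hg [|n] x; try exact: hfil0.
  by have := hg n.+1 x; rewrite h // opprD addrA addrAC.
by have := hg n.+1 x; rewrite h // opprD addrA addrAC.
Qed.

End Coproducts.

(** * Exponential and logarithm as maps between morphisms and tangent morphisms *)

Section ExpLn.
Variables (k : fieldType) (H : chopf k).
Hypothesis char_k : [pchar k] =i pred0.
Local Notation X := (hdg H).
Local Notation F := (hfil H).
Local Notation e := (cunit H).
Implicit Types C D : ccdgc k.

Lemma thom_fil C (v : thom C H) x : F 1%N (v x).
Proof. by apply/hfil1; exact: thom_eps. Qed.

Lemma thom_chain C (v : thom C H) : chain v.
Proof.
move=> x; have := thom_dif v x; rewrite /hom_dif expr0 scale1r => /eqP.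
by rewrite subr_eq0 => /eqP.
Qed.

Lemma exp_spec C (v : thom C H) : exists g : mhom C H, is_ps (exp_coef k) v g.
Proof.
have lv := linearP v; have dv := @thom_deg _ _ _ v; have Fv := thom_fil v.
have [g hg] := ps_exists (exp_coef k) lv dv Fv.
have gd := is_ps_deg lv dv Fv hg; have gc := is_ps_chain lv dv (thom_chain v) hg.
have ge x : heps H (g x) = ceps C x.
  by rewrite (is_ps_eps x hg) /exp_coef invr1 mul1r.
have gg : grouplike g by apply: exp_grouplike hg => // x; exact: thom_del.
by exists (Mhom gd gc ge gg).
Qed.

Definition mhom_exp C (v : thom C H) : mhom C H := projT1 (cid (exp_spec v)).

Lemma mhom_exp_ps C (v : thom C H) : is_ps (exp_coef k) v (mhom_exp v).
Proof. exact: projT2 (cid (exp_spec v)). Qed.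

Definition mhom_bar C (g : mhom C H) (x : C) : H := g x - hunit H x.

Lemma mhom_bar_linear C (g : mhom C H) : linear (mhom_bar g).
Proof.
move=> a u v; rewrite /mhom_bar linearP [hunit _ _](@cunit_linear k C H) scalerBr opprD.
by rewrite addrACA.
Qed.

Lemma mhom_bar_deg C (g : mhom C H) : degmap C X 0 (mhom_bar g).
Proof.
move=> i x hx; apply: subspaceB; first exact: homog_subspace.
  exact: mhom_deg hx.
exact: cunit_deg hx.
Qed.

Lemma mhom_bar_chain C (g : mhom C H) : chain (mhom_bar g).
Proof. by move=> x; rewrite /mhom_bar mhom_dif [hunit _ _]cunit_chain -linearB. Qed.

Lemma mhom_bar_fil C (g : mhom C H) x : F 1%N (mhom_bar g x).
Proof.
apply/hfil1; have lh := linearP (heps H).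
by rewrite /mhom_bar (linB lh) mhom_eps /hunit (linZ lh) heps1 [_ *: _]mulr1 subrr.
Qed.

(** Both expansions are produced together: that the logarithm is tangent is deduced from [g] being
    its exponential, so this identity comes before the logarithm is known to be a [thom]. *)
Lemma ln_spec C (g : mhom C H) :
  exists2 v : thom C H, is_ps (ln1p_coef k) (mhom_bar g) v & is_ps (exp_coef k) v g.
Proof.
have lb := mhom_bar_linear g; have db := @mhom_bar_deg _ g; have Fb := mhom_bar_fil g.
have [v hv] := ps_exists (ln1p_coef k) lb db Fb.
have dv := is_ps_deg lb db Fb hv; have cv := is_ps_chain lb db (@mhom_bar_chain _ g) hv.
have Fv x : F 1%N (v x) by exact: is_ps_fil1 hv.
have lv := linearP v.
have gv : is_ps (exp_coef k) v g.
  apply/is_ps_expm1 => //.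
  (* [w] is exp(v) - 1; as a series in [mhom_bar g] it is the identity series, hence it equals
     [mhom_bar g]. *)
  have [w hw] := ps_exists (expm1_coef k) lv dv Fv.
  have : is_ps (fun i => (i == 1%N)%:R) (mhom_bar g) w.
    apply: is_ps_comp hv hw _ => // n.
    apply: pcong_trans (expm1_ln1p char_k n) _.
    by apply/pcongP => i il; rewrite coefX coef_poly il.
  move=> /(is_ps_X _ lb Fb) e n x; rewrite -/(mhom_bar g x) -e; exact: hw.
have tv : tangent v.
  apply: log_tangent gv => //; [exact: linearP|exact: mhom_deg|exact: mhom_del].
have ve x : heps H (v x) = 0 by apply/hfil1.
have vd x : hom_dif C X 0 v x = 0 by rewrite /hom_dif cv expr0 scale1r subrr.
by exists (Thom dv vd ve tv).
Qed.

End ExpLn.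

Definition mk_linear (k : fieldType) (V W : lmodType k) (f : V -> W) (lf : linear f) :
  {linear V -> W} := HB.pack f (GRing.isLinear.Build _ _ _ _ f lf).

(** * The cylinder coalgebra *)

Section Cylinder.
Variables (k : fieldType) (C : ccdgc k).

(* [tens {poly k} C] is the tensor product of [C] with the coalgebra dual to
   [k[t, dt]]: ['X^(2n)] is dual to [t^n] and ['X^(2n+1)], of degree 1, to
   [t^n dt]. A homotopy pair on maps from [C] is one chain map of degree 0 from
   this coalgebra. *)
Definition cyl : lmodType k := tens {poly k} C.

Definition cyl_in (m : nat) (c : C) : cyl := tpure 'X^m c.

Lemma cyl_in_linear m : linear (cyl_in m).
Proof. exact: (tpure_bilin {poly k} C).2. Qed.

HB.instance Definition _ m := GRing.isLinear.Build _ _ _ _ (cyl_in m) (cyl_in_linear m).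

Lemma cyl_ind (P : set cyl) : subspace P -> (forall m c, P (cyl_in m c)) -> forall x, P x.
Proof.
move=> sP hP x; rewrite [x]tens_sum; apply: subspace_sum => // -[p c] _ /=.
rewrite -[p]coefK poly_def (bilin_suml (tpure_bilin _ _)); apply: subspace_sum => // i _.
by rewrite (bilinZl (tpure_bilin {poly k} C)); apply: (subspaceZ _ sP); exact: hP.
Qed.

Lemma cyl_ext (U : lmodType k) (f g : cyl -> U) : linear f -> linear g ->
  (forall m c, f (cyl_in m c) = g (cyl_in m c)) -> f =1 g.
Proof.
move=> lf lg fg; apply: (cyl_ind (P := [set x | f x = g x])) => //.
by split=> [|a u v] /=; rewrite ?(lin0 lf) ?(lin0 lg) // lf lg => -> ->.
Qed.

Definition cyl_lift (U : lmodType k) (F : nat -> {linear C -> U}) : cyl -> U :=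
  tlift (fun (p : {poly k}) c => \sum_(i < size p) p`_i *: F i c).

Section Lift.
Variables (U : lmodType k) (F : nat -> {linear C -> U}).

Lemma cyl_lift_bilin : bilin (fun (p : {poly k}) c => \sum_(i < size p) p`_i *: F i c).
Proof.
have w (p : {poly k}) n c : (size p <= n)%N ->
    \sum_(i < size p) p`_i *: F i c = \sum_(i < n) p`_i *: F i c.
  move=> pn; rewrite (big_ord_widen _ (fun i => p`_i *: F i c) pn) big_mkcond.
  apply: eq_bigr => i _; case: ltnP => // /(nth_default 0) ->.
  by rewrite scale0r.
split=> [c a p q|p]; last first.
  by apply: linear_bigsum => i; apply: linear_scale; exact: linearP.
pose n := maxn (size (a *: p + q)) (maxn (size p) (size q)).
rewrite !(w _ n) ?leq_max ?leqnn ?orbT //.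
rewrite scaler_sumr -big_split; apply: eq_bigr => i _ /=.
by rewrite coefD coefZ scalerDl scalerA.
Qed.

Lemma cyl_lift_linear : linear (cyl_lift F).
Proof. exact/tliftP/cyl_lift_bilin. Qed.

HB.instance Definition _ := GRing.isLinear.Build _ _ _ _ (cyl_lift F) cyl_lift_linear.

Lemma cyl_lift_inj m c : cyl_lift F (cyl_in m c) = F m c.
Proof.
rewrite /cyl_lift /cyl_in tlift_pure; last exact: cyl_lift_bilin.
rewrite size_polyXn big_ord_recr /= coefXn eqxx scale1r big1 ?add0r // => i _.
by rewrite coefXn (ltn_eqF (ltn_ord i)) scale0r.
Qed.
End Lift.

Definition cyl_gpr (i : int) : {linear cyl -> cyl} :=
  cyl_lift (fun m => cyl_in m \o gpr C (i - (odd m)%:Z)).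

(** The transpose of d(t^(n+1)) = (n + 1) t^n dt: the differential of 'X^(2n+1) is (n + 1)
    'X^(2n+2), and even powers are cycles. *)
Definition cyl_dcoef (m : nat) : k := if odd m then m./2.+1%:R else 0.

Definition cyl_dif : {linear cyl -> cyl} :=
  cyl_lift (fun m => (cyl_dcoef m \*: cyl_in m.+1) \+ ((-1) ^+ m \*: (cyl_in m \o gdif C))).

Lemma cgpr_inj i m c : cyl_gpr i (cyl_in m c) = cyl_in m (gpr C (i - (odd m)%:Z) c).
Proof. exact: cyl_lift_inj. Qed.

Lemma cdif_inj m c :
  cyl_dif (cyl_in m c) = cyl_dcoef m *: cyl_in m.+1 c + (-1) ^+ m *: cyl_in m (gdif C c).
Proof. exact: cyl_lift_inj. Qed.

Fact cgpr_idem i j x : cyl_gpr i (cyl_gpr j x) = if i == j then cyl_gpr j x else 0.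
Proof.
move: x; apply: cyl_ext => [a u v|a u v|m c]; rewrite ?linearP //.
  by case: ifP; rewrite ?linearP // scaler0 addr0.
rewrite !cgpr_inj gpr_idem (inj_eq (addIr _)).
by case: ifP => // _; rewrite linear0.
Qed.

(** Asking the conclusion of every larger list makes the property stable under linear combinations,
    so it need only be checked on generators. *)
Lemma cgpr_cover x : exists r0 : seq int, forall r, uniq r -> {subset r0 <= r} ->
  (forall i, i \notin r -> cyl_gpr i x = 0) /\ x = \sum_(i <- r) cyl_gpr i x.
Proof.
move: x; apply: cyl_ind => [|m c].
  split=> [|a u v [r1 h1] [r2 h2]].
    by exists [::] => r _ _; split=> *; rewrite ?linear0 // big1 // => i _; rewrite linear0.
  exists (r1 ++ r2) => r ur sr.
  have [|z1 s1] := h1 r ur; first by move=> i ir; apply: sr; rewrite mem_cat ir.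
  have [|z2 s2] := h2 r ur; first by move=> i ir; apply: sr; rewrite mem_cat ir orbT.
  split=> [i ir|]; first by rewrite linearP z1 // z2 // scaler0 addr0.
  rewrite {1}s1 {1}s2 scaler_sumr -big_split; apply: eq_bigr => i _ /=.
  by rewrite linearP.
have [s [us hs]] := gpr_cover C c c.
exists [seq i + (odd m)%:Z | i <- s] => r ur sr.
have hr i : i \notin [seq j - (odd m)%:Z | j <- r] -> gpr C i c = 0.
  move=> ir; have /hs[] // : i \notin s.
  apply: contra ir => /(map_f (+%R^~ (odd m)%:Z))/sr ir.
  by apply/mapP; exists (i + (odd m)%:Z); rewrite // addrK.
split=> [i ir|].
  rewrite cgpr_inj hr ?linear0 //; apply: contra ir => /mapP[j jr /addIr ->].
  exact: jr.
under eq_bigr do rewrite cgpr_inj.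
rewrite -linear_sum -(big_map (fun i => i - (odd m)%:Z) xpredT (fun i => gpr C i c)).
rewrite -gpr_sum_cover // map_inj_uniq //; exact: addIr.
Qed.

Fact cgpr_fin x : finite_set [set i | cyl_gpr i x != 0].
Proof.
have [r0 /(_ (undup r0) (undup_uniq _))] := cgpr_cover x.
case=> [i|h _]; first by rewrite mem_undup.
apply: (sub_finite_set (B := [set` undup r0])); last exact: finite_seq.
by move=> i; apply: contraNT => /h ->.
Qed.

Fact cgpr_sum x : x = \sum_(i \in [set: int]) cyl_gpr i x.
Proof.
have [r0 /(_ (undup r0) (undup_uniq _))] := cgpr_cover x.
case=> [i|h e]; first by rewrite mem_undup.
rewrite (fsbigE (undup r0)) ?undup_uniq //; last by move=> i _ /h.
rewrite {1}e; apply: eq_bigl => i; by rewrite in_setT.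
Qed.

Lemma dcoef_even m : ~~ odd m -> cyl_dcoef m = 0.
Proof. by rewrite /cyl_dcoef => /negbTE ->. Qed.

Fact cdif_deg i x : cyl_dif (cyl_gpr i x) = cyl_gpr (i - 1) (cyl_dif x).
Proof.
move: x; apply: cyl_ext => [a u v|a u v|m c]; rewrite ?linearP //.
rewrite cgpr_inj !cdif_inj linearD !linearZ /= !cgpr_inj gdif_deg addrAC.
congr (_ + _); rewrite /cyl_dcoef /=; case: (odd m) => /=; last by rewrite !scale0r.
by rewrite subr0.
Qed.

Fact cdif_dif x : cyl_dif (cyl_dif x) = 0.
Proof.
move: x; apply: cyl_ext => [a u v|a u v|m c]; rewrite ?linearP ?scaler0 ?addr0 //.
rewrite cdif_inj linearD !linearZ /= !cdif_inj gdif_dif linear0 scaler0 addr0.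
rewrite scalerDr !scalerA -addrA -scalerDl exprS mulN1r mulrN [cyl_dcoef m * (-1) ^+ m]mulrC addNr scale0r addr0.
by rewrite /cyl_dcoef /=; case: (odd m); rewrite ?mulr0 ?mul0r scale0r.
Qed.

Definition cyl_dg : dgmod cyl :=
  DGmod cgpr_idem cgpr_fin cgpr_sum cdif_deg cdif_dif.

Definition ceps_cyl : {linear cyl -> k^o} :=
  cyl_lift (fun m => if m is 0%N then ceps C else \0).

Lemma ceps_cyl_inj m c : ceps_cyl (cyl_in m c) = if m is 0%N then ceps C c else 0.
Proof. by rewrite /ceps_cyl /= cyl_lift_inj; case: m. Qed.

Lemma homog_cyl_in i m c : homog C i c -> homog cyl_dg (i + (odd m)%:Z) (cyl_in m c).
Proof. by move=> hc; rewrite /homog /= cgpr_inj addrK hc. Qed.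

Lemma ksgn_cyl_in n m c : ksgn cyl_dg n (cyl_in m c) = (-1) ^+ (n * m) *: cyl_in m (ksgn C n c).
Proof.
move: c; apply: (homog_ext (X := C)).
- by apply: (linear_comp (f := ksgn _ n)); [exact: ksgn_linear|exact: linearP].
- by apply: linear_scale; apply: (linear_comp (f := cyl_in m)); [exact: linearP|exact: ksgn_linear].
move=> i c hc; rewrite (ksgn_homog n (homog_cyl_in m hc)) (ksgn_homog n hc) linearZ /= scalerA.
rewrite sign_absD mulrC; congr (_ * _ *: _).
by rewrite -signr_odd -[RHS]signr_odd !oddM /= oddb.
Qed.

(* the component of the coproduct of [cyl_in (a + b) c] at ['X^a (x) 'X^b], up to
   the coefficient [cyl_w a b] *)
Definition cyl_co a b (t : tens C C) : tens cyl cyl := gtmap C b (cyl_in a) (cyl_in b) t.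

Lemma cyl_co_linear a b : linear (cyl_co a b).
Proof. by apply: gtmap_linear; exact: linearP. Qed.

(** The transpose of multiplication in k[t, dt] on monomials: every product has coefficient 1,
    except that dt dt = 0. *)
Definition cyl_w (a b : nat) : k := (~~ (odd a && odd b))%:R.

Lemma cyl_del_linear m :
  linear (fun c => \sum_(i < m.+1) cyl_w i (m - i) *: cyl_co i (m - i) (cdel C c)).
Proof.
apply: linear_bigsum => i; apply: linear_scale.
by apply: (linear_comp (f := cyl_co _ _)); [exact: cyl_co_linear|exact: linearP].
Qed.

Definition cyl_del : {linear cyl -> tens cyl cyl} :=
  cyl_lift (fun m => mk_linear (cyl_del_linear m)).

Lemma cyl_del_inj m c : cyl_del (cyl_in m c) =
  \sum_(i < m.+1) cyl_w i (m - i) *: cyl_co i (m - i) (cdel C c).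
Proof. exact: cyl_lift_inj. Qed.

Lemma cyl_wC a b : cyl_w a b = cyl_w b a.
Proof. by rewrite /cyl_w andbC. Qed.

Lemma cyl_w_assoc a b c : cyl_w (a + b) c * cyl_w a b = cyl_w a (b + c) * cyl_w b c.
Proof.
rewrite /cyl_w !oddD -!natrM !mulnb; congr (_%:R); congr nat_of_bool.
by case: (odd a); case: (odd b); case: (odd c).
Qed.

Fact ceps_cyl_deg i x : i != 0 -> ceps_cyl (cyl_gpr i x) = 0.
Proof.
move=> i0; move: x; apply: cyl_ext => [a u v|a u v|m c]; rewrite ?linearP ?scaler0 ?addr0 //.
by rewrite cgpr_inj ceps_cyl_inj; case: m => //=; rewrite subr0 ceps_deg.
Qed.

Fact ceps_cyl_dif x : ceps_cyl (cyl_dif x) = 0.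
Proof.
move: x; apply: cyl_ext => [a u v|a u v|m c]; rewrite ?linearP ?scaler0 ?addr0 //.
rewrite cdif_inj linearD !linearZ /= !ceps_cyl_inj scaler0 add0r.
by case: m => [|m]; rewrite ?scaler0 // ceps_dif scaler0.
Qed.

Lemma cyl_co_pure a b c c' :
  cyl_co a b (tpure c c') = tpure (cyl_in a (ksgn C b c)) (cyl_in b c').
Proof.
rewrite /cyl_co /gtmap tmap_pure //; last exact: linearP.
by apply: (linear_comp (f := cyl_in a)); [exact: linearP|exact: ksgn_linear].
Qed.

Lemma tlift_cyl_co (U : lmodType k) (B : cyl -> cyl -> U) a b t : bilin B ->
  tlift B (cyl_co a b t) = tlift (fun y z => B (cyl_in a (ksgn C b y)) (cyl_in b z)) t.
Proof.
move=> bB; rewrite /cyl_co /gtmap tlift_tmap //; last exact: linearP.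
by apply: (linear_comp (f := cyl_in a)); [exact: linearP|exact: ksgn_linear].
Qed.

Fact cyl_del_deg i x : homog cyl_dg i x -> thomog cyl_dg cyl_dg i (cyl_del x).
Proof.
have sT := lspan_sub _ : subspace (thomog cyl_dg cyl_dg i).
rewrite /homog /= => <-; move: x; apply: cyl_ind => [|m c].
  split=> [|a u v hu hv] /=; first by rewrite !linear0; exact: sT.1.
  by rewrite !linearP; apply: sT.2.
rewrite cgpr_inj cyl_del_inj; apply: subspace_sum => // -[a am] _ /=.
rewrite /cyl_w; case: (boolP (odd a && odd (m - a))) => [_|ab]; rewrite ?scale0r ?scale1r.
  exact: sT.1.
apply: (lspan_map (cyl_co_linear _ _) sT _ (cdel_deg (gpr_homog C _ c))).
move=> _ [p [q [v [w [pq hv hw ->]]]]]; rewrite cyl_co_pure; apply: lspan_gen.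
exists (p + (odd a)%:Z), (q + (odd (m - a))%:Z), (cyl_in a (ksgn C (m - a) v)), (cyl_in (m - a) w).
split=> //; last 2 first.
- apply: homog_cyl_in; rewrite (ksgn_homog _ hv).
  by apply: subspaceZ => //; exact: homog_subspace.
- exact: homog_cyl_in.
(* The degrees of 'X^a and 'X^(m-a) are parity bits; they add up to that of 'X^m as integers because
   the case of two odd exponents has weight 0. *)
have -> : p + (odd a)%:Z + (q + (odd (m - a))%:Z) = p + q + (odd m)%:Z.
  rewrite addrACA; congr (_ + _).
  have -> : odd m = odd a (+) odd (m - a) by rewrite -oddD subnKC -1?ltnS.
  by case: (odd a) (odd (m - a)) ab => [] [].
by rewrite pq subrK.
Qed.

Fact cyl_del_epsl x : tlift (fun y z => ceps_cyl y *: z) (cyl_del x) = x.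
Proof.
have b : bilin (fun (y z : cyl) => ceps_cyl y *: z).
  split=> [z a u v|z a u v]; last by rewrite scalerDr !scalerA mulrC.
  by rewrite linearP scalerDl -scalerA.
have lt := tliftP b; move: x; apply: cyl_ext => [a u v|a u v|m c]; rewrite ?linearP ?lt //.
rewrite cyl_del_inj (lin_sum lt) big_ord_recl big1 ?addr0 => [|i _].
  rewrite (linZ lt) tlift_cyl_co // /cyl_w /= scale1r subn0 -[in RHS](cdel_epsl c).
  rewrite linear_sum_tlift; apply: eq_tlift => y z.
  by rewrite ceps_cyl_inj ceps_ksgn linearZ.
rewrite (linZ lt) tlift_cyl_co // /tlift big1 ?scaler0 // => p _.
by rewrite ceps_cyl_inj scale0r.
Qed.

Fact cyl_del_epsr x : tlift (fun y z => ceps_cyl z *: y) (cyl_del x) = x.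
Proof.
have b : bilin (fun (y z : cyl) => ceps_cyl z *: y).
  split=> [z a u v|z a u v]; first by rewrite scalerDr !scalerA mulrC.
  by rewrite linearP scalerDl -scalerA.
have lt := tliftP b; move: x; apply: cyl_ext => [a u v|a u v|m c]; rewrite ?linearP ?lt //.
rewrite cyl_del_inj (lin_sum lt) big_ord_recr /= big1 ?add0r => [|i _].
  rewrite (linZ lt) tlift_cyl_co // /cyl_w subnn andbF scale1r -[in RHS](cdel_epsr c).
  rewrite linear_sum_tlift; apply: eq_tlift => y z.
  by rewrite ceps_cyl_inj ksgn0 linearZ.
rewrite (linZ lt) tlift_cyl_co // /tlift big1 ?scaler0 // => p _.
rewrite ceps_cyl_inj; case E : (m - i)%N => [|n]; last by rewrite scale0r.
by move/eqP: E; rewrite subn_eq0 leqNgt ltn_ord.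
Qed.

Fact cyl_del_assoc x :
  tassoc (tmap cyl_del id (cyl_del x)) = tmap id cyl_del (cyl_del x).
Proof.
have ld := linearP cyl_del; have bp := tpure_bilin.
have ba (z : cyl) : bilin (fun v w : cyl => tpure v (tpure w z)).
  split=> [w a u v|v a u w]; first by rewrite (bp _ _ _).1.
  by rewrite (bp _ _ _).1 (bp _ _ _).2.
have bA : bilin (fun (t : tens cyl cyl) (z : cyl) => tlift (fun x y => tpure x (tpure y z)) t).
  split=> [z|t]; first exact: tliftP.
  by apply: tlift_linearl => v w a z z'; rewrite !(bp _ _ _).2.
have la : linear (@tassoc k cyl cyl cyl) by exact: tliftP.
have lm : linear (tmap cyl_del (@id cyl)) by exact: tmap_linear.
have lm' : linear (tmap (@id cyl) cyl_del) by exact: tmap_linear.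
move: x; apply: cyl_ext => [a u v|a u v|m c]; rewrite ?ld ?lm ?la ?lm' //.
have ls n := ksgn_linear C n.
have lis n m' : linear (fun y => cyl_in m' (ksgn C n y)).
  by apply: (linear_comp (f := cyl_in m')); [exact: linearP|].
(* The signs come from moving 'X^q and 'X^r past [y1], and 'X^r past [y2]. Both iterated coproducts
   become sums of the resulting [T p q r] over p + q + r = m. *)
pose S p q r y1 y2 z :=
  tpure (cyl_in p (ksgn C (q + r) y1)) (tpure (cyl_in q (ksgn C r y2)) (cyl_in r z)).
have tS p q r : trilin (S p q r).
  split=> v w a y y'; rewrite /S.
  - by rewrite lis (bp _ _ _).1.
  - by rewrite lis (bp _ _ _).1 (bp _ _ _).2.
  - by rewrite cyl_in_linear !(bp _ _ _).2.
pose T p q r := tlift (fun y z => tlift (fun y1 y2 => S p q r y1 y2 z) (cdel C y)) (cdel C c).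
have EL a b : tassoc (tmap cyl_del id (cyl_co a b (cdel C c))) =
    \sum_(j < a.+1) cyl_w j (a - j) *: T j (a - j)%N b.
  rewrite /tassoc tlift_tmap // tlift_cyl_co; last exact: (bilin_comp ld (@linear_idfun k cyl) bA).
  transitivity (tlift (fun y z => \sum_(j < a.+1) cyl_w j (a - j) *:
      tlift (fun y1 y2 => S j (a - j)%N b y1 y2 z) (cdel C y)) (cdel C c)).
    apply: eq_tlift => y z; rewrite cyl_del_inj (lin_sum (tliftP (ba _))).
    apply: eq_bigr => j _; rewrite (linZ (tliftP (ba _))) tlift_cyl_co // cdel_ksgn.
    rewrite tlift_tmap //; last first.
      exact: (bilin_comp (lis _ _) (linearP (cyl_in (a - j))) (ba _)).
    by congr (_ *: _); apply: eq_tlift => y1 y2; rewrite ksgnD.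
  by rewrite tlift_sum; apply: eq_bigr => j _; exact: tlift_scale2.
have ER a b : tmap id cyl_del (cyl_co a b (cdel C c)) =
    \sum_(j < b.+1) cyl_w j (b - j) *: T a j (b - j)%N.
  rewrite /tmap tlift_cyl_co; last exact: (bilin_comp (@linear_idfun k cyl) ld (bp _ _ _)).
  transitivity (tlift (fun y z => \sum_(j < b.+1) cyl_w j (b - j) *:
      tlift (fun z1 z2 => S a j (b - j)%N y z1 z2) (cdel C z)) (cdel C c)).
    apply: eq_tlift => y z; rewrite cyl_del_inj (lin_sum ((bp _ _ _).2 _)).
    apply: eq_bigr => j _; rewrite (linZ ((bp _ _ _).2 _)) /cyl_co /gtmap /tmap.
    rewrite (lin_tlift ((bp _ _ _).2 _)); congr (_ *: _); apply: eq_tlift => z1 z2.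
    by rewrite /S subnKC // -ltnS.
  rewrite tlift_sum; apply: eq_bigr => j _; rewrite tlift_scale2 /T.
  by rewrite cdel_coassoc.
rewrite cyl_del_inj (lin_sum lm) (lin_sum la) (lin_sum lm').
transitivity (\sum_(i < m.+1) \sum_(j < i.+1) (fun p q r =>
    (cyl_w (p + q) r * cyl_w p q) *: T p q r) j (i - j)%N (m - i)%N).
  apply: eq_bigr => i _; rewrite (linZ lm) (linZ la) EL scaler_sumr.
  by apply: eq_bigr => j _; rewrite scalerA subnKC // -ltnS.
rewrite (sum_assoc (fun p q r => (cyl_w (p + q) r * cyl_w p q) *: T p q r)).
apply: eq_bigr => i _; rewrite (linZ lm') ER scaler_sumr.
by apply: eq_bigr => j _; rewrite scalerA cyl_w_assoc subnKC // -ltnS.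
Qed.

(** Modulo 2, b i + (j + b) (i + a) = a b + j i + a j. *)
Lemma sign_swap (a b : nat) (i j : int) :
  (-1) ^+ (b * absz i) * (-1) ^+ (absz (j + (odd b)%:Z)%R * absz (i + (odd a)%:Z)%R) =
  (-1) ^+ (a * b) * ((-1) ^+ (absz j * absz i) * (-1) ^+ (a * absz j)) :> k.
Proof.
have o l c : odd (absz (l + (odd c)%:Z)%R) = odd (absz l) (+) odd c.
  by case: l => n; case: (odd c); rewrite ?addr0 ?addbF ?addbT //; lia.
rewrite -!exprD -signr_odd -[RHS]signr_odd; congr (_ ^+ nat_of_bool _).
rewrite !(oddD, oddM) !o.
by case: (odd a); case: (odd b); case: (odd (absz i)); case: (odd (absz j)).
Qed.

Lemma tswap_cyl_co a b t :
  tswap cyl_dg cyl_dg (cyl_co a b t) = (-1) ^+ (a * b) *: cyl_co b a (tswap C C t).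
Proof.
have bs (V : lmodType k) := bilin_swap (tpure_bilin V V).
have ls (V : lmodType k) (X : dgmod V) : linear (tswap X X).
  exact/tliftP/koszul_bilin.
move: t; apply: (tens_homog_ext (X := C) (Y := C)).
- exact: (linear_comp (ls _ _) (cyl_co_linear a b)).
- exact/linear_scale/(linear_comp (cyl_co_linear b a) (ls _ _)).
move=> i j v w hv hw; rewrite cyl_co_pure /tswap !tlift_pure; try exact: koszul_bilin.
rewrite (koszul_homogr _ _ (bs _) (homog_cyl_in b hw)) (koszul_homogr _ _ (bs _) hw).
rewrite (ksgn_homog _ hv) !linearZ /= (linZ (ksgn_linear _ _)).
rewrite (ksgn_homog _ (homog_cyl_in a hv)) (ksgn_homog _ hv).
have lc := cyl_co_linear b a; have bp := tpure_bilin.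
rewrite scalerA (bilinZr (bp _ _ _)) (bilinZr (bp _ _ _)) (linZ lc) cyl_co_pure.
rewrite (ksgn_homog _ hw) (linZ (cyl_in_linear b)) (bilinZl (bp _ _ _)) !scalerA.
by rewrite sign_swap mulrA.
Qed.

Fact cyl_del_comm x : tswap cyl_dg cyl_dg (cyl_del x) = cyl_del x.
Proof.
have ls : linear (tswap cyl_dg cyl_dg).
  by apply/tliftP/koszul_bilin/bilin_swap; exact: tpure_bilin.
move: x; apply: cyl_ext => [a u v|a u v|m c]; rewrite ?linearP ?ls //.
rewrite cyl_del_inj (lin_sum ls).
rewrite [RHS](sum_ord_rev (fun a b => cyl_w a b *: cyl_co a b (cdel C c))).
apply: eq_bigr => i _; rewrite (linZ ls) tswap_cyl_co cdel_comm scalerA cyl_wC.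
(* The remaining sign (-1)^(a b) differs from 1 only when both indices are odd, where the weight is
   0. *)
congr (_ *: _); rewrite /cyl_w andbC -signr_odd oddM.
by case: (odd i); case: (odd (m - i)); rewrite ?mulr1 ?mul0r.
Qed.

Lemma tdif_cyl_co a b t : tdif cyl_dg cyl_dg (cyl_co a b t) =
  cyl_dcoef a *: cyl_co a.+1 b t + (-1) ^+ a * cyl_dcoef b *: cyl_co a b.+1 t +
  (-1) ^+ (a + b) *: cyl_co a b (tdif C C t).
Proof.
have lc a' b' := cyl_co_linear a' b'.
move: t; apply: tens_linear_ext.
- exact: (linear_comp (tdif_linear _ _) (lc a b)).
- apply: linear_add; first by apply: linear_add; exact: linear_scale.
  exact/linear_scale/(linear_comp (lc a b) (tdif_linear _ _)).
move=> v w; have bp := tpure_bilin.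
rewrite !cyl_co_pure !tdif_pure (linD (lc a b)) !cyl_co_pure.
rewrite [gdif cyl_dg _]cdif_inj [gdif cyl_dg _]cdif_inj ksgn_cyl_in ksgnD add1n.
rewrite !(bilinDl (bp _ _ _), bilinDr (bp _ _ _), bilinZl (bp _ _ _), bilinZr (bp _ _ _)).
rewrite ksgn_dif (linZ (cyl_in_linear a)) (bilinZl (bp _ _ _)) ksgnD addn1 mul1n !scalerDr !scalerA.
rewrite exprD -[in RHS]mulrA sign_sq mulr1 -!addrA; congr (_ + _).
by rewrite addrCA.
Qed.

Fact cyl_del_dif x : cyl_del (cyl_dif x) = tdif cyl_dg cyl_dg (cyl_del x).
Proof.
have lt := tdif_linear cyl_dg cyl_dg; have lc a b := cyl_co_linear a b.
move: x; apply: cyl_ext => [a u v|a u v|m c]; rewrite ?linearP ?lt //.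
rewrite cdif_inj linearD !linearZ /= !cyl_del_inj (lin_sum lt) !scaler_sumr.
pose K i j := cyl_co i j (cdel C c).
(* [P i j] is the share of the first factor in the coefficient of [K i j]. On the left only even i
   and j contribute, with (m + 1) / 2 = i/2 + j/2; this split matches the differentials of the two
   tensor factors. *)
pose P i j : k := (~~ odd i && ~~ odd j)%:R * (i./2)%:R.
transitivity (\sum_(i < m.+1) (P i.+1 (m - i)%N *: K i.+1 (m - i)%N +
    P (m - i).+1 i *: K i (m - i).+1) +
  \sum_(i < m.+1) (-1) ^+ m *: (cyl_w i (m - i) *: cyl_co i (m - i) (cdel C (gdif C c)))).
  congr (_ + _); rewrite (sum_shift (P := P) (Q := fun i j => P j i)) => [|j|i];
    try by rewrite /P mulr0.
  apply: eq_bigr => -[i im] _ /=; rewrite scalerA; congr (_ *: _).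
  move: (subnKC (im : (i <= m.+1)%N)); set j := (m.+1 - i)%N => ij.
  rewrite /P (andbC (~~ odd j)) -mulrDr /cyl_w /cyl_dcoef.
  have -> : odd m = ~~ (odd i (+) odd j) by rewrite -oddD ij /= negbK.
  case oi: (odd i); case oj: (odd j); rewrite /= ?mul0r ?mulr0 // mul1r mulr1 -natrD.
  by congr (_%:R); lia.
rewrite -big_split; apply: eq_bigr => -[i im] _ /=.
rewrite (linZ lt) tdif_cyl_co subnKC // cdel_dif !scalerDr !scalerA.
congr (_ *: _ + _ *: _ + _ *: _); last exact: mulrC.
  rewrite /P /cyl_w /cyl_dcoef /= uphalf_half.
  by case: (odd i); case: (odd (m - i)); rewrite /= ?mul0r ?mulr0 ?mul1r ?mulr1 ?add1n ?mulr0.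
rewrite /P /cyl_w /cyl_dcoef /= uphalf_half -signr_odd.
by case: (odd i); case: (odd (m - i)); rewrite /= ?mul0r ?mulr0 ?mul1r ?mulr1 ?add1n ?mulr0.
Qed.

Definition cyl_ccdgc : ccdgc k := @Ccdgc k cyl cyl_dg ceps_cyl cyl_del ceps_cyl_deg ceps_cyl_dif cyl_del_deg
  cyl_del_dif cyl_del_assoc cyl_del_epsl cyl_del_epsr cyl_del_comm.

Fact inj0_deg : degmap C cyl_ccdgc 0 (cyl_in 0).
Proof. by move=> i c hc; have := homog_cyl_in 0 hc. Qed.
Fact inj0_dif c : cyl_in 0 (gdif C c) = gdif cyl_ccdgc (cyl_in 0 c).
Proof. by rewrite [RHS]cdif_inj dcoef_even // scale0r add0r scale1r. Qed.
Fact inj0_eps c : ceps cyl_ccdgc (cyl_in 0 c) = ceps C c.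
Proof. exact: ceps_cyl_inj. Qed.
Fact inj0_del c : cdel cyl_ccdgc (cyl_in 0 c) = tmap (cyl_in 0) (cyl_in 0) (cdel C c).
Proof.
rewrite [LHS]cyl_del_inj big_ord1 scale1r /cyl_co /gtmap.
by apply: eq_tmap => // y /=; rewrite ksgn0.
Qed.

(* the inclusion of [C] at [t = 0] *)
Definition cyl0 : chom C cyl_ccdgc := @Chom k C cyl_ccdgc (cyl_in 0) inj0_deg inj0_dif inj0_eps inj0_del.

End Cylinder.

Lemma hom_dif1 (k : fieldType) (V W : lmodType k) (X : dgmod V) (Y : dgmod W)
    (f : V -> W) v : hom_dif X Y 1 f v = gdif Y (f v) + f (gdif X v).
Proof. by rewrite /hom_dif expr1 scaleN1r opprK. Qed.

(** * Maps out of the cylinder *)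

Section CylinderMaps.
Variables (k : fieldType) (C : ccdgc k) (H : chopf k).
Local Notation X := (hdg H).
Local Notation F := (hfil H).
Local Notation F2 := (tens_filt F F).
Local Notation cyl := (cyl_ccdgc C).
Implicit Types (S T : cyl -> H) (f g : C -> H).

(** For m = 2i this is the coefficient of t^i, for m = 2i + 1 that of t^i dt. *)
Definition coefm S m (c : C) : H := S (cyl_in m c).

Lemma coefm_linear S m : linear S -> linear (coefm S m).
Proof. by move=> lS; apply: (linear_comp lS); exact: cyl_in_linear. Qed.

Lemma ctmap_inj S T m c : linear S -> linear T -> ctmap S T (cyl_in m c) =
  \sum_(i < m.+1) cyl_w k i (m - i) *:
    gtmap C (m - i) (coefm S i) (coefm T (m - i)) (cdel C c).
Proof.
move=> lS lT; rewrite /ctmap [cdel _ _]cyl_del_inj (lin_sum (tmap_linear lS lT)).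
apply: eq_bigr => i _; rewrite (linZ (tmap_linear lS lT)) /cyl_co gtmap_comp //;
exact: cyl_in_linear.
Qed.

Lemma conv_inj S T m c : linear S -> linear T -> conv S T (cyl_in m c) =
  \sum_(i < m.+1) cyl_w k i (m - i) *:
    tlift (fun y z => S (cyl_in i (ksgn C (m - i) y)) * T (cyl_in (m - i) z)) (cdel C c).
Proof.
move=> lS lT; have lt := tliftP (conv_bilin lS lT).
rewrite /conv [cdel _ _]cyl_del_inj (lin_sum lt); apply: eq_bigr => i _.
by rewrite (linZ lt) tlift_cyl_co //; exact: (conv_bilin lS lT).
Qed.

(** Two indices with an even sum have equal parity, and the weight removes the odd pairs. In
    [sum_odd] the parities differ and every weight is 1. *)
Lemma sum_even (V : lmodType k) (B : nat -> nat -> V) m :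
  \sum_(i < m.*2.+1) cyl_w k i (m.*2 - i) *: B i (m.*2 - i)%N =
  \sum_(i < m.+1) B i.*2 (m - i).*2.
Proof.
rewrite big_ord_recr [RHS]big_ord_recr /= !subnn.
rewrite (sum_pairs (fun i => cyl_w k i (m.*2 - i) *: B i (m.*2 - i)%N)) /cyl_w andbF scale1r.
congr (_ + _); apply: eq_bigr => i _; have im := ltn_ord i.
rewrite doubleB !oddB ?leq_double ?(ltnW im) ?ltn_double //= !odd_double /=.
by rewrite scale1r scale0r addr0.
Qed.

Lemma sum_odd (V : lmodType k) (B : nat -> nat -> V) m :
  \sum_(i < m.*2.+2) cyl_w k i (m.*2.+1 - i) *: B i (m.*2.+1 - i)%N =
  \sum_(i < m.+1) (B i.*2 (m - i).*2.+1 + B i.*2.+1 (m - i).*2).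
Proof.
rewrite -[m.*2.+2]/(m.+1.*2).
rewrite (sum_pairs (fun i => cyl_w k i (m.*2.+1 - i) *: B i (m.*2.+1 - i)%N)).
apply: eq_bigr => -[i im] _ /=; rewrite subSS -doubleB.
rewrite subSn ?leq_double // -doubleB /cyl_w /= !odd_double /=.
by rewrite !scale1r.
Qed.

Lemma conv_even S T m c : linear S -> linear T -> conv S T (cyl_in m.*2 c) =
  \sum_(i < m.+1) conv (coefm S i.*2) (coefm T (m - i).*2) c.
Proof.
move=> lS lT; rewrite conv_inj // (sum_even (fun i j => tlift (fun y z =>
  S (cyl_in i (ksgn C j y)) * T (cyl_in j z)) (cdel C c))).
apply: eq_bigr => i _; apply: eq_tlift => y z; congr (S (cyl_in _ _) * _).
by rewrite -ksgn_odd odd_double ksgn0.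
Qed.

Lemma ctmap_even S T m c : linear S -> linear T -> ctmap S T (cyl_in m.*2 c) =
  \sum_(i < m.+1) tmap (coefm S i.*2) (coefm T (m - i).*2) (cdel C c).
Proof.
move=> lS lT; rewrite ctmap_inj // (sum_even (fun i j =>
  gtmap C j (coefm S i) (coefm T j) (cdel C c))).
apply: eq_bigr => i _; apply: eq_tmap => // y /=.
by rewrite -ksgn_odd odd_double ksgn0.
Qed.

(** For S = T this is the right-hand side of the coproduct condition in [mhtpy]. *)
Lemma ctmap_odd S T m c : linear S -> linear T -> ctmap S T (cyl_in m.*2.+1 c) =
  \sum_(i < m.+1) (gtmap C 1 (coefm S i.*2) (coefm T (m - i).*2.+1) (cdel C c) +
                   tmap (coefm S i.*2.+1) (coefm T (m - i).*2) (cdel C c)).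
Proof.
move=> lS lT; rewrite ctmap_inj // (sum_odd (fun i j =>
  gtmap C j (coefm S i) (coefm T j) (cdel C c))).
apply: eq_bigr => i _; congr (_ + _); apply: eq_tmap => // y /=.
  by rewrite -ksgn_odd /= odd_double.
by rewrite -ksgn_odd odd_double ksgn0.
Qed.

Local Notation e := (cunit H).

Lemma cunit_inj m c : e (cyl_in m c : cyl) = if m is 0%N then e c else 0.
Proof. by rewrite /cunit [ceps _ _]ceps_cyl_inj; case: m => // m; rewrite scale0r. Qed.

Lemma ctmap_cunit_inj S m c : linear S ->
  ctmap e S (cyl_in m c) = tmap e (coefm S m) (cdel C c) /\
  ctmap S e (cyl_in m c) = tmap (coefm S m) e (cdel C c).
Proof.
move=> lS; have le : linear (e : cyl -> H) by exact: cunit_linear.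
have lc i := coefm_linear i lS; have ls n := ksgn_linear C n.
split; rewrite ctmap_inj //.
  rewrite big_ord_recl big1 ?addr0 => [|i _]; last first.
    by rewrite /gtmap tmap0l ?scaler0 // => y; rewrite /= /coefm cunit_inj.
  rewrite scale1r subn0; apply: eq_tmap => // y.
  by rewrite /= /coefm cunit_inj /cunit ceps_ksgn.
rewrite big_ord_recr /= big1 ?add0r => [|i _]; last first.
  rewrite /gtmap tmap0r ?scaler0 //; last exact: (linear_comp (lc i)).
  move=> y; rewrite /coefm cunit_inj; case E : (m - i)%N => [|j] //.
  by move/eqP: E; rewrite subn_eq0 leqNgt ltn_ord.
rewrite subnn /cyl_w andbF scale1r; apply: eq_tmap => y; first by rewrite /= ksgn0.
by rewrite /coefm cunit_inj.
Qed.

Lemma cyl_degmap S : linear S -> (forall m, degmap C X (odd m) (coefm S m)) <->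
  degmap cyl X 0 S.
Proof.
move=> lS; split=> [h i x|h m i c hc]; last first.
  by have := h _ _ (homog_cyl_in m hc); rewrite addr0.
rewrite addr0 => <-; move: x; apply: cyl_ind => [|m c].
  split=> [|a u v hu hv] /=; first by rewrite linear0 (lin0 lS); exact: (homog_subspace X i).1.
  by rewrite linearP lS; apply: (homog_subspace X i).2.
by rewrite [gpr _ _ _]cgpr_inj; have := h m _ _ (gpr_homog C (i - (odd m)%:Z) c); rewrite subrK.
Qed.

(** On even generators the condition says that the coefficients of f(t) are chain maps; on odd ones,
    where the differential also raises the exponent, it is the homotopy equation. *)
Lemma cyl_chain S : linear S -> chain S <->
  (forall i c, coefm S i.*2 (gdif C c) = gdif X (coefm S i.*2 c)) /\
  (forall i c, i.+1%:R *: coefm S i.+1.*2 c = hom_dif C X 1 (coefm S i.*2.+1) c).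
Proof.
move=> lS; have E m c : S (gdif cyl (cyl_in m c)) =
    cyl_dcoef k m *: coefm S m.+1 c + (-1) ^+ m *: coefm S m (gdif C c).
  by rewrite [gdif _ _]cdif_inj (linD lS) !(linZ lS).
have sg m : (-1) ^+ m.*2 = 1 :> k by rewrite -signr_odd odd_double.
split=> [h|[h1 h2] x].
  split=> i c; first by rewrite -[RHS]h E dcoef_even ?odd_double // scale0r add0r sg scale1r.
  rewrite hom_dif1 -[gdif X _]h E /cyl_dcoef /= odd_double /= uphalf_double.
  by rewrite exprS sg mulr1 scaleN1r subrK.
move: x; apply: cyl_ext => [||m c].
- exact: (linear_comp lS (linearP _)).
- exact: (linear_comp (linearP (gdif X)) lS).
rewrite E -[m]odd_double_half; case: (odd m); rewrite /= ?add1n ?add0n.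
  have := h2 m./2 c; rewrite hom_dif1 /cyl_dcoef /= odd_double /= uphalf_double => ->.
  by rewrite exprS sg mulr1 scaleN1r addrK.
by rewrite dcoef_even ?odd_double // scale0r add0r sg scale1r h1.
Qed.

Lemma cyl_eps S (r : cyl -> k^o) : linear S -> linear r ->
  (forall m c, heps H (coefm S m c) = r (cyl_in m c)) -> forall x, heps H (S x) = r x.
Proof.
by move=> lS lr h; apply: cyl_ext => //; exact: (linear_comp (linearP (heps H)) lS).
Qed.

Lemma cyl_hdel S (T : cyl -> tens H H) : linear S -> linear T ->
  (forall m c, hdel H (coefm S m c) = cpl_eta F2 (T (cyl_in m c))) ->
  forall x, hdel H (S x) = cpl_eta F2 (T x).
Proof.
move=> lS lT; apply: cyl_ext; first exact: (linear_comp (linearP (hdel H)) lS).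
exact: (linear_comp (cpl_eta_linear F2) lT).
Qed.

(* the coefficients of [S] in [t] tend to 0 uniformly *)
Definition tends S := forall n, exists N, forall m c, (N <= m)%N -> F n (S (cyl_in m c)).

(* [g] is the value of [S] at [t = 1], [dt = 0] *)
Definition at1 S g := forall n, exists N, forall M c, (N <= M)%N ->
  F n (g c - \sum_(i < M) S (cyl_in i.*2 c)).

Lemma fil_tail (V : lmodType k) (G : filt V) n (t : nat -> V) N M :
  (N <= M)%N -> (forall i, (N <= i)%N -> G n (t i)) ->
  G n (\sum_(i < M) t i - \sum_(i < N) t i).
Proof.
move=> NM h; rewrite -!(big_mkord xpredT) (big_cat_nat _ _ (n := N)) // addrAC subrr add0r.
by rewrite big_nat; apply: fil_sum => i /andP[Ni _]; exact: h.
Qed.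

Lemma tends_cunit : tends e.
Proof. by move=> n; exists 1%N => -[|m] // c _; rewrite cunit_inj; exact: fil0. Qed.

Lemma at1_cunit : at1 e e.
Proof.
move=> n; exists 1%N => -[|M] // c _; rewrite big_ord_recl big1 => [|i _].
  by rewrite addr0 cunit_inj subrr; exact: fil0.
by rewrite cunit_inj.
Qed.

Lemma hfil_mull n (x y : H) : F n x -> F n (x * y).
Proof. by move=> Fx; rewrite -[n]addn0; apply: hfil_mul => //; exact: hfil0. Qed.

Lemma hfil_mulr n (x y : H) : F n y -> F n (x * y).
Proof. by move=> Fy; rewrite -[n]add0n; apply: hfil_mul => //; exact: hfil0. Qed.

Lemma tends_conv S T : linear S -> linear T -> tends S -> tends T -> tends (conv S T).
Proof.
move=> lS lT tS tT n; have [N hN] := tS n; have [N' hN'] := tT n.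
exists (N + N')%N => m c Nm; rewrite conv_inj //; apply: fil_sum => i _.
apply: filZ; apply: tlift_fil => y z; case: (leqP N i) => [Ni|iN].
  by apply: hfil_mull; exact: hN.
apply: hfil_mulr; apply: hN'; rewrite leq_subRL; last by rewrite -ltnS.
by apply: leq_trans Nm; rewrite leq_add2r ltnW.
Qed.

(** A Cauchy product: modulo F^n, the partial sum over a triangle agrees with the product of two
    partial sums, since every other term has an index large enough to lie in F^n. *)
Lemma at1_conv S T f g : linear S -> linear T -> tends S -> tends T ->
  at1 S f -> at1 T g -> at1 (conv S T) (conv f g).
Proof.
move=> lS lT tS tT Sf Tg n.
have [N1 h1] := tS n; have [N2 h2] := tT n; have [N3 h3] := Sf n; have [N4 h4] := Tg n.
pose N := maxn (maxn N1 N2) (maxn N3 N4).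
have [l1 l2] : (N1 <= N)%N /\ (N2 <= N)%N by rewrite !leq_max !leqnn !orbT.
have [l3 l4] : (N3 <= N)%N /\ (N4 <= N)%N by rewrite !leq_max !leqnn !orbT.
have dbl i : (N <= i)%N -> (N <= i.*2)%N by move=> Ni; rewrite -addnn (leq_trans Ni) ?leq_addr.
have ml i c : (N <= i)%N -> F n (S (cyl_in i.*2 c)).
  by move=> /dbl Ni; apply: h1; exact: leq_trans l1 Ni.
have mr i c : (N <= i)%N -> F n (T (cyl_in i.*2 c)).
  by move=> /dbl Ni; apply: h2; exact: leq_trans l2 Ni.
pose B i j c := conv (coefm S i.*2) (coefm T j.*2) c.
(* From 2N on, the triangle i + j < M contains the square of side N. *)
exists (N + N)%N => M c NM.
have -> : \sum_(i < M) conv S T (cyl_in i.*2 c) = \sum_(i < M) \sum_(j < M - i) B i j c.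
  rewrite -(sum_triangle (fun i j => B i j c)); apply: eq_bigr => m _.
  exact: conv_even.
rewrite -(subrKA (\sum_(i < N) \sum_(j < N) B i j c)); apply: filD.
  have -> : \sum_(i < N) \sum_(j < N) B i j c =
      conv (fun c => \sum_(i < N) coefm S i.*2 c) (fun c => \sum_(i < N) coefm T i.*2 c) c.
    by rewrite conv_suml; apply: eq_bigr => i _; rewrite conv_sumr.
  by apply: conv_congr => y; [exact: h3|exact: h4].
apply: filC; rewrite -(subrKA (\sum_(i < N) \sum_(j < M - i) B i j c)); apply: filD.
  apply: (@fil_tail _ _ n (fun i => \sum_(j < M - i) B i j c)) => [|i Ni].
    exact: leq_trans (leq_addr _ _) NM.
  by apply: fil_sum => j _; apply: tlift_fil => y z; apply: hfil_mull; exact: ml.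
rewrite -sumrB; apply: fil_sum => i _; apply: (@fil_tail _ _ n (fun j => B i j c)) => [|j Nj].
  rewrite leq_subRL; first by apply: leq_trans NM; rewrite leq_add2r ltnW.
  by apply: leq_trans (ltnW (ltn_ord i)) (leq_trans (leq_addr _ _) NM).
by apply: tlift_fil => y z; apply: hfil_mulr; exact: mr.
Qed.

Lemma tends_cpow S n : linear S -> tends S -> tends (cpow S n).
Proof.
move=> lS tS; elim: n => [|n IH]; first exact: tends_cunit.
by apply: tends_conv => //; exact: cpow_linear.
Qed.

Lemma at1_cpow S g n : linear S -> tends S -> at1 S g -> at1 (cpow S n) (cpow g n).
Proof.
move=> lS tS Sg; elim: n => [|n IH]; first exact: at1_cunit.
by apply: at1_conv => //; [exact: cpow_linear|exact: tends_cpow].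
Qed.

Lemma tends_ev S p : linear S -> tends S -> tends (ev S p).
Proof.
move=> lS tS n; rewrite /ev; elim: (size p) => [|d [N IH]].
  by exists 0%N => m c _; rewrite big_ord0; exact: fil0.
have [N' hN'] := tends_cpow d lS tS n.
exists (maxn N N') => m c; rewrite geq_max => /andP[h1 h2].
by rewrite big_ord_recr; apply: filD; [exact: IH|apply: filZ; exact: hN'].
Qed.

Lemma at1_ev S g p : linear S -> tends S -> at1 S g -> at1 (ev S p) (ev g p).
Proof.
move=> lS tS Sg n; rewrite /ev; elim: (size p) => [|d [N IH]].
  exists 0%N => M c _; rewrite big_ord0 big1 ?subrr => [|i _]; first exact: fil0.
  by rewrite big_ord0.
have [N' hN'] := at1_cpow d lS tS Sg n.
exists (maxn N N') => M c; rewrite geq_max => /andP[h1 h2].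
under [X in _ - X]eq_bigr do rewrite big_ord_recr.
rewrite big_split big_ord_recr opprD addrACA; apply: filD; first exact: IH.
by rewrite -scaler_sumr -scalerBr; apply: filZ; exact: hN'.
Qed.

Lemma tends_ps cf S T : linear S -> tends S -> is_ps cf S T -> tends T.
Proof.
move=> lS tS ST n; have [N hN] := tends_ev (ptrunc n cf) lS tS n.
exists N => m c Nm; rewrite -(subrK (ev S (ptrunc n cf) (cyl_in m c)) (T _)).
by apply: filD; [exact: ST|exact: hN].
Qed.

Lemma at1_ps cf S T f g : linear S -> tends S -> at1 S f ->
  is_ps cf S T -> is_ps cf f g -> at1 T g.
Proof.
move=> lS tS Sf ST fg n; have [N hN] := at1_ev (ptrunc n cf) lS tS Sf n.
exists N => M c NM; rewrite -(subrKA (ev f (ptrunc n cf) c)); apply: filD; first exact: fg.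
rewrite -(subrKA (\sum_(i < M) ev S (ptrunc n cf) (cyl_in i.*2 c))); apply: filD.
  exact: hN.
by rewrite -sumrB; apply: fil_sum => i _; apply: filC; exact: ST.
Qed.

Lemma at1_series S g c : at1 S g -> series_sum F (fun i => S (cyl_in i.*2 c)) (g c).
Proof. by move=> Sg n; have [N hN] := Sg n; exists N => m; exact: hN. Qed.

(** Pointwise convergence becomes uniform: the tails are bounded independently of [c] by [tends],
    and the bound depending on [c] serves only to choose a longer partial sum to compare with. *)
Lemma series_at1 S g : tends S ->
  (forall c, series_sum F (fun i => S (cyl_in i.*2 c)) (g c)) -> at1 S g.
Proof.
move=> tS h n; have [N hN] := tS n; exists N => M c NM.
have [N' hN'] := h c n; rewrite -(subrKA (\sum_(i < maxn M N') S (cyl_in i.*2 c))).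
apply: filD; first by apply: hN'; exact: leq_maxr.
apply: (@fil_tail _ _ n (fun i => S (cyl_in i.*2 c))); first exact: leq_maxl.
move=> i Mi; apply: hN; apply: leq_trans NM (leq_trans Mi _).
by rewrite -addnn leq_addr.
Qed.

End CylinderMaps.

(** * Homotopies *)

Section Homotopies.
Variables (k : fieldType) (C : ccdgc k) (H : chopf k).
Hypothesis char_k : [pchar k] =i pred0.
Local Notation X := (hdg H).
Local Notation F := (hfil H).
Local Notation F2 := (tens_filt F F).
Local Notation cyl := (cyl_ccdgc C).
Local Notation e := (cunit H).

Lemma tmap_scalel (V W V' W' : lmodType k) a (f : V -> V') (g : W -> W') t :
  tmap (fun x => a *: f x) g t = a *: tmap f g t.
Proof.
rewrite /tmap -tlift_scale2; apply: eq_tlift => y z.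
by rewrite (bilinZl (tpure_bilin _ _)).
Qed.

Lemma tmap_scaler (V W V' W' : lmodType k) a (f : V -> V') (g : W -> W') t :
  tmap f (fun x => a *: g x) t = a *: tmap f g t.
Proof.
rewrite /tmap -tlift_scale2; apply: eq_tlift => y z.
by rewrite (bilinZr (tpure_bilin _ _)).
Qed.

Lemma hom_dif_linear n (f : C -> H) : linear f -> linear (hom_dif C X n f).
Proof.
move=> lf a u v; rewrite /hom_dif linearP !lf linearP scalerBr scalerDr opprD !scalerA.
by rewrite [a * _]mulrC addrACA.
Qed.

Section Tdif.
Variables (f xi : C -> H).
Hypotheses (lf : linear f) (lx : linear xi) (df : degmap C X 0 f) (cf : chain f)
  (dx : degmap C X 1 xi).

(** The differential of f (x) xi in the Hom complex is f (x) d xi, as [f] is a chain map of degree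
    0; the plus sign reflects the total degree 1. *)
Lemma tdif_gtmap t : tdif X X (gtmap C 1 f xi t) + gtmap C 1 f xi (tdif C C t) =
  tmap f (hom_dif C X 1 xi) t.
Proof.
have lk := ksgn_linear C 1; have lfk := linear_comp lf lk.
have lt := tdif_linear X X; have lt' := tdif_linear C C; have lg := gtmap_linear C 1 lf lx.
have lh := hom_dif_linear 1 lx; have bp := tpure_bilin H H.
move: t; apply: tens_linear_ext.
- by apply: linear_add; [exact: (linear_comp lt lg)|exact: (linear_comp lg lt')].
- exact: tmap_linear.
move=> v w; rewrite tdif_pure (linD lg) /gtmap !tmap_pure //= tdif_pure.
rewrite -cf (@ksgn_degmap _ _ _ C X 0%N) // muln0 scale1r ksgn2 hom_dif1.
rewrite ksgn_dif expr1 scaleN1r -scaleN1r (linZ lf) (bilinZl bp) scaleN1r.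
by rewrite addrACA subrr add0r -(bilinDr bp).
Qed.

Lemma tdif_tmap t : tdif X X (tmap xi f t) + tmap xi f (tdif C C t) =
  tmap (hom_dif C X 1 xi) f t.
Proof.
have lt := tdif_linear X X; have lt' := tdif_linear C C; have lg := tmap_linear lx lf.
have lh := hom_dif_linear 1 lx; have bp := tpure_bilin H H.
move: t; apply: tens_linear_ext.
- by apply: linear_add; [exact: (linear_comp lt lg)|exact: (linear_comp lg lt')].
- exact: tmap_linear.
move=> v w; rewrite tdif_pure (linD lg) !tmap_pure // tdif_pure.
rewrite cf (@ksgn_degmap _ _ _ C X 1%N) // expr1 (bilinZl bp) scaleN1r hom_dif1.
by rewrite addrACA addNr addr0 -(bilinDl bp).
Qed.

End Tdif.

Lemma hdel_hom_dif (xi : {linear C -> H}) (S : tens C C -> tens H H) x : linear S ->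
  (forall x, hdel H (xi x) = cpl_eta F2 (S (cdel C x))) ->
  hdel H (hom_dif C X 1 xi x) =
  cpl_eta F2 (tdif X X (S (cdel C x)) + S (tdif C C (cdel C x))).
Proof.
move=> lS h; rewrite hom_dif1 linearD h (hdel_dif_eta (h x)) cdel_dif.
exact/esym/(linD (cpl_eta_linear F2)).
Qed.

Section FromHomotopy.
Variables f xi : nat -> {linear C -> H}.

Definition total_fam m : {linear C -> H} := if odd m then xi m./2 else f m./2.

Definition total : {linear cyl -> H} := cyl_lift total_fam.

Lemma total_coef m c : coefm total m c = total_fam m c.
Proof. exact: cyl_lift_inj. Qed.

Lemma total_even i c : coefm total i.*2 c = f i c.
Proof. by rewrite total_coef /total_fam odd_double doubleK. Qed.

Lemma total_odd i c : coefm total i.*2.+1 c = xi i c.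
Proof. by rewrite total_coef /total_fam /= odd_double /= uphalf_double. Qed.

Hypothesis bound : forall n, exists N, forall i x, (N <= i)%N -> F n (f i x) /\ F n (xi i x).
Hypothesis deg : forall i, degmap C X 0 (f i) /\ degmap C X 1 (xi i).
Hypothesis deriv : forall i x, i.+1%:R *: f i.+1 x = hom_dif C X 1 (xi i) x.
Hypothesis chain0 : chain (f 0%N).

(** A positive coefficient of f(t) is, up to an invertible scalar, a boundary in the Hom complex,
    hence a cycle there. *)
Lemma total_chain_even i : chain (f i).
Proof.
case: i => [|i] x; first exact: chain0.
apply: (scalerI (natS_neq0 char_k i)); rewrite deriv -linearZ deriv /= !hom_dif1.
by rewrite linearD !gdif_dif linear0 addr0 add0r.
Qed.

Lemma total_tends : tends total.
Proof.
move=> n; have [N hN] := bound n; exists N.*2 => m c Nm.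
rewrite -[total _]/(coefm total m c) -[m]odd_double_half.
have Nm2 : (N <= m./2)%N by rewrite -[N]doubleK half_leq.
by case: (odd m); rewrite ?add1n ?add0n ?total_odd ?total_even; have [] := hN _ c Nm2.
Qed.

Lemma total_deg : degmap cyl X 0 total.
Proof.
apply/cyl_degmap => [|m i c hc]; first exact: linearP.
rewrite -[m]odd_double_half; have [df dx] := deg m./2.
case: (odd m); rewrite ?add1n ?add0n ?total_odd ?total_even /= odd_double; last exact: df.
exact: dx.
Qed.

Lemma total_chain : chain total.
Proof.
apply/cyl_chain; first exact: linearP.
have eo i : coefm total i.*2.+1 = xi i by apply/funext => c; exact: total_odd.
split=> i c; last by rewrite eo total_even deriv.
by rewrite !total_even total_chain_even.
Qed.

End FromHomotopy.

(** For i > 0 the counit and coproduct conditions on [f i] are not part of a homotopy pair. They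
    result from applying the differential to those on [s i.-1] and cancelling the factor [i]. *)
Lemma thtpy_cyl (f s : nat -> {linear C -> H}) (v : thom C H) : thtpy f s ->
  f 0%N =1 v -> exists V : thom cyl H, V =1 total f s.
Proof.
move=> h f0; have ls i := linearP (s i); have lf i := linearP (f i).
have c0 : chain (f 0%N) by move=> x; rewrite !f0; exact: thom_chain.
have tc := total_chain (thtpy_deriv h) c0; have td := total_deg (thtpy_deg h).
have lT := linearP (total f s); have le := @cunit_linear k C H.
have eo i : coefm (total f s) i.*2.+1 = s i by apply/funext => c; exact: total_odd.
have ee i : coefm (total f s) i.*2 = f i by apply/funext => c; exact: total_even.
have dif0 x : hom_dif cyl X 0 (total f s) x = 0.
  by rewrite /hom_dif tc expr0 scale1r subrr.
have eps0 x : heps H (total f s x) = 0.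
  apply: (@cyl_eps _ _ _ _ (fun=> 0)) => // [|m c]; first by move=> a u w; rewrite scaler0 addr0.
  rewrite -[m]odd_double_half; case: (odd m); rewrite ?add1n ?add0n.
    by rewrite total_odd (thtpy_eps h).
  rewrite total_even; case: m./2 => [|i]; first by rewrite f0 thom_eps.
  apply: (scalerI (natS_neq0 char_k i)); rewrite -linearZ (thtpy_deriv h) hom_dif1 /=.
  by rewrite linearD heps_dif (thtpy_eps h) addr0 scaler0.
have del x : hdel H (total f s x) =
    cpl_eta F2 (ctmap e (total f s) x + ctmap (total f s) e x).
  apply: (@cyl_hdel _ _ _ _ (fun x => ctmap e (total f s) x + ctmap (total f s) e x)) => //.
    by apply: linear_add; apply: ctmap_linear => //; exact: cunit_linear.
  move=> m c; have [-> ->] := ctmap_cunit_inj m c lT.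
  have ke : e \o ksgn C 1 = e by apply/funext => y; rewrite /= /cunit ceps_ksgn.
  rewrite -[m]odd_double_half; case: (odd m); rewrite ?add1n ?add0n.
    by rewrite eo (thtpy_del h) /gtmap [hunit _ \o _]ke.
  rewrite ee; case: m./2 => [|i].
    rewrite f0 thom_del; congr (cpl_eta _ (_ + _)); apply: eq_tmap => // y; by rewrite f0.
  pose S t := gtmap C 1 e (s i) t + tmap (s i) e t.
  have lS : linear S by apply: linear_add; [exact: gtmap_linear|exact: tmap_linear].
  apply: (scalerI (natS_neq0 char_k i)); rewrite -linearZ /= (thtpy_deriv h).
  rewrite (@hdel_hom_dif _ S) //; last exact: (thtpy_del h i).
  have de := @cunit_deg _ C H; have ce := @cunit_chain _ C H.
  have ds := (thtpy_deg h i).2.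
  have hd : hom_dif C X 1 (s i) = fun x => i.+1%:R *: f i.+1 x.
    by apply/funext => y; rewrite -(thtpy_deriv h).
  rewrite (linD (tdif_linear X X)) addrACA tdif_gtmap // tdif_tmap // hd.
  by rewrite tmap_scaler tmap_scalel -scalerDr (linZ (cpl_eta_linear F2)).
by exists (@Thom k cyl H (total f s) td dif0 eps0 del).
Qed.

Lemma mhtpy_cyl (f xi : nat -> {linear C -> H}) (g : mhom C H) : mhtpy f xi ->
  f 0%N =1 g -> exists G : mhom cyl H, G =1 total f xi.
Proof.
move=> h f0; have lx i := linearP (xi i); have lf i := linearP (f i).
have c0 : chain (f 0%N) by move=> x; rewrite !f0; exact: mhom_dif.
have cf := total_chain_even (mhtpy_deriv h) c0.
have tc := total_chain (mhtpy_deriv h) c0; have td := total_deg (mhtpy_deg h).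
have lT := linearP (total f xi).
have eo i : coefm (total f xi) i.*2.+1 = xi i by apply/funext => c; exact: total_odd.
have ee i : coefm (total f xi) i.*2 = f i by apply/funext => c; exact: total_even.
have eps x : heps H (total f xi x) = ceps cyl x.
  apply: (@cyl_eps _ _ _ _ (ceps cyl)) => // [|m c]; first exact: linearP.
  rewrite [RHS]ceps_cyl_inj -[m]odd_double_half; case: (odd m); rewrite ?add1n ?add0n.
    by rewrite total_odd (mhtpy_eps h).
  rewrite total_even; case: m./2 => [|i]; first by rewrite f0 mhom_eps.
  apply: (scalerI (natS_neq0 char_k i)); rewrite -linearZ (mhtpy_deriv h) hom_dif1 /=.
  by rewrite linearD heps_dif (mhtpy_eps h) addr0 scaler0.
have del x : hdel H (total f xi x) =
    cpl_eta F2 (ctmap (total f xi) (total f xi) x).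
  apply: cyl_hdel => // [|m c]; first exact: ctmap_linear.
  rewrite -[m]odd_double_half; case: (odd m); rewrite ?add1n ?add0n.
    rewrite ctmap_odd // eo (mhtpy_del h); congr (cpl_eta _ _).
    by apply: eq_bigr => i _; rewrite !eo !ee.
  rewrite ctmap_even // ee; case: m./2 => [|i].
    rewrite big_ord1 ee f0 mhom_del; congr (cpl_eta _ _).
    by apply: eq_tmap => y; rewrite f0.
  pose S t := \sum_(j < i.+1) (gtmap C 1 (f j) (xi (i - j)%N) t + tmap (xi j) (f (i - j)%N) t).
  have lS : linear S.
    by apply: linear_bigsum => j; apply: linear_add; [exact: gtmap_linear|exact: tmap_linear].
  apply: (scalerI (natS_neq0 char_k i)); rewrite -linearZ /= (mhtpy_deriv h).
  rewrite (@hdel_hom_dif _ S) //; last exact: (mhtpy_del h i).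
  rewrite -(linZ (cpl_eta_linear F2)); congr (cpl_eta _ _).
  under [in RHS]eq_bigr do rewrite !ee.
  (* The coproduct condition on f(t) is quadratic, so its derivative in t is expanded by the Leibniz
     rule and matched with the differential of the condition on xi(t). *)
  rewrite -(sum_deriv (fun a b => tmap (f a) (f b) (cdel C c))).
  rewrite (lin_sum (tdif_linear X X)) -big_split; apply: eq_bigr => j _ /=.
  have hd l : hom_dif C X 1 (xi l) = fun x => l.+1%:R *: f l.+1 x.
    by apply/funext => y; rewrite -(mhtpy_deriv h).
  have df l := (mhtpy_deg h l).1; have dx l := (mhtpy_deg h l).2.
  rewrite (linD (tdif_linear X X)) addrACA tdif_gtmap // tdif_tmap // !hd.
  by rewrite tmap_scaler tmap_scalel addrC.
by exists (@Mhom k cyl H (total f xi) td tc eps del).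
Qed.

Section ToHomotopy.
Variable S : {linear cyl -> H}.
Let f i : {linear C -> H} := mk_linear (coefm_linear i.*2 (linearP S)).
Let xi i : {linear C -> H} := mk_linear (coefm_linear i.*2.+1 (linearP S)).

Lemma tends_bound : tends S ->
  forall n, exists N, forall i x, (N <= i)%N -> F n (f i x) /\ F n (xi i x).
Proof.
move=> tS n; have [N hN] := tS n; exists N => i x Ni.
have Ni2 : (N <= i.*2)%N by rewrite -addnn (leq_trans Ni) ?leq_addr.
by split; apply: hN => //; exact: leqW.
Qed.

Lemma coefm_deg : degmap cyl X 0 S -> forall i, degmap C X 0 (f i) /\ degmap C X 1 (xi i).
Proof.
move=> /(cyl_degmap (linearP S)) h i.
by split; [have := h i.*2|have := h i.*2.+1]; rewrite /= odd_double.
Qed.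

Lemma coefm_deriv : chain S ->
  forall i x, i.+1%:R *: f i.+1 x = hom_dif C X 1 (xi i) x.
Proof. by move=> /(cyl_chain (linearP S))[_ h] i x; exact: h. Qed.

End ToHomotopy.

Lemma cyl_mhomotopic (G : mhom cyl H) (g g' : mhom C H) : tends G ->
  (forall c, G (cyl_in 0 c) = g c) -> at1 G g' -> mhomotopic g g'.
Proof.
move=> tG G0 G1; have lG := linearP G.
exists (fun i => mk_linear (coefm_linear i.*2 lG)), (fun i => mk_linear (coefm_linear i.*2.+1 lG)).
split; [|exact: G0|by move=> x; exact: at1_series]; split.
- exact: tends_bound.
- exact/coefm_deg/mhom_deg.
- by apply: coefm_deriv; exact: mhom_dif.
- by move=> i x; rewrite [LHS]mhom_eps; exact: ceps_cyl_inj.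
- move=> n x; rewrite [LHS]mhom_del; congr (cpl_eta _ _).
  exact: ctmap_odd.
Qed.

Lemma cyl_thomotopic (V : thom cyl H) (v v' : thom C H) : tends V ->
  (forall c, V (cyl_in 0 c) = v c) -> at1 V v' -> thomotopic v v'.
Proof.
move=> tV V0 V1; have lV := linearP V.
exists (fun i => mk_linear (coefm_linear i.*2 lV)), (fun i => mk_linear (coefm_linear i.*2.+1 lV)).
split; [|exact: V0|by move=> x; exact: at1_series]; split.
- exact: tends_bound.
- exact/coefm_deg/thom_deg.
- by apply: coefm_deriv; exact: thom_chain.
- by move=> i x; rewrite [LHS]thom_eps.
- move=> n x; rewrite [LHS]thom_del; congr (cpl_eta _ _).
  have [E1 E2] := ctmap_cunit_inj n.*2.+1 x lV.
  rewrite -[LHS]/(ctmap e V (cyl_in n.*2.+1 x) + ctmap V e (cyl_in n.*2.+1 x)) E1 E2.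
  by congr (_ + _); apply: eq_tmap => // y; rewrite /= /hunit ceps_ksgn.
Qed.

End Homotopies.

(** * Convolution powers as iterated products and coproducts *)

Section IteratedProducts.
Variables (k : fieldType) (C : ccdgc k) (H : chopf k).

Lemma cdel_iter_linear n : linear (@cdel_iter k C n).
Proof.
elim: n => [//|n IH] /=.
by apply: (linear_comp (f := tmap id _)); [exact: tmap_linear|exact: linearP].
Qed.

Lemma tpow_map_linear (V W : lmodType k) (f : V -> W) n : linear f -> linear (@tpow_map k V W f n).
Proof. by move=> lf; elim: n => [//|n IH] /=; exact: tmap_linear. Qed.

Lemma hmul_iter_bilin n : linear (@hmul_iter k H n) ->
  bilin (fun (x : H) t => x * @hmul_iter k H n t).
Proof. by move=> lh; exact: (bilin_comp (@linear_idfun k H) lh (bilin_mul H)). Qed.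

Lemma hmul_iter_linear n : linear (@hmul_iter k H n).
Proof. by elim: n => [//|n IH] /=; exact/tliftP/hmul_iter_bilin. Qed.

(** Both sides associate to the right; [cpow] has one extra factor at the end, the convolution unit,
    which [conv1r] removes at the base of the induction. *)
Lemma hconv_cpow (f : C -> H) n x : linear f -> hconv f n.+1 x = cpow f n.+1 x.
Proof.
move=> lf; rewrite /hconv /=; elim: n x => [|n IH] x; first by rewrite /= conv1r.
have lt : linear (@tpow_map k C H f n) by exact: tpow_map_linear.
have lc := @cdel_iter_linear n.
rewrite [cdel_iter _ _]/= [tpow_map _ _]/= [hmul_iter _]/= tmap_comp //.
rewrite tlift_tmap //; last exact/hmul_iter_bilin/hmul_iter_linear.
  by apply: eq_tlift => y z /=; rewrite IH.
exact: linear_comp.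
Qed.

End IteratedProducts.

(** * Exponential and logarithm on homotopy types *)

Section ExpLnHomotopy.
Variables (k : fieldType) (H : chopf k).
Hypothesis char_k : [pchar k] =i pred0.
Local Notation F := (hfil H).
Implicit Types C D : ccdgc k.

Definition thom_ln C (g : mhom C H) : thom C H := projT1 (cid2 (ln_spec char_k g)).

Lemma thom_ln_ps C (g : mhom C H) : is_ps (ln1p_coef k) (mhom_bar g) (thom_ln g).
Proof. by rewrite /thom_ln; case: cid2. Qed.

Lemma mhom_exp_ln_ps C (g : mhom C H) : is_ps (exp_coef k) (thom_ln g) g.
Proof. by rewrite /thom_ln; case: cid2. Qed.

Local Notation mhom_exp := (mhom_exp char_k).

Lemma mhom_exp_ln C (g : mhom C H) : mhom_exp (thom_ln g) =1 g.
Proof. exact: is_ps_uniq (mhom_exp_ps char_k (thom_ln g)) (mhom_exp_ln_ps g). Qed.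

Lemma mhom_exp_bar C (v : thom C H) : is_ps (expm1_coef k) v (mhom_bar (mhom_exp v)).
Proof.
apply/is_ps_expm1; try exact: linearP; try exact: thom_deg; try exact: thom_fil.
exact: mhom_exp_ps.
Qed.

Lemma thom_ln_exp C (v : thom C H) : thom_ln (mhom_exp v) =1 v.
Proof.
have lv := linearP v; have Fv := thom_fil v.
apply/(is_ps_X _ lv Fv).
apply: is_ps_comp (mhom_exp_bar v) (thom_ln_ps _) _ => //; [exact: mhom_bar_linear|exact: mhom_bar_fil|].
move=> n; apply: pcong_trans (ln1p_expm1 char_k n) _.
by apply/pcongP => i il; rewrite coefX coef_poly il.
Qed.

(** The displayed series start at the first power, so the vanishing constant term is dropped and the
    index moves by one. *)
Lemma series_sum_shift c C (a : C -> H) x y : c 0%N = 0 -> linear a ->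
  series_sum F (fun i => c i *: cpow a i x) y ->
  series_sum F (fun i => c i.+1 *: hconv a i.+1 x) y.
Proof.
move=> c0 la h n; have [N hN] := h n; exists N => m Nm.
have := hN m.+1 (leqW Nm); rewrite big_ord_recl c0 scale0r add0r.
by under [X in F _ (_ - X) -> _]eq_bigr do rewrite -hconv_cpow //.
Qed.

Lemma is_exp_mhom_exp C (v : thom C H) : is_exp v (mhom_exp v).
Proof.
move=> x; apply: (@series_sum_shift (expm1_coef k)) => //; first exact: linearP.
exact: (is_ps_series x (mhom_exp_bar v)).
Qed.

Lemma is_ln_thom_ln C (g : mhom C H) : is_ln g (thom_ln g).
Proof.
move=> x n; have [N hN] := series_sum_shift (c := ln1p_coef k) erefl (mhom_bar_linear g)
  (is_ps_series x (thom_ln_ps g)) n.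
exists N => m /hN; congr (F n (_ - _)); apply: eq_bigr => i _.
by rewrite /ln1p_coef scaleNr.
Qed.

Lemma mhom_exp_pre C D (v : thom D H) (f : chom C D) :
  mhom_exp (thom_pre v f) =1 mhom_pre (mhom_exp v) f.
Proof.
apply: (is_ps_uniq (mhom_exp_ps char_k (thom_pre v f))).
exact: (is_ps_pre f (linearP v) (mhom_exp_ps char_k v)).
Qed.

Lemma thom_ln_pre C D (g : mhom D H) (f : chom C D) :
  thom_ln (mhom_pre g f) =1 thom_pre (thom_ln g) f.
Proof.
apply: (is_ps_uniq (thom_ln_ps (mhom_pre g f))).
have -> : mhom_bar (mhom_pre g f) = mhom_bar g \o f.
  by apply/funext => x; rewrite /mhom_bar /= -(hunit_comp H f).
exact: (is_ps_pre f (mhom_bar_linear g) (thom_ln_ps g)).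
Qed.

Lemma tends_bar C (G : mhom (cyl_ccdgc C) H) : tends G -> tends (mhom_bar G).
Proof.
move=> tG n; have [N hN] := tG n; have [N' hN'] := @tends_cunit _ C H n.
exists (maxn N N') => m c; rewrite geq_max => /andP[h h'].
by apply: filB; [exact: hN|exact: hN'].
Qed.

Lemma at1_bar C (G : mhom (cyl_ccdgc C) H) (g : mhom C H) : at1 G g -> at1 (mhom_bar G) (mhom_bar g).
Proof.
move=> Gg n; have [N hN] := Gg n; have [N' hN'] := @at1_cunit _ C H n.
exists (maxn N N') => M c; rewrite geq_max => /andP[h h'].
rewrite /mhom_bar sumrB (_ : _ - _ = (g c - \sum_(i < M) G (cyl_in i.*2 c)) -
    (cunit H c - \sum_(i < M) cunit H (cyl_in i.*2 c : cyl_ccdgc C))).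
  by apply: filB; [exact: hN|exact: hN'].
by rewrite !opprD !opprK addrACA.
Qed.

(** The exponential of the map on the cylinder is the new homotopy. Its value at t = 0 is found by
    naturality along [cyl0], its value at t = 1 by [at1_ps]. *)
Lemma mhom_exp_homotopic C (v v' : thom C H) :
  thomotopic v v' -> mhomotopic (mhom_exp v) (mhom_exp v').
Proof.
case=> f [s [h f0 f1]]; have [V /funext EV] := thtpy_cyl char_k h f0.
have tV : tends V by rewrite EV; exact/total_tends/thtpy_bound/h.
have V0 : V \o cyl0 C = v by apply/funext => c; rewrite EV -f0; exact: (total_even f s 0).
have V1 : at1 V v'.
  apply: series_at1 => // c; rewrite EV.
  by rewrite (_ : (fun i => _) = f^~ c); [exact: f1|apply/funext => i; exact: total_even].
have lV := linearP V.
apply: (cyl_mhomotopic (G := mhom_exp V)).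
- exact: tends_ps lV tV (mhom_exp_ps char_k V).
- move=> c; move: c; apply: (@is_ps_uniq _ C H (exp_coef k) v) (mhom_exp_ps char_k v).
  by rewrite -V0; exact: (is_ps_pre (cyl0 C) lV (mhom_exp_ps char_k V)).
- exact: at1_ps lV tV V1 (mhom_exp_ps char_k V) (mhom_exp_ps char_k v').
Qed.

Lemma thom_ln_homotopic C (g g' : mhom C H) :
  mhomotopic g g' -> thomotopic (thom_ln g) (thom_ln g').
Proof.
case=> f [xi [h f0 f1]]; have [G /funext EG] := mhtpy_cyl char_k h f0.
have tG : tends G by rewrite EG; exact/total_tends/mhtpy_bound/h.
have G0 c : G (cyl_in 0 c) = g c by rewrite EG -f0; exact: (total_even f xi 0).
have G1 : at1 G g'.
  apply: series_at1 => // c; rewrite EG.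
  by rewrite (_ : (fun i => _) = f^~ c); [exact: f1|apply/funext => i; exact: total_even].
have lG := mhom_bar_linear G; have tb := tends_bar tG.
apply: (cyl_thomotopic (V := thom_ln G)).
- exact: tends_ps lG tb (thom_ln_ps G).
- move=> c; move: c; apply: (@is_ps_uniq _ C H (ln1p_coef k) (mhom_bar g)) (thom_ln_ps g).
  (* Subtracting the unit commutes with restriction to t = 0 because the unit of the cylinder
     restricts to that of [C]. *)
  have -> : mhom_bar g = mhom_bar G \o cyl0 C.
    apply/funext => c; rewrite /mhom_bar -G0; congr (_ - _).
    exact/esym/(cunit_inj _ 0 c).
  exact: (is_ps_pre (cyl0 C) lG (thom_ln_ps G)).
- exact: at1_ps lG tb (at1_bar G1) (thom_ln_ps G) (thom_ln_ps g').
Qed.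

Definition ho_exp C (x : ho_thom C H) : ho_mhom C H := class_of _ (mhom_exp (class_repr x)).

Lemma ho_expE C (v : thom C H) : ho_exp (class_of _ v) = class_of _ (mhom_exp v).
Proof.
apply/class_eqP; apply: (rst_map (h := fun v => mhom_exp v)) (class_repr_of _ v).
exact: mhom_exp_homotopic.
Qed.

Definition ho_ln C (y : ho_mhom C H) : ho_thom C H := class_of _ (thom_ln (class_repr y)).

Lemma ho_lnE C (g : mhom C H) : ho_ln (class_of _ g) = class_of _ (thom_ln g).
Proof.
apply/class_eqP; apply: (rst_map (h := fun g => thom_ln g)) (class_repr_of _ g).
exact: thom_ln_homotopic.
Qed.

Fact ho_exp_nat C D (f : ho_hom C D) (x : ho_thom D H) :
  ho_exp (hoTP_arr f x) = hoP_arr f (ho_exp x).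
Proof.
rewrite -[f]class_reprK -[x]class_reprK hoTP_arrE // !ho_expE hoP_arrE.
exact/class_eqP/rst_step/mhomotopic_ext/mhom_exp_pre.
Qed.

Fact ho_ln_nat C D (f : ho_hom C D) (y : ho_mhom D H) :
  ho_ln (hoP_arr f y) = hoTP_arr f (ho_ln y).
Proof.
rewrite -[f]class_reprK -[y]class_reprK hoP_arrE !ho_lnE hoTP_arrE //.
exact/class_eqP/rst_step/thomotopic_ext/thom_ln_pre.
Qed.

End ExpLnHomotopy.

Theorem theorem3p3 (k : fieldType) (char_k : [pchar k]%R =i pred0) (H : chopf k) :
  exists (exp : nattrans (psh_TP char_k H) (psh_P H))
         (ln : nattrans (psh_P H) (psh_TP char_k H)),
    [/\ forall (C : ccdgc k) (x : ho_thom C H), ln C (exp C x) = x,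
        forall (C : ccdgc k) (y : ho_mhom C H), exp C (ln C y) = y,
        forall (C : ccdgc k) (v : thom C H), exists2 g : mhom C H,
          is_exp v g & exp C (class_of _ v) = class_of _ g
      & forall (C : ccdgc k) (g : mhom C H), exists2 v : thom C H,
          is_ln g v & ln C (class_of _ g) = class_of _ v].
Proof.
exists (@Nattrans _ (psh_TP char_k H) (psh_P H) _ (ho_exp_nat char_k (H := H))).
exists (@Nattrans _ (psh_P H) (psh_TP char_k H) _ (ho_ln_nat char_k (H := H))).
split=> [C x|C y|C v|C g] /=.
- rewrite -[x]class_reprK ho_expE ho_lnE.
  exact/class_eqP/rst_step/thomotopic_ext/thom_ln_exp.
- rewrite -[y]class_reprK ho_lnE ho_expE.
  exact/class_eqP/rst_step/mhomotopic_ext/mhom_exp_ln.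
- by exists (mhom_exp char_k v); [exact: is_exp_mhom_exp|exact: ho_expE].
- by exists (thom_ln char_k g); [exact: is_ln_thom_ln|exact: ho_lnE].
Qed.
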